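(* Let $n\ge2$, $P_0,P_1\in\mathcal{L}_a$, and let $\varphi_1$ be the exponentially concave function on $\Delta_n$ whose portfolio map $\boldsymbol{\pi}_1$ induces the optimal transport map $T_1(p)=p\odot\boldsymbol{\pi}_1(p^{-1})$ from $P_0$ to $P_1$ for the cost $c$. Assume that $\varphi_1$ is twice continuously differentiable on $\Delta_n$ and that the quadratic form $-\nabla^2\varphi_1(r)-\nabla\varphi_1(r)\otimes\nabla\varphi_1(r)$ is strictly positive definite on vectors $v\in\mathbb{R}^n$ with $\sum_iv_i=0$, for every $r\in\Delta_n$. Let $0\le t\le1$, $P_t=(T_t)_{\#}P_0$ with $T_t(p)=p\odot\boldsymbol{\pi}_t(p^{-1})$ and $\boldsymbol{\pi}_t=(1-t)\overline{e}+t\boldsymbol{\pi}_1$, and let $\rho_0=dP_0/d\mu_0$, $\rho_t=dP_t/d\mu_0$. For $p\in\Delta_n$, put $r=p^{-1}$, $q=T_t(p)$ and $\pi=(\pi_1,\dots,\pi_n)=\boldsymbol{\pi}_t(r)$. Then $$\rho_t(q)=\rho_0(p)\,\frac{\pi_1\cdots\pi_n}{\det(\tilde L_t(r))}\,\frac{1}{r_1^2\cdots r_n^2}.$$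
   Context: Simplex: $\Delta_n=\{p\in(0,1)^n:\sum_ip_i=1\}$, $\overline{e}=(1/n,\dots,1/n)$. Group operation: $(p\odot q)_i=\frac{p_iq_i}{\sum_jp_jq_j}$; inverse: $(p^{-1})_i=\frac{1/p_i}{\sum_j1/p_j}$. Cost: $c(p,q)=\log\left(\frac1n\sum_i\frac{q_i}{p_i}\right)-\frac1n\sum_i\log\frac{q_i}{p_i}$. $\mathcal{L}_a$: Borel probability measures $P$ on $\Delta_n$ with $\sum_i\int|\log p_i|\,dP<\infty$ that are absolutely continuous with respect to $(n-1)$-dimensional Lebesgue measure on $\Delta_n$. $\varphi$ is exponentially concave if $e^\varphi$ is concave; its portfolio map is $(\boldsymbol{\pi}(r))_i=r_i(1+\nabla_{e_i-r}\varphi(r))$, with $e_i$ the standard basis of $\mathbb{R}^n$. Known fact: for $P_0,P_1\in\mathcal{L}_a$ a $\varphi_1$ exists such that $T_1$ is the $P_0$-a.e. unique optimal transport map from $P_0$ to $P_1$ for $c$. Reference measure: in coordinates $(p_1,\dots,p_{n-1})\in\mathcal{D}_{n-1}=\{p_i>0,\ p_1+\cdots+p_{n-1}<1\}$, $p_n=1-\sum_{i<n}p_i$, $d\mu_0(p)=\frac{1}{p_1\cdots p_n}dp_1\cdots dp_{n-1}$. Densities are defined up to $\mu_0$-null sets and the identity is understood accordingly. Let $\varphi_0(r)=\frac1n\sum_i\log r_i$ and $\varphi_t=(1-t)\varphi_0+t\varphi_1$ (its portfolio map is $\boldsymbol{\pi}_t$). For $r\in\Delta_n$ let $\tilde r=(r_1,\dots,r_{n-1})\in\mathcal{D}_{n-1}$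 and write $\varphi_t(r)=\tilde\varphi_t(\tilde r)$ as a function of $\tilde r$. Then $\tilde L_t(r)=\tilde L_t(\tilde r)=-\nabla^2\tilde\varphi_t(\tilde r)-(\nabla\tilde\varphi_t(\tilde r))(\nabla\tilde\varphi_t(\tilde r))^\top$, an $(n-1)\times(n-1)$ matrix. *)

(* Defs.v *)
From HB Require Import structures.
From mathcomp Require Import all_boot all_order all_algebra.
From mathcomp Require Import all_classical all_reals all_analysis.
From mathcomp Require Import measurable_realfun.

Set Implicit Arguments.
Unset Strict Implicit.
Unset Printing Implicit Defensive.

Import Order.TTheory GRing.Theory Num.Theory.
Import numFieldNormedType.Exports.

Local Open Scope classical_set_scope.
Local Open Scope ring_scope.

(* 'M[R]_(m, n), in particular R^n = 'rV[R]_n, gets its Borel sigma-algebra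
   (generated by the open sets of the topology, not by the coordinates). *)
HB.instance Definition _ (R : realType) (m n : nat) :=
  @isMeasurable.Build (sigma_display (@open 'M[R]_(m, n))) 'M[R]_(m, n)
    <<s @open 'M[R]_(m, n) >> (@sigma_algebra0 _ setT _)
    (@sigma_algebraC _ (@open 'M[R]_(m, n)))
    (@sigma_algebra_bigcup _ setT _).

Section borel.
Context {R : realType}.

Lemma open_measurable_mx (m n : nat) (U : set 'M[R]_(m, n)) :
  open U -> measurable U.
Proof. by move=> oU; apply: sub_sigma_algebra. Qed.

Lemma measurable_fun_mx d (T : measurableType d) (m n : nat)
    (f : T -> 'M[R]_(m, n)) :
  (forall i j, measurable_fun setT (fun x => f x i j)) -> measurable_fun setT f.
Proof.
move=> mf.
apply: (@measurability _ _ _ _ _ _ (@open 'M[R]_(m, n))) => //.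
move=> _ [U oU <-]; rewrite setTI.
pose I : set ('M[rat]_(m, n) * rat) := [set qe | 0 < qe.2 /\
  ball (map_mx ratr qe.1 : 'M[R]_(m, n)) (ratr qe.2 : R) `<=` U].
pose B (qe : 'M[rat]_(m, n) * rat) : set T :=
  \bigcap_(ij in [set: 'I_m * 'I_n])
      (fun x => f x ij.1 ij.2) @^-1` ball (ratr (qe.1 ij.1 ij.2) : R) (ratr qe.2).
have -> : f @^-1` U = \bigcup_(qe in I) B qe.
  apply/seteqP; split=> [x /= Ux|x [[q e] [/= e0 sU] xq]].
  - have /nbhs_ballP[r /= r0 rU] := open_nbhs_nbhs (conj oU Ux).
    have [e] := rat_in_itvoo (divr_gt0 r0 (ltr0n R 2)).
    rewrite in_itv/= => /andP[e0 er].
    have e0' : (0 < e)%R by rewrite -(ltr0q R).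
    have qP i j : {q : rat | ball (ratr q : R) (ratr e) (f x i j)}.
      apply: cid.
      have lt : f x i j - ratr e < f x i j + ratr e.
        by rewrite ltrD2l gtrN.
      have [q] := rat_in_itvoo lt; rewrite in_itv/= => /andP[q1 q2].
      exists q; rewrite /ball/= ltr_distlC; apply/andP; split.
        by rewrite ltrBlDr.
      by rewrite -ltrBlDr.
    exists (\matrix_(i, j) sval (qP i j), e).
      split=> //= y [_ qy]; apply: rU; split => // i j.
      have := qy i j; rewrite !mxE => qy'.
      rewrite (splitr r).
      apply: (@ball_triangle _ _ (ratr (sval (qP i j)) : R)).
        by apply: ball_sym; exact: lt_trans (svalP (qP i j)) er.
      exact: lt_trans qy' er.
    by move=> [i j] _ /=; rewrite mxE; exact: (svalP (qP i j)).
  - apply: sU; split=> [|i j]; first by rewrite ltr0q.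
    by rewrite mxE; exact: (xq (i, j)).
rewrite bigcup_mkcond; apply: countable_bigcupT_measurable => // qe.
case: ifPn => // _.
apply: fin_bigcap_measurable => // -[i j] _ /=.
rewrite -[X in measurable X]setTI; apply: mf => //.
by rewrite ball_itv; exact: measurable_itv.
Qed.

Lemma measurable_coord (m n : nat) (i : 'I_m) (j : 'I_n) :
  measurable_fun setT (fun M : 'M[R]_(m, n) => M i j).
Proof.
apply: (measurability _ (RGenOpens.measurableE R)).
move=> _ [_ [a [b ->]] <-]; rewrite setTI; apply: open_measurable_mx.
apply: open_comp; last exact: interval_open.
by move=> M _; exact: coord_continuous.
Qed.


Definition row_cons (n : nat) (vx : 'rV[R]_n * R) : 'rV[R]_n.+1 :=
  row_mx vx.2%:M vx.1 : 'rV[R]_(1 + n).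

Lemma measurable_row_cons (n : nat) : measurable_fun setT (@row_cons n).
Proof.
apply: measurable_fun_mx => i j; rewrite (ord1 i).
case: (@split_ordP 1 n j) => k ->.
- rewrite [X in measurable_fun _ X](_ : _ = snd); first exact: measurable_snd.
  apply/funext => vx; apply: etrans; first exact: row_mxEl.
  by rewrite mxE (ord1 k).
- rewrite [X in measurable_fun _ X](_ : _ = (fun v : 'rV[R]_n => v 0 k) \o fst).
    by apply: measurableT_comp; [exact: measurable_coord|exact: measurable_fst].
  by apply/funext => vx; apply: etrans; first exact: row_mxEr.
Qed.

End borel.

Definition image_measure d d' (T : measurableType d) (T' : measurableType d')
    (R : realType) (mu : {measure set T -> \bar R}) (f : T -> T')
    (mf : measurable_fun setT f) : {measure set T' -> \bar R}.
Proof. by refine [the measure _ _ of pushforward mu f]. Defined.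

Fixpoint lebesgue_rV (R : realType) (n : nat) :
    {measure set 'rV[R]_n -> \bar R} :=
  match n with
  | 0 => \d_(0 : 'rV[R]_0)
  | n'.+1 => image_measure (lebesgue_rV R n' \x lebesgue_measure)%E
               (@measurable_row_cons R n')
  end.

Section simplex.
Context {R : realType}.

Definition simplex (n : nat) : set 'rV[R]_n :=
  [set p | (forall i, 0 < p 0 i < 1) /\ \sum_i p 0 i = 1].

Definition barycenter (n : nat) : 'rV[R]_n := const_mx n%:R^-1.

Definition odot (n : nat) (p q : 'rV[R]_n) : 'rV[R]_n :=
  \row_i (p 0 i * q 0 i / \sum_j p 0 j * q 0 j).

Definition simplex_inv (n : nat) (p : 'rV[R]_n) : 'rV[R]_n :=
  \row_i ((p 0 i)^-1 / \sum_j (p 0 j)^-1).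

Definition cost (n : nat) (p q : 'rV[R]_n) : R :=
  ln (n%:R^-1 * \sum_i q 0 i / p 0 i) -
  n%:R^-1 * \sum_i ln (q 0 i / p 0 i).

(* The simplex of R^(m+1) is parametrized by its first m coordinates. *)
Definition coord_domain (m : nat) : set 'rV[R]_m :=
  [set x | (forall i, 0 < x 0 i) /\ \sum_i x 0 i < 1].

Definition chart (m : nat) (x : 'rV[R]_m) : 'rV[R]_m.+1 :=
  \row_i if unlift ord_max i is Some j then x 0 j else 1 - \sum_j x 0 j.

Definition drop_last (m : nat) (r : 'rV[R]_m.+1) : 'rV[R]_m :=
  \row_j r 0 (lift ord_max j).

Lemma measurable_chart_coord (m : nat) (i : 'I_m.+1) :
  measurable_fun setT (fun x : 'rV[R]_m => chart x 0 i).
Proof.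
under eq_fun do rewrite mxE.
case: unlift => [j|]; first exact: measurable_coord.
apply: measurable_funB => //; apply: measurable_sum => j.
exact: measurable_coord.
Qed.

Lemma measurable_chart (m : nat) : measurable_fun setT (@chart m).
Proof.
apply: measurable_fun_mx => i j; rewrite (ord1 i).
exact: measurable_chart_coord.
Qed.

Lemma coord_domainE (m : nat) : @coord_domain m =
  \bigcap_(i in [set: 'I_m.+1]) [set x | 0 < chart x 0 i].
Proof.
apply/seteqP; split=> [x [x0 x1] i _ /=|x xP].
  by rewrite mxE; case: unlift => [j|] //; rewrite subr_gt0.
split=> [i|].
  by have := xP (lift ord_max i) I; rewrite /= mxE liftK.
by have := xP ord_max I; rewrite /= mxE unlift_none subr_gt0.
Qed.

Lemma measurable_coord_domain (m : nat) : measurable (@coord_domain m).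
Proof.
rewrite coord_domainE; apply: fin_bigcap_measurable => // i _.
rewrite -[X in measurable X]setTI.
have -> : [set x : 'rV[R]_m | 0 < chart x 0 i] =
          (fun x : 'rV[R]_m => chart x 0 i) @^-1` `]0, +oo[.
  by apply/seteqP; split=> x /=; rewrite in_itv/= andbT.
exact: measurable_chart_coord.
Qed.

(* (n-1)-dimensional Lebesgue measure on the simplex, read in the chart; any
   other normalization differs by a constant factor. *)
Definition simplex_lebesgue (m : nat) : {measure set 'rV[R]_m.+1 -> \bar R} :=
  image_measure (mrestr (lebesgue_rV R m) (@measurable_coord_domain m))
    (@measurable_chart m).

Definition mu0 (m : nat) (A : set 'rV[R]_m.+1) : \bar R :=
  (\int[lebesgue_rV R m]_(x in @coord_domain m `&` @chart m @^-1` A)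
     ((\prod_i chart x 0 i)^-1)%:E)%E.

Let chart_gt0 (m : nat) (x : 'rV[R]_m) :
  coord_domain x -> 0 < \prod_i chart x 0 i.
Proof. by rewrite coord_domainE => xP; apply: prodr_gt0 => i _; exact: xP. Qed.

Let measurable_density (m : nat) : measurable_fun (@coord_domain m)
  (fun x => ((\prod_i chart x 0 i)^-1)%:E).
Proof.
apply/measurable_EFinP.
have mV : measurable_fun (`]0, +oo[ : set R) (@GRing.inv R).
  apply: open_continuous_measurable_fun; first exact: interval_open.
  move=> x; rewrite inE/= in_itv/= andbT => x0.
  by apply: inv_continuous; rewrite gt_eqF.
rewrite [X in measurable_fun _ X](_ : _ =
  @GRing.inv R \o (fun x : 'rV[R]_m => \prod_i chart x 0 i))//.
apply: (measurable_comp _ _ mV) => //.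
- by move=> _ [x /chart_gt0 x0 <-]; rewrite /= in_itv/= andbT.
- apply: measurable_prod => i _; apply: measurable_funTS.
  exact: measurable_chart_coord.
Qed.

Let mu0_0 (m : nat) : mu0 (set0 : set 'rV[R]_m.+1) = 0%E.
Proof. by rewrite /mu0 preimage_set0 setI0 integral_set0. Qed.

Let mu0_ge0 (m : nat) (A : set 'rV[R]_m.+1) : (0 <= mu0 A)%E.
Proof.
apply: integral_ge0 => x [/chart_gt0 x0 _].
by rewrite lee_fin invr_ge0 ltW.
Qed.

Let mu0_sigma_additive (m : nat) : semi_sigma_additive (@mu0 m).
Proof.
move=> F mF tF mUF; rewrite /mu0 preimage_bigcup setI_bigcupr.
rewrite ge0_integral_bigcup//=.
- apply: is_cvg_ereal_nneg_natsum_cond => k _ _; exact: mu0_ge0.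
- move=> k; apply: measurableI; first exact: measurable_coord_domain.
  by rewrite -[X in measurable X]setTI; exact: measurable_chart.
- apply: (measurable_funS (@measurable_coord_domain m)) (@measurable_density m).
  by move=> x [k _ []].
- by move=> x [k _ [/chart_gt0 x0 _]]; rewrite lee_fin invr_ge0 ltW.
- apply/trivIsetP => i j _ _ ij; move/trivIsetP : tF => /(_ i j I I ij) Fij.
  by rewrite setIACA -preimage_setI Fij preimage_set0 setI0.
Qed.

HB.instance Definition _ (m : nat) := isMeasure.Build _ _ _ (@mu0 m)
  (@mu0_0 m) (@mu0_ge0 m) (@mu0_sigma_additive m).

Definition log_integrable_ac (m : nat) (P : probability 'rV[R]_m.+1 R) : Prop :=
  [/\ P (@simplex m.+1) = 1%E,
      (\sum_i \int[P]_(p in @simplex m.+1) `|ln (p 0 i)|%:E < +oo)%E &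
      P `<< @simplex_lebesgue m].

(* Image of a measure on the simplex under a map whose values off the simplex
   are irrelevant. *)
Definition simplex_image (n : nat) (P : set 'rV[R]_n -> \bar R)
    (T : 'rV[R]_n -> 'rV[R]_n) : set 'rV[R]_n -> \bar R :=
  fun A => P (@simplex n `&` T @^-1` A).

Definition is_coupling (n : nat) (P Q : set 'rV[R]_n -> \bar R)
    (gamma : probability ('rV[R]_n * 'rV[R]_n)%type R) : Prop :=
  forall A, measurable A ->
    gamma (A `*` setT) = P A /\ gamma (setT `*` A) = Q A.

Definition optimal_transport_map (n : nat) (P Q : set 'rV[R]_n -> \bar R)
    (T : 'rV[R]_n -> 'rV[R]_n) : Prop :=
  [/\ measurable_fun (@simplex n) T,
      forall A, measurable A -> Q A = simplex_image P T A &
      forall gamma, is_coupling P Q gamma ->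
        (\int[P]_(p in @simplex n) (cost p (T p))%:E <=
         \int[gamma]_(pq in @simplex n `*` @simplex n)
            (cost pq.1 pq.2)%:E)%E].

Definition exp_concave (n : nat) (phi : 'rV[R]_n -> R) : Prop :=
  convex_function (@simplex n) (fun p => - expR (phi p)).

(* The directions e_i - r are tangent to the simplex, so only the values of phi
   on the simplex matter. *)
Definition portfolio (n : nat) (phi : 'rV[R]_n -> R) (r : 'rV[R]_n) :
    'rV[R]_n :=
  \row_i (r 0 i * (1 + 'D_(delta_mx 0 i - r) phi r)).

Definition transport_map (n : nat) (pi : 'rV[R]_n -> 'rV[R]_n)
    (p : 'rV[R]_n) : 'rV[R]_n :=
  odot p (pi (simplex_inv p)).

Definition partial (m : nat) (f : 'rV[R]_m -> R) (i : 'I_m) : 'rV[R]_m -> R :=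
  'D_(delta_mx 0 i) f.

Definition gradient (m : nat) (f : 'rV[R]_m -> R) (x : 'rV[R]_m) : 'cV[R]_m :=
  \col_i partial f i x.

Definition hessian (m : nat) (f : 'rV[R]_m -> R) (x : 'rV[R]_m) : 'M[R]_m :=
  \matrix_(i, j) partial (partial f j) i x.

Definition C2_on (m : nat) (U : set 'rV[R]_m) (f : 'rV[R]_m -> R) : Prop :=
  forall x, U x -> forall i,
    [/\ derivable f x (delta_mx 0 i),
        {for x, continuous (partial f i)} &
        forall j, derivable (partial f i) x (delta_mx 0 j) /\
          {for x, continuous (partial (partial f i) j)}].

Definition C2_on_simplex (m : nat) (phi : 'rV[R]_m.+1 -> R) : Prop :=
  C2_on (@coord_domain m) (phi \o @chart m).

(* - nabla^2 phi (r) - nabla phi (r) (x) nabla phi (r), on tangent vectors v. *)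
Definition L_form (n : nat) (phi : 'rV[R]_n -> R) (r v : 'rV[R]_n) : R :=
  - 'D_v ('D_v phi) r - ('D_v phi r) ^+ 2.

Definition L_tilde (m : nat) (phi : 'rV[R]_m.+1 -> R) (r : 'rV[R]_m.+1) :
    'M[R]_m :=
  let f := phi \o @chart m in
  let x := drop_last r in
  - hessian f x - gradient f x *m (gradient f x)^T.

Definition phi0 (n : nat) (r : 'rV[R]_n) : R := n%:R^-1 * \sum_i ln (r 0 i).

Definition phi_interp (n : nat) (phi1 : 'rV[R]_n -> R) (t : R)
    (r : 'rV[R]_n) : R :=
  (1 - t) * phi0 r + t * phi1 r.

Definition portfolio_interp (n : nat) (phi1 : 'rV[R]_n -> R) (t : R)
    (r : 'rV[R]_n) : 'rV[R]_n :=
  (1 - t) *: barycenter n + t *: portfolio phi1 r.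

(* rho is a version of dP/dmu; it may take infinite values on a null set. *)
Definition is_density d (T : measurableType d) (mu P : set T -> \bar R)
    (rho : T -> \bar R) : Prop :=
  mu.-integrable setT rho /\
  forall A, measurable A -> P A = (\int[mu]_(x in A) rho x)%E.

End simplex.

(* Main.v *)
(* In the chart x of the simplex by its first m coordinates, T_t is the composite of
   x |-> x / (1 - sum x), coordinatewise inversion, u |-> u / (1 + sum u), the map
   y |-> 1 + grad f(y) / (1 - <y, grad f(y)>) and again u |-> u / (1 + sum u), where f
   is phi_t in coordinates.  The projective maps and the gradient map are multiples of
   the identity or of a Hessian up to a rank-one term, so each Jacobian determinant is
   explicit; that of the gradient map is det L / (1 - <y, grad f>)^(m+1).  Positive
   definiteness of L makes exp f strictly concave, and the strict tangent inequality
   gives both the positivity of the portfolio weights and the injectivity of T_t.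

   The change of variables formula holds for injective strictly differentiable maps
   with invertible derivative: near each point such a map is, after composition with a
   linear map, bi-Lipschitz with constant close to 1, and an L-Lipschitz map for the
   sup norm multiplies Lebesgue measure by at most L^m, as one sees on grid cubes.
   Hence the densities of P_0 and of the pull-back of P_t by T_t have the same integral
   over every Borel set, and so agree almost everywhere. *)
From HB Require Import structures.
Require Import Defs.
From mathcomp Require Import all_boot all_order all_algebra.
From mathcomp Require Import all_classical all_reals all_analysis.
From mathcomp Require Import measurable_realfun ring lra.

Set Implicit Arguments.
Unset Strict Implicit.
Unset Printing Implicit Defensive.

Import Order.TTheory GRing.Theory Num.Theory.
Import numFieldNormedType.Exports.

Local Open Scope classical_set_scope.
Local Open Scope ring_scope.

(** * Lebesgue measure on row vectors *)

Section affine_line.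
Context {R : realType}.
Let mu := @lebesgue_measure R.

Lemma measurable_affine (a b : R) : measurable_fun [set: R] (fun x : R => a * x + b : R).
Proof. by apply: measurable_funD => //; apply: measurable_funM. Qed.

Lemma lebesgue_measure_affine (a b : R) (E : set R) : a != 0 -> measurable E ->
  (`|a|%:E * mu ((fun x : R => (a * x + b)%R) @^-1` E) = mu E)%E.
Proof.
move=> a0 mE.
have na : 0 <= `|a| by [].
pose nu := [the measure _ _ of mscale (NngNum na) (@image_measure _ _ (measurableTypeR R) (measurableTypeR R) R mu _ (measurable_affine a b))].
apply/esym; apply: (@lebesgue_measure_unique R nu _ E mE) => X [[c d] _ <-] /=.
apply/esym.
rewrite /mscale /= /pushforward.
have [cd|dc] := ltP c d; last first.
  rewrite set_itv_ge; last by rewrite bnd_simp -leNgt.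
  by rewrite preimage_set0 !measure0 mule0.
rewrite [in RHS]lebesgue_measure_itv/= lte_fin cd.
move: a0; rewrite neq_lt => /orP[a0|a0].
- rewrite (_ : _ @^-1` _ = `[(d - b) / a, (c - b) / a[%classic); last first.
    apply/seteqP; split=> x /=; rewrite !in_itv/= ler_ndivrMr// ltr_ndivlMr//;
      by rewrite lerBrDr ltrBlDr andbC [a * x]mulrC.
  rewrite lebesgue_measure_itv/= lte_fin ltr_nM2r ?invr_lt0// ltrD2r cd.
  rewrite -!EFinD -EFinM ltr0_norm//; congr EFin; field.
  by rewrite lt_eqF.
- rewrite (_ : _ @^-1` _ = `](c - b) / a, (d - b) / a]%classic); last first.
    apply/seteqP; split=> x /=; rewrite !in_itv/= ltr_pdivrMr// ler_pdivlMr//;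
      by rewrite lerBrDr ltrBlDr [a * x]mulrC.
  rewrite lebesgue_measure_itv/= lte_fin ltr_pM2r ?invr_gt0// ltrD2r cd.
  rewrite -!EFinD -EFinM gtr0_norm//; congr EFin; field.
  by rewrite gt_eqF.
Qed.
End affine_line.

Section lebesgue_row.
Context {R : realType}.
Notation mu := (@lebesgue_measure R).
Local Notation lam := (lebesgue_rV R).

Lemma row_cons0 n (v : 'rV[R]_n) (x : R) : row_cons (v, x) 0 ord0 = x.
Proof.
have -> : ord0 = lshift n (ord0 : 'I_1) by exact/val_inj.
by apply: etrans; [exact: row_mxEl|rewrite mxE eqxx].
Qed.

Lemma row_consS n (v : 'rV[R]_n) (x : R) (i : 'I_n) :
  row_cons (v, x) 0 (lift ord0 i) = v 0 i.
Proof.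
have -> : lift ord0 i = rshift 1 i by exact/val_inj.
exact: row_mxEr.
Qed.

Lemma lebesgue_rVS n (E : set 'rV[R]_n.+1) :
  lam n.+1 E = (\int[lam n]_v mu (fun x => E (row_cons (v, x))))%E.
Proof.
rewrite [LHS]/= /pushforward /product_measure1.
by apply: eq_integral => v _ /=; rewrite xsectionE.
Qed.

Lemma measurable_box n (A : 'I_n -> set R) : (forall i, measurable (A i)) ->
  measurable [set x : 'rV[R]_n | forall i, A i (x 0 i)].
Proof.
move=> mA; rewrite [X in measurable X](_ : _ =
    \bigcap_(i in [set: 'I_n]) [set x : 'rV[R]_n | A i (x 0 i)]).
  apply: fin_bigcap_measurable => // i _.
  by rewrite -[X in measurable X]setTI; exact: measurable_coord.
by apply/seteqP; split=> x /= xA; [move=> i _|move=> i]; exact: xA.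
Qed.

Lemma lebesgue_rV_box n (A : 'I_n -> set R) (l : 'I_n -> R) :
  (forall i, measurable (A i)) -> (forall i, mu (A i) = (l i)%:E) ->
  lam n [set x : 'rV[R]_n | forall i, A i (x 0 i)] = (\prod_i l i)%:E.
Proof.
elim: n => [|n IH] in A l *.
  move=> _ _ /=; rewrite big_ord0 diracE mem_set//= => -[].
  by [].
move=> mA lA; rewrite lebesgue_rVS big_ord_recl EFinM.
pose A' i := A (lift ord0 i).
rewrite -(lA ord0) -(IH A' (fun i => l (lift ord0 i)) (fun i => mA (lift ord0 i)) (fun i => lA (lift ord0 i))).
have mA' := measurable_box (fun i => mA (lift ord0 i)).
have := @integral_indic _ _ _ (lam n) _ measurableT _ mA'.
rewrite setIT => <-; rewrite -ge0_integralZl//; last exact/measurable_EFinP.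
apply: eq_integral => v _; rewrite indicE.
have [vA|vA] := boolP (v \in _); rewrite /= ?mule1 ?mule0.
- rewrite inE/= in vA; congr (mu _); apply/seteqP; split=> x.
    by move=> /(_ ord0); rewrite row_cons0.
  move=> xA i; have [j ->|->] := unliftP ord0 i; last by rewrite row_cons0.
  by rewrite row_consS.
- rewrite -(measure0 mu); congr (mu _); apply/seteqP; split=> // x xA.
  by move/negP: vA; apply; rewrite inE => i; have := xA (lift ord0 i); rewrite row_consS.
Qed.

Lemma lebesgue_rV_sigma_finite n : sigma_finite setT (lam n).
Proof.
pose A (k : nat) : set R := `]- k%:R, k%:R[%classic.
exists (fun k => [set x : 'rV[R]_n | forall i, A k (x 0 i)]); last first.
  move=> k; have mA : measurable (A k) by exact: measurable_itv.
  split; first by apply: (@measurable_box _ (fun=> A k)).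
  rewrite (@lebesgue_rV_box _ (fun=> A k) (fun=> k%:R + k%:R)) ?ltry// => _.
  rewrite /A lebesgue_measure_itv/= lte_fin.
  case: k {A mA} => [|k]; first by rewrite oppr0 ltxx addr0.
  by rewrite gtrN// -EFinD opprK.
apply/esym/seteqP; split=> // x _.
exists (Num.bound (\sum_i `|x 0 i|)) => // i.
rewrite /A/= in_itv/= -ltr_norml (le_lt_trans _ (archi_boundP _)) ?sumr_ge0//.
by rewrite (bigD1 i)//= lerDl sumr_ge0.
Qed.

End lebesgue_row.

(* An alias of [lebesgue_rV] on which sigma-finiteness can be declared: the
   head of [lebesgue_rV] is not a function but a bundled measure. *)
Definition lebesgue_sf (R : realType) (n : nat) : set 'rV[R]_n -> \bar R :=
  lebesgue_rV R n.

HB.instance Definition _ (R : realType) (n : nat) :=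
  isMeasure.Build _ _ _ (@lebesgue_sf R n) (measure0 (lebesgue_rV R n))
    (measure_ge0 (lebesgue_rV R n))
    (@measure_semi_sigma_additive _ _ _ (lebesgue_rV R n)).
HB.instance Definition _ (R : realType) (n : nat) :=
  Measure_isSigmaFinite.Build _ _ _ (@lebesgue_sf R n)
    (@lebesgue_rV_sigma_finite R n).

Section lebesgue_linear.
Context {R : realType}.
Notation mu := (@lebesgue_measure R).
Local Notation lam := (lebesgue_rV R).

Lemma measurable_row_affine m n (A : 'M[R]_(m, n)) (c : 'rV[R]_n) :
  measurable_fun setT (fun x : 'rV[R]_m => x *m A + c).
Proof.
apply: measurable_fun_mx => i j; rewrite (ord1 i).
under eq_fun do rewrite !mxE.
apply: measurable_funD => //; apply: measurable_sum => k.
by apply: measurable_funM => //; exact: measurable_coord.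
Qed.

Definition scales_volume n (A : 'M[R]_n) := forall (c : 'rV[R]_n) E,
  measurable E ->
  (`|\det A|%:E * lam n ((fun x => (x *m A + c)%R) @^-1` E) = lam n E)%E.

Lemma scales_volumeM n (A B : 'M[R]_n) :
  scales_volume A -> scales_volume B -> scales_volume (A *m B).
Proof.
move=> sA sB c E mE; rewrite det_mulmx normrM mulrC EFinM -muleA.
have mF : measurable ((fun x => x *m B + c) @^-1` E).
  by rewrite -[X in measurable X]setTI; exact: measurable_row_affine.
rewrite -[RHS](sB c)// -[in RHS](sA 0)//; congr (_ * (_ * lam n _))%E.
by apply/seteqP; split=> x /=; rewrite mulmxA addr0.
Qed.

Lemma measurable_preimage_row_cons n (E : set 'rV[R]_n.+1) : measurable E ->
  measurable (@row_cons R n @^-1` E).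
Proof.
by move=> mE; rewrite -[X in measurable X]setTI; exact: measurable_row_cons.
Qed.

Lemma measurable_lebesgue_section n (E : set 'rV[R]_n.+1) : measurable E ->
  measurable_fun setT (fun v : 'rV[R]_n => mu (fun x => E (row_cons (v, x)))).
Proof.
move=> mE; have mE' := measurable_preimage_row_cons mE.
have := measurable_fun_xsection mu mE'.
by apply: eq_measurable_fun => v _ /=; rewrite xsectionE.
Qed.

Lemma row_cons_surj n (u : 'rV[R]_n.+1) : exists v x, u = row_cons (v, x).
Proof.
exists (\row_i u 0 (lift ord0 i)), (u 0 ord0); apply/rowP => i.
have [j ->|->] := unliftP ord0 i; last by rewrite row_cons0.
by rewrite row_consS mxE.
Qed.

Lemma row_consD n (v w : 'rV[R]_n) (x y : R) :
  row_cons (v, x) + row_cons (w, y) = row_cons (v + w, x + y).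
Proof.
by apply/rowP => i; have [j ->|->] := unliftP ord0 i;
  rewrite mxE ?row_cons0// !row_consS mxE.
Qed.

Lemma row_cons_lblock n (a : R) (c : 'cV[R]_n) (S : 'M[R]_n) v x :
  row_cons (v, x) *m (block_mx a%:M 0 c S : ('M[R]_(1 + n))) =
  row_cons (v *m S, a * x + (v *m c) 0 0).
Proof.
apply: etrans; first exact: (@mul_row_block R 1 1 n 1 n).
rewrite mulmx0 add0r; apply: (congr1 (fun z => row_mx z _)) => /=.
by apply/rowP => i; rewrite (ord1 i) mul_scalar_mx !mxE/= mulrC.
Qed.

Lemma row_cons_ublock n (b : 'rV[R]_n) v x :
  row_cons (v, x) *m (block_mx 1%:M b 0 1%:M : ('M[R]_(1 + n))) =
  row_cons (v + x *: b, x).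
Proof.
apply: etrans; first exact: (@mul_row_block R 1 1 n 1 n).
by rewrite mulmx0 addr0 !mulmx1 mul_scalar_mx addrC.
Qed.

Lemma scales_volume_lblock n (a : R) (c : 'cV[R]_n) (S : 'M[R]_n) :
  a != 0 -> \det S != 0 -> scales_volume S ->
  scales_volume (block_mx a%:M 0 c S : 'M[R]_(1 + n)).
Proof.
move=> a0 S0 sS d E mE; rewrite (@det_lblock _ 1 n) det_scalar1 normrM EFinM.
have [w [y dE]] := row_cons_surj d; rewrite {}dE.
rewrite [in LHS]lebesgue_rVS.
pose h (v : 'rV[R]_n) := mu (fun x => E (row_cons (v, x))).
have mh : measurable_fun setT h by exact: measurable_lebesgue_section.
have mS := measurable_row_affine S w.
have mhS : measurable_fun setT (h \o (fun v => v *m S + w)).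
  exact: measurableT_comp.
have h0 v : (0 <= h v)%E by exact: measure_ge0.
rewrite (eq_integral (fun v : 'rV[R]_n => (`|a|^-1%:E * h (v *m S + w)%R)%E)); last first.
  move=> v _.
  have mEv : measurable (fun x : R => E (row_cons (v *m S + w, x))).
    have := measurable_xsection (v *m S + w) (measurable_preimage_row_cons mE).
    by rewrite xsectionE.
  rewrite /h -(lebesgue_measure_affine ((v *m c) 0 0 + y) a0 mEv).
  rewrite muleA -EFinM mulVf ?normr_eq0// mul1e.
  by congr (mu _); apply/seteqP; split=> x /=;
    rewrite row_cons_lblock row_consD addrA.
rewrite ge0_integralZl//.
rewrite muleAC muleA -EFinM mulfV ?normr_eq0// mul1e.
rewrite muleC.
have := ge0_integral_pushforward mS (lam n) measurableT mh (fun v _ => h0 v).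
rewrite preimage_setT => <-.
have nS : 0 <= `|\det S| by [].
rewrite -[X in (X * _)%E]/((NngNum nS)%:num%:E) -ge0_integral_mscale//.
rewrite lebesgue_rVS; apply: eq_measure_integral => B mB _.
exact: sS.
Qed.

Lemma scales_volume_ublock n (b : 'rV[R]_n) :
  scales_volume (1%:M : 'M[R]_n) -> scales_volume (block_mx 1%:M b 0 1%:M : 'M[R]_(1 + n)).
Proof.
move=> s1 d E mE; rewrite (@det_ublock _ 1 n) !det1 mulr1 normr1 mul1e.
pose m1 : {sigma_finite_measure set 'rV[R]_n -> \bar R} := @lebesgue_sf R n.
have [w [y dE]] := row_cons_surj d; rewrite {}dE.
have mE' := measurable_preimage_row_cons mE.
pose u (z : 'rV[R]_n.+1) : 'rV[R]_n.+1 :=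
  z *m (block_mx 1%:M b 0 1%:M : 'M[R]_(1 + n)) + row_cons (w, y).
have mu_ : measurable_fun setT (u \o @row_cons R n).
  apply: measurableT_comp; last exact: measurable_row_cons.
  exact: (@measurable_row_affine _ _ (block_mx 1%:M b 0 1%:M : 'M[R]_(1 + n))).
have mF : measurable ((u \o @row_cons R n) @^-1` E : set ('rV[R]_n * R)).
  by rewrite -[X in measurable X]setTI; exact: mu_.
rewrite !lebesgue_rVS.
have flip F (mF_ : measurable F) :
    (\int[lam n]_v mu (fun x => F (v, x)) =
     \int[mu]_x lam n (fun v => F (v, x)))%E.
  have := @indic_fubini_tonelli _ _ _ _ R m1 mu F mF_.
  rewrite indic_fubini_tonelli_FE// indic_fubini_tonelli_GE// => FG.
  transitivity (\int[m1]_v (mu \o xsection F) v)%E.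
    by apply: eq_integral => v _ /=; rewrite xsectionE.
  by rewrite FG; apply: eq_integral => x _ /=; rewrite ysectionE.
rewrite (flip _ mE') (flip _ mF).
have m2E : measurable_fun setT (fun x => lam n (fun v => E (row_cons (v, x)))).
  have := measurable_fun_ysection m1 mE'.
  by apply: eq_measurable_fun => v _ /=; rewrite ysectionE.
transitivity (\int[mu]_x lam n (fun v => E (row_cons (v, (x + y)%R))))%E.
  apply: eq_integral => x _.
  have mEx : measurable (fun v => E (row_cons (v, x + y))).
    by have := measurable_ysection (x + y) mE'; rewrite ysectionE.
  rewrite -[RHS](s1 (x *: b + w))// det1 normr1 mul1e; congr (lam n _).
  by apply/seteqP; split=> v /=;
    rewrite /u/= row_cons_ublock row_consD mulmx1 addrA.
pose g (x : R) := lam n (fun v => E (row_cons (v, x))).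
have mt : measurable_fun [set: R] (fun x : R => 1 * x + y) := measurable_affine 1 y.
have := @ge0_integral_pushforward _ _ (measurableTypeR R) (measurableTypeR R) R _ mt mu setT _ measurableT m2E (fun v _ => measure_ge0 _ _).
rewrite preimage_setT => gE.
transitivity (\int[mu]_x (g \o (fun x : R => 1 * x + y)%R) x)%E.
  by apply: eq_integral => x _; rewrite /g/= mul1r.
rewrite -gE; apply: eq_measure_integral => B mB _.
by rewrite -[RHS](lebesgue_measure_affine y (oner_neq0 R) mB) normr1 mul1e.
Qed.

Lemma scales_volume_unit n (A : 'M[R]_n) : \det A != 0 -> scales_volume A.
Proof.
elim: n => [|n IH] in A *.
  move=> _ c E mE; rewrite det_mx00 normr1 mul1e; congr (lam 0 _).
  by apply/seteqP; split=> x /=; rewrite !thinmx0.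
have sU b := @scales_volume_ublock n b (IH 1%:M _).
have {}sU b : scales_volume (block_mx 1%:M b 0 1%:M : 'M[R]_(1 + n)).
  by apply: sU; rewrite det1 oner_neq0.
have H (B : 'M[R]_(1 + n)) : B 0 0 != 0 -> \det B != 0 -> scales_volume B.
  move=> B00 detB; pose a := B 0 0; pose b := ursubmx B; pose c := dlsubmx B.
  pose S := drsubmx B - c *m (a^-1 *: b).
  have BE : B = block_mx a%:M 0 c S *m block_mx 1%:M (a^-1 *: b) 0 1%:M.
    rewrite mulmx_block !mulmx0 !mulmx1 !addr0 mul_scalar_mx scalerA.
    rewrite mulfV// scale1r /S subrKC.
    rewrite -[LHS]submxK; congr block_mx; apply/matrixP => i j.
    by rewrite !ord1 !mxE eqxx mulr1n; congr (B _ _); exact/val_inj.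
  move: detB; rewrite BE det_mulmx => detB; apply: scales_volumeM => //.
  apply: scales_volume_lblock => //; [|apply: IH];
    by move: detB; rewrite det_lblock !mulf_eq0 !negb_or => /andP[/andP[]].
move=> detA; have [A00|] := eqVneq (A 0 0) 0; last by move=> ?; exact: H.
pose A' : 'M[R]_(1 + n) := A.
have [c0|/cV0Pn[k ck]] := eqVneq (dlsubmx A') 0.
  move: detA; rewrite -[A]/A' -[A']submxK c0 (@det_ublock _ 1 n).
  suff -> : ulsubmx A' = 0 by rewrite det0 // mul0r eqxx.
  apply/matrixP => i j; rewrite !ord1 !mxE -[RHS]A00; congr (A _ _); exact/val_inj.
pose b : 'rV[R]_n := delta_mx 0 k.
pose U b : 'M[R]_(1 + n) := block_mx 1%:M b 0 1%:M.
have detU b' : \det (U b') = 1 by rewrite det_ublock !det1 mulr1.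
have AE : A' = U (- b) *m (U b *m A').
  rewrite mulmxA /U mulmx_block !mulmx0 !mulmx1 !mul1mx mul0mx !addr0 add0r subrr.
  by rewrite -scalar_mx_block mul1mx.
rewrite -[A]/A' AE; apply: scales_volumeM; first exact: sU.
apply: H; last by rewrite det_mulmx detU mul1r.
suff -> : (U b *m A') 0 0 = dlsubmx A' k 0 by [].
transitivity (ulsubmx (U b *m A') 0 0).
  by rewrite [RHS]mxE [RHS]mxE; congr (_ _ _); exact/val_inj.
rewrite -{1}[A']submxK /U mulmx_block block_mxKul mul1mx -rowE !mxE.
by rewrite (_ : A' _ _ = 0) ?add0r// -[RHS]A00; congr (A _ _); exact/val_inj.
Qed.

End lebesgue_linear.

Section regularity.
Context {R : realType}.

Lemma nonincreasing_measure_lt d (T : measurableType d)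
    (mu : {measure set T -> \bar R}) (G : (set T)^nat) (e : R) :
  (mu setT < +oo)%E -> (forall k, measurable (G k)) -> nonincreasing_seq G ->
  \bigcap_k G k = set0 -> 0 < e -> exists k, (mu (G k) < e%:E)%E.
Proof.
move=> muoo mG niG G0 e0.
have : (mu \o G) @ \oo --> mu (\bigcap_k G k).
  apply: nonincreasing_cvg_mu => //; last exact: bigcapT_measurable.
  by apply: le_lt_trans muoo; apply: le_measure; rewrite ?inE.
rewrite G0 measure0 => /fine_cvgP[] [N1 _ H1] /cvgrPdist_lt/(_ _ e0)[N2 _ H2].
exists (maxn N1 N2).
have := H1 _ (leq_maxl N1 N2); have := H2 _ (leq_maxr N1 N2).
rewrite /= sub0r normrN => h fin; rewrite -(fineK fin) lte_fin.
exact: le_lt_trans (ler_norm _) h.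
Qed.

Lemma outer_regular_finite n (mu : {measure set 'rV[R]_n -> \bar R})
    (E : set 'rV[R]_n) (e : R) : (mu setT < +oo)%E -> measurable E -> 0 < e ->
  exists U, [/\ open U, E `<=` U & (mu (U `\` E) < e%:E)%E].
Proof.
move=> muoo mE e0.
pose C : set (set 'rV[R]_n) := [set E : set 'rV[R]_n | measurable E /\
  forall e : R, 0 < e -> exists U F : set 'rV[R]_n, [/\ open U, closed F, F `<=` E, E `<=` U & (mu (U `\` F) < e%:E)%E]].
have cm (F : set 'rV[R]_n) : closed F -> measurable F.
  move=> cF; rewrite -[F]setCK; apply: measurableC; apply: open_measurable_mx.
  exact: closed_openC.
suff : C E.
  move=> [_ /(_ _ e0)[U [F [oU cF FE EU UFe]]]]; exists U; split=> //.
  apply: le_lt_trans UFe; apply: le_measure; rewrite ?inE.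
  - by apply: measurableD => //; exact: open_measurable_mx.
  - by apply: measurableD; [exact: open_measurable_mx|exact: cm].
  - exact: setDS.
move: E mE; apply: smallest_sub; last first.
  move=> O oO; split=> [|{}e {}e0]; first exact: open_measurable_mx.
  pose F k := [set x | ball x (k.+1%:R^-1 : R) `<=` O].
  have cF k : closed (F k).
    rewrite -[F k]setCK; apply: open_closedC.
    rewrite (_ : ~` _ = \bigcup_(y in ~` O) ball y (k.+1%:R^-1 : R)).
      by apply: bigcup_open => y _; apply: ball_open; rewrite invr_gt0.
    apply/seteqP; split=> x /=.
      move=> h; apply: contrapT => k'; apply: h => y xy; apply: contrapT => Oy.
      by apply: k'; exists y => //; exact: ball_sym.
    by move=> [y Oy yx] /(_ _ (ball_sym yx)).
  have := @nonincreasing_measure_lt _ _ mu (fun k => O `\` F k) e muoo.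
  case=> //.
  - by move=> k; apply: measurableD; [exact: open_measurable_mx|exact: cm].
  - move=> i j ij; apply/subsetPset; apply: setDS => x Fix; apply: subset_trans Fix.
    by apply: le_ball; rewrite lef_pV2 ?posrE// ler_nat.
  - apply/seteqP; split=> // x /= Fx.
    have [Ox _] := Fx 0%N I.
    have /nbhs_ballP[r /= r0 rO] := open_nbhs_nbhs (conj oO Ox).
    have [k] := ltr_add_invr r0; rewrite add0r => kr.
    by have [_] := Fx k I; apply; apply: subset_trans rO; apply: le_ball; exact: ltW.
  - move=> k Fke; exists O, (F k); split=> // x; apply.
    exact: ballxx.
split.
- split=> [|{}e {}e0]; first exact: measurable0.
  exists set0, set0; split=> //.
  + exact: closed0.
  + by rewrite setD0 measure0 lte_fin.
- move=> E [mE CE]; rewrite setTD; split; first exact: measurableC.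
  move=> {}e {}e0; have [U [F [oU cF FE EU UFe]]] := CE _ e0.
  exists (~` F), (~` U); split.
  + exact: closed_openC.
  + exact: open_closedC.
  + exact: subsetC.
  + exact: subsetC.
  + by rewrite setDE setCK setIC -setDE.
- move=> E CE; split; first by apply: bigcupT_measurable => k; have [] := CE k.
  move=> {}e {}e0.
  have e20 : 0 < e / 2 by rewrite divr_gt0.
  have /choice[UF UFP] k : exists UF : set 'rV[R]_n * set 'rV[R]_n,
      [/\ open UF.1, closed UF.2, UF.2 `<=` E k, E k `<=` UF.1 &
       (mu (UF.1 `\` UF.2) < (e / 2 / 2 ^+ k.+1)%:E)%E].
    have [_ /(_ (e / 2 / 2 ^+ k.+1))[]] := CE k.
      by rewrite divr_gt0// exprn_gt0.
    by move=> U [F ?]; exists (U, F).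
  pose U := \bigcup_k (UF k).1; pose F N := \bigcup_(k < N) (UF k).2.
  pose FF := \bigcup_k (UF k).2.
  have mU1 k : measurable (UF k).1 by apply: open_measurable_mx; have [] := UFP k.
  have mF1 k : measurable (UF k).2 by apply: cm; have [] := UFP k.
  have mU : measurable U by exact: bigcupT_measurable.
  have mFF : measurable FF by exact: bigcupT_measurable.
  have mF N : measurable (F N) by apply: bigcup_measurable.
  have [N FN] : exists N, (mu (FF `\` F N) < (e / 2)%:E)%E.
    apply: (@nonincreasing_measure_lt _ _ mu (fun N => FF `\` F N)) => //.
    - by move=> k; apply: measurableD.
    - move=> i j ij; apply/subsetPset; apply: setDS => x [k /= ki xk].
      by exists k => //=; exact: leq_trans ij.
    - apply/seteqP; split=> // x /= Fx; have [[k _ xk] _] := Fx 0%N I.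
      by have [_] := Fx k.+1 I; apply; exists k => /=.
  exists U, (F N); split.
  + by apply: bigcup_open => k _; have [] := UFP k.
  + apply: closed_bigcup => //.
    by move=> k _; have [] := UFP k.
  + by move=> x [k _ xk]; exists k => //; have [_ _ + _ _] := UFP k; apply.
  + by move=> x [k _ xk]; exists k => //; have [_ _ _ + _] := UFP k; apply.
  + have -> : e = e / 2 + e / 2 by lra.
    rewrite EFinD.
    apply: (@le_lt_trans _ _ (mu ((U `\` FF) `|` (FF `\` F N)))).
      apply: le_measure; rewrite ?inE.
      * exact: measurableD.
      * by apply: measurableU; apply: measurableD.
      * move=> x [Ux Fx]; have [xF|xF] := pselect (FF x); [by right|by left].
    apply: le_lt_trans (measureU2 _ _ _) _; [exact: measurableD|exact: measurableD|].
    apply: lee_ltD => //.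
      by rewrite ge0_fin_numE// (le_lt_trans _ muoo)// le_measure ?inE//; exact: measurableD.
    apply: (@le_trans _ _ (\sum_(k <oo) mu ((UF k).1 `\` (UF k).2))%E).
      apply: measure_sigma_subadditive.
      * by move=> k; apply: measurableD.
      * exact: measurableD.
      * by move=> x [[k _ xk] nF]; exists k => //; split=> // xF; apply: nF; exists k.
    apply: le_trans (epsilon_trick0 xpredT (ltW e20)).
    apply: lee_nneseries => // k _; have [_ _ _ _] := UFP k.
    by rewrite natrX => /ltW.
Qed.
End regularity.

Section row_norm.
Context {R : realType}.

Lemma row_norm_coord n (x : 'rV[R]_n) i : `|x 0 i| <= `|x|.
Proof.
rewrite [leRHS]/Num.norm /= mx_normrE; apply/bigmax_geP; right => /=.
by exists (0, i).
Qed.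

Lemma row_norm_le n (x : 'rV[R]_n) (e : R) : 0 <= e ->
  (forall i, `|x 0 i| <= e) -> `|x| <= e.
Proof.
move=> e0 xe; rewrite [leLHS]/Num.norm /= mx_normrE; apply/bigmax_leP; split => //=.
by move=> [i j] _ /=; rewrite (ord1 i).
Qed.

Lemma row_norm_lt n (x : 'rV[R]_n) (e : R) : 0 < e ->
  (forall i, `|x 0 i| < e) -> `|x| < e.
Proof.
move=> e0 xe; rewrite [ltLHS]/Num.norm /= mx_normrE; apply/bigmax_ltP; split => //=.
by move=> [i j] _ /=; rewrite (ord1 i).
Qed.

End row_norm.

Section lipschitz.
Context {R : realType}.
Notation mu := (@lebesgue_measure R).
Local Notation lam := (lebesgue_rV R).

Lemma lebesgue_rV_diameter n (B : set 'rV[R]_n) (d : R) : measurable B -> 0 <= d ->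
  (forall x y, B x -> B y -> `|x - y| <= d) -> (lam n B <= (d ^+ n)%:E)%E.
Proof.
move=> mB d0 Bd; have [->|/set0P[b Bb]] := eqVneq B set0.
  by rewrite measure0 lee_fin exprn_ge0.
pose a i := inf [set x 0 i | x in B].
have Ba x i : B x -> a i <= x 0 i <= a i + d.
  move=> Bx; have lbd y : B y -> x 0 i - d <= y 0 i.
    move=> By; rewrite lerBlDr -lerBlDl (le_trans (ler_norm _))//.
    have := row_norm_coord (x - y) i; rewrite !mxE => /le_trans; apply.
    exact: Bd.
  apply/andP; split.
    apply: ge_inf; last by exists x.
    by exists (x 0 i - d) => _ [y By <-]; exact: lbd.
  rewrite -lerBlDr; apply: lb_le_inf; first by exists (b 0 i), b.
  by move=> _ [y By <-]; exact: lbd.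
pose A (i : 'I_n) : set R := `[a i, a i + d]%classic.
have mA i : measurable (A i) by exact: measurable_itv.
have AE i : mu (A i) = d%:E.
  rewrite /A lebesgue_measure_itv/= lte_fin.
  have [da|ad] := ltP (a i) (a i + d); first by rewrite -EFinB addrAC subrr add0r.
  by congr EFin; apply/eqP; rewrite eq_le d0 /=; move: ad; rewrite gerDl.
have := lebesgue_rV_box mA AE; rewrite prodr_const card_ord => <-.
apply: le_measure; rewrite ?inE//; first exact: measurable_box.
by move=> x Bx i; rewrite /A/= in_itv/=; exact: Ba.
Qed.

Definition grid_cube n (s : R) (z : 'rV[int]_n) : set 'rV[R]_n :=
  [set x | forall i, `[(z 0 i)%:~R * s, (z 0 i + 1)%:~R * s[%classic (x 0 i)].

Lemma measurable_grid_cube n (s : R) (z : 'rV[int]_n) : measurable (grid_cube s z).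
Proof.
apply: (@measurable_box _ _ (fun i => `[(z 0 i)%:~R * s, (z 0 i + 1)%:~R * s[%classic)).
by move=> i; exact: measurable_itv.
Qed.

Lemma lebesgue_grid_cube n (s : R) (z : 'rV[int]_n) : 0 < s ->
  lam n (grid_cube s z) = (s ^+ n)%:E.
Proof.
move=> s0.
rewrite (@lebesgue_rV_box _ _ (fun i => `[(z 0 i)%:~R * s, (z 0 i + 1)%:~R * s[%classic)
  (fun=> s)).
- by rewrite prodr_const card_ord.
- by move=> i; exact: measurable_itv.
- move=> i; rewrite lebesgue_measure_itv/= lte_fin ltr_pM2r// ltr_int ltzD1 lexx.
  by rewrite -EFinB -mulrBl intrD addrAC subrr add0r mul1r.
Qed.

Lemma grid_cube_cover n (s : R) (x : 'rV[R]_n) : 0 < s ->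
  exists z, grid_cube s z x.
Proof.
move=> s0; exists (\row_i Num.floor (x 0 i / s)) => i /=.
by rewrite in_itv/= mxE -ler_pdivlMr// -ltr_pdivrMr// floor_le floorD1_gt.
Qed.

Lemma grid_cube_inj n (s : R) (z z' : 'rV[int]_n) x : 0 < s ->
  grid_cube s z x -> grid_cube s z' x -> z = z'.
Proof.
move=> s0 zx zx'; apply/rowP => i; move: (zx i) (zx' i); rewrite /= !in_itv/=.
move=> /andP[a b] /andP[c d].
have := le_lt_trans a d; have := le_lt_trans c b.
by rewrite !ltr_pM2r// !ltr_int !ltzD1 => p q; apply/eqP; rewrite eq_le p q.
Qed.

Lemma grid_cube_dist n (s : R) (z : 'rV[int]_n) x y : 0 < s ->
  grid_cube s z x -> grid_cube s z y -> `|x - y| < s.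
Proof.
move=> s0 zx zy; apply: row_norm_lt => // i; rewrite !mxE.
move: (zx i) (zy i); rewrite /= !in_itv/= intrD mulrDl mul1r ltr_norml.
by move=> /andP[a b] /andP[c d]; apply/andP; split; lra.
Qed.

End lipschitz.

Section lipschitz_image.
Context {R : realType}.
Local Notation lam := (lebesgue_rV R).

Lemma row_ballE n (x y : 'rV[R]_n) (e : R) : ball x e y = (`|x - y| < e) :> Prop.
Proof. by rewrite -ball_normE. Qed.

Lemma row_ball0 n (x : 'rV[R]_n) (e : R) : e <= 0 -> ball x e = set0.
Proof.
move=> e0; apply/seteqP; split=> // y; rewrite row_ballE => /lt_le_trans/(_ e0).
by rewrite normr_lt0.
Qed.

Lemma measurable_row_ball n (x : 'rV[R]_n) (e : R) : measurable (ball x e).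
Proof.
have [e0|/row_ball0->//] := ltP 0 e; apply: open_measurable_mx.
exact: ball_open.
Qed.

Lemma measurable_ball_subset n (O : set 'rV[R]_n) (s : R) : 0 < s ->
  measurable [set x | ball x s `<=` O].
Proof.
move=> s0; rewrite -[X in measurable X]setCK; apply: measurableC.
apply: open_measurable_mx.
rewrite (_ : ~` _ = \bigcup_(y in ~` O) ball y s).
  by apply: bigcup_open => y _; apply: ball_open.
apply/seteqP; split=> x /=.
  move=> h; apply: contrapT => k'; apply: h => y xy; apply: contrapT => Oy.
  by apply: k'; exists y => //; exact: ball_sym.
by move=> [y Oy yx] /(_ _ (ball_sym yx)).
Qed.

Lemma lipschitz_image_grid n (E O : set 'rV[R]_n) (h : 'rV[R]_n -> 'rV[R]_n)
    (L s : R) : 0 <= L -> 0 < s -> measurable O ->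
  (forall x, E x -> ball x s `<=` O) ->
  (forall x y, E x -> E y -> `|h x - h y| <= L * `|x - y|) ->
  measurable E ->
  (forall B, B `<=` E -> measurable B -> measurable (h @` B)) ->
  (lam n (h @` E) <= (L ^+ n)%:E * lam n O)%E.
Proof.
move=> L0 s0 mO EO hL mE mh.
pose Q k : set 'rV[R]_n :=
  if (pickle_inv k : option 'rV[int]_n) is Some z then
    (if pselect (E `&` grid_cube s z !=set0) then grid_cube s z else set0)
  else set0.
have mQ k : measurable (Q k).
  rewrite /Q; case: (pickle_inv _) => [z|]; last exact: measurable0.
  by case: pselect => [?|?]; [exact: measurable_grid_cube|exact: measurable0].
have QO k : Q k `<=` O.
  rewrite /Q; case: (pickle_inv _) => [z|]; last exact: sub0set.
  case: pselect => [[x [Ex zx]]|?]; last exact: sub0set.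
  move=> y zy.
  by apply: (EO _ Ex); rewrite row_ballE; exact: grid_cube_dist zx zy.
have tQ : trivIset setT Q.
  apply/trivIsetP => i j _ _; apply: contraNeq => /set0P[x []]; rewrite /Q.
  have := @pickle_invK 'rV[int]_n i; have := @pickle_invK 'rV[int]_n j.
  case: (pickle_inv i) => // z; case: (pickle_inv j) => // z' /= zj zi.
  case: pselect => // ? zx; case: pselect => // ? zx'.
  by apply/eqP; rewrite -zi -zj (grid_cube_inj s0 zx zx').
have EQ : E `<=` \bigcup_k Q k.
  move=> x Ex; have [z zx] := grid_cube_cover x s0.
  exists (pickle z) => //; rewrite /Q pickleK_inv; case: pselect => [//|[]].
  by exists x.
have mhQ k : measurable (h @` (E `&` Q k)).
  by apply: mh; [exact: subIsetl|exact: measurableI].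
apply: (@le_trans _ _ (\sum_(k <oo) lam n (h @` (E `&` Q k)))%E).
  apply: measure_sigma_subadditive => //; first by apply: mh.
  by move=> _ [x Ex <-]; have [k _ Qx] := EQ _ Ex; exists k => //; exists x.
apply: (@le_trans _ _ (\sum_(k <oo) ((L ^+ n)%:E * lam n (Q k)))%E).
  apply: lee_nneseries => // k _.
  have hd : (lam n (h @` (E `&` Q k)) <= ((L * s) ^+ n)%:E)%E.
    apply: lebesgue_rV_diameter => //; first by rewrite mulr_ge0// ltW.
    move=> _ _ [x [Ex Qx] <-] [y [Ey Qy] <-].
    apply: le_trans (hL _ _ Ex Ey) _; apply: ler_wpM2l => //.
    move: Qx Qy; rewrite /Q; case: (pickle_inv _) => // z; case: pselect => // ?.
    by move=> zx zy; exact/ltW/(grid_cube_dist s0 zx zy).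
  move: hd; rewrite {3}/Q.
  case E1: (pickle_inv k) => [z|]; last first.
    by rewrite /Q E1 !setI0 !image_set0 !measure0 mule0.
  case: pselect => [p|p].
    by rewrite /= lebesgue_grid_cube// -EFinM -exprMn.
  by rewrite /Q E1; case: pselect => // ?; rewrite setI0 image_set0 !measure0 mule0.
rewrite nneseriesZl//.
apply: lee_wpmul2l; first by rewrite lee_fin exprn_ge0.
rewrite -measure_semi_bigcup//; last exact: bigcupT_measurable.
apply: le_measure; rewrite ?inE//; first exact: bigcupT_measurable.
by move=> x [k _ /QO].
Qed.

Lemma lipschitz_image_open n (E O : set 'rV[R]_n) (h : 'rV[R]_n -> 'rV[R]_n)
    (L : R) : 0 <= L -> open O -> E `<=` O ->
  (forall x y, E x -> E y -> `|h x - h y| <= L * `|x - y|) ->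
  measurable E ->
  (forall B, B `<=` E -> measurable B -> measurable (h @` B)) ->
  (lam n (h @` E) <= (L ^+ n)%:E * lam n O)%E.
Proof.
move=> L0 oO EO hL mE mh.
have s0 k : 0 < k.+1%:R^-1 :> R by rewrite invr_gt0.
pose F k := E `&` [set x | ball x (k.+1%:R^-1 : R) `<=` O].
have mF k : measurable (F k) by apply: measurableI => //; exact: measurable_ball_subset.
have FE k : F k `<=` E by exact: subIsetl.
have hE : h @` E = \bigcup_k (h @` F k).
  apply/seteqP; split=> [_ [x Ex <-]|_ [k _ [x [Ex _] <-]]]; last by exists x.
  have /nbhs_ballP[r /= r0 rO] := open_nbhs_nbhs (conj oO (EO _ Ex)).
  have [k] := ltr_add_invr r0; rewrite add0r => kr.
  exists k => //; exists x => //; split=> //=.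
  by apply: subset_trans rO; apply: le_ball; exact: ltW.
have mhF k : measurable (h @` F k) by exact: mh.
rewrite hE.
have cv := @nondecreasing_cvg_mu _ _ _ (lam n) (fun k => h @` F k) mhF.
rewrite -(cvg_lim _ (cv _ _))//.
- apply: lime_le.
    apply/cvg_ex; eexists; apply: cv; first exact: bigcupT_measurable.
    move=> i j ij; apply/subsetPset; apply: image_subset => x [Ex xO]; split=> //.
    by apply: subset_trans xO; apply: le_ball; rewrite lef_pV2 ?posrE// ler_nat.
  apply: nearW => k; apply: (@lipschitz_image_grid n _ _ _ _ k.+1%:R^-1) => //.
  + exact: open_measurable_mx.
  + by move=> x [].
  + by move=> x y [Ex _] [Ey _]; exact: hL.
  + by move=> B BF; apply: mh; exact: subset_trans (FE k).
- exact: bigcupT_measurable.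
- move=> i j ij; apply/subsetPset; apply: image_subset => x [Ex xO]; split=> //.
  by apply: subset_trans xO; apply: le_ball; rewrite lef_pV2 ?posrE// ler_nat.
Qed.

Lemma lebesgue_ball_lty n (x : 'rV[R]_n) (M : R) : (lam n (ball x M) < +oo)%E.
Proof.
have mB : measurable (ball x M) by exact: measurable_row_ball.
apply: le_lt_trans (ltry ((`|M| + `|M|) ^+ n)).
apply: lebesgue_rV_diameter => // y z; rewrite !row_ballE => xy xz.
have -> : y - z = (x - z) - (x - y) by rewrite opprB [RHS]addrC subrKA.
by rewrite (le_trans (ler_normB _ _))// lerD// ltW// (lt_le_trans _ (ler_norm _)).
Qed.

Lemma lipschitz_image n (E : set 'rV[R]_n) (h : 'rV[R]_n -> 'rV[R]_n)
    (L M : R) (a : 'rV[R]_n) : 0 <= L -> E `<=` ball a M ->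
  (forall x y, E x -> E y -> `|h x - h y| <= L * `|x - y|) ->
  measurable E ->
  (forall B, B `<=` E -> measurable B -> measurable (h @` B)) ->
  (lam n (h @` E) <= (L ^+ n)%:E * lam n E)%E.
Proof.
move=> L0 EM hL mE mh.
have [M0|/row_ball0 B0] := ltP 0 M; last first.
  move: EM; rewrite B0 subset0 => ->.
  by rewrite image_set0 !measure0 mule0.
have mB : measurable (ball a M) by exact: measurable_row_ball.
apply/lee_addgt0Pr => e e0.
pose e' := e / (L ^+ n + 1).
have Ln : 0 < L ^+ n + 1 by rewrite ltr_wpDl// exprn_ge0.
have e'0 : 0 < e' by rewrite divr_gt0.
have [] := @outer_regular_finite R n (mrestr (lam n) mB) E e' _ mE e'0.
  by rewrite -[ltLHS]/(lam n (setT `&` ball a M)) setTI lebesgue_ball_lty.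
move=> U [oU EU UE].
have oO : open (U `&` ball a M) by apply: openI => //; exact: ball_open.
apply: le_trans (lipschitz_image_open L0 oO _ hL mE mh) _.
  by move=> x Ex; split; [exact: EU|exact: EM].
rewrite (measureDI _ (open_measurable_mx oO) mE).
have -> : U `&` ball a M `&` E = E.
  by apply/seteqP; split=> [x []//|x Ex]; split=> //; split; [exact: EU|exact: EM].
rewrite muleDr//; last by rewrite ge0_adde_def// inE.
rewrite addeC; apply: leeD => //.
apply: (@le_trans _ _ ((L ^+ n)%:E * e'%:E)%E).
  apply: lee_wpmul2l; first by rewrite lee_fin exprn_ge0.
  move/ltW: UE; rewrite -[leLHS]/(lam n ((U `\` E) `&` ball a M)) setIDAC.
  by rewrite setIDA.
rewrite -EFinM lee_fin /e' mulrCA ler_piMr ?(ltW e0)//.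
by rewrite ler_pdivrMr// mul1r lerDl.
Qed.

End lipschitz_image.

(** * Strict differentiability *)

Section lines.
Context {R : realType}.

Lemma is_derive_line (V : normedModType R) (u : V -> R) (z v : V) (t : R) :
  derivable u (z + t *: v) v ->
  is_derive t (1 : R) (fun s : R => u (z + s *: v)) ('D_v u (z + t *: v)).
Proof.
move=> du.
have E : (fun h : R => h^-1 *: (((fun s : R => u (z + s *: v)) \o shift t) (h *: (1 : R))
      - u (z + t *: v))) =
    (fun h : R => h^-1 *: ((u \o shift (z + t *: v)) (h *: v) - u (z + t *: v))).
  apply/funext => h /=; congr (_ *: (u _ - _)).
  by rewrite /shift/= [h *: 1]mulr1 scalerDl addrCA.
by apply: DeriveDef; rewrite /derivable /derive E.
Qed.

Lemma MVT01 (g dg : R -> R) :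
  (forall s : R, 0 <= s <= 1 -> is_derive s (1 : R) g (dg s)) ->
  exists2 c, 0 < c < 1 & g 1 - g 0 = dg c.
Proof.
move=> dgP; have [||c] := @MVT R g dg 0 1 ltr01.
- by move=> x; rewrite in_itv/= => /andP[x0 x1]; apply: dgP; rewrite !ltW.
- apply: derivable_within_continuous => x; rewrite in_itv/= => /dgP dx.
  exact: ex_derive.
- by rewrite in_itv/= => c01 ->; exists c => //; rewrite subr0 mulr1.
Qed.

End lines.

Section strict_diff.
Context {R : realType}.

(* Row vectors: the derivative acts on the right, so the matrix is the transpose
   of the usual Jacobian and a composite multiplies left to right. *)
Definition strict_diff m k (f : 'rV[R]_m -> 'rV[R]_k) (x0 : 'rV[R]_m)
    (A : 'M[R]_(m, k)) :=
  forall e : R, 0 < e -> \forall d \near 0^'+, forall x y, ball x0 d x -> ball x0 d y ->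
    `|f x - f y - (x - y) *m A| <= e * `|x - y|.

Definition strict_diff1 m (u : 'rV[R]_m -> R) (x0 : 'rV[R]_m) (a : 'cV[R]_m) :=
  forall e : R, 0 < e -> \forall d \near 0^'+, forall x y, ball x0 d x -> ball x0 d y ->
    `|u x - u y - ((x - y) *m a) 0 0| <= e * `|x - y|.

(* row i agrees with x on the first k coordinates and with y on the others *)
Let mix m (x y : 'rV[R]_m) k : 'rV[R]_m := \row_i if (i < k)%N then x 0 i else y 0 i.

Let convex_dist (a b c d s : R) : 0 <= s <= 1 -> `|a - b| < d -> `|a - c| < d ->
  `|a - (c + s * (b - c))| < d.
Proof.
move=> /andP[s0 s1] ab ac.
have -> : a - (c + s * (b - c)) = s * (a - b) + (1 - s) * (a - c) by ring.
apply: le_lt_trans (ler_normD _ _) _; rewrite !normrM (ger0_norm s0).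
rewrite (@ger0_norm _ (1 - s)) ?subr_ge0//; have [->|sN0] := eqVneq s 0.
  by rewrite mul0r add0r subr0 mul1r.
have {}s0 : 0 < s by rewrite lt_neqAle eq_sym sN0.
have := mulr_gt0 s0 (_ : 0 < d - `|a - b|); rewrite subr_gt0 => /(_ ab) p.
have := mulr_ge0 (_ : 0 <= 1 - s) (_ : 0 <= d - `|a - c|).
by rewrite !subr_ge0 => /(_ s1 (ltW ac)) q; lra.
Qed.

Lemma C1_strict_diff1 m (u : 'rV[R]_m -> R) (x0 : 'rV[R]_m) :
  (\forall x \near x0, forall i, derivable u x (delta_mx 0 i)) ->
  (forall i, {for x0, continuous (partial u i)}) ->
  strict_diff1 u x0 (gradient u x0).
Proof.
move=> du cu e e0.
have e'0 : 0 < e / m.+1%:R by rewrite divr_gt0.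
have H : \forall x \near x0, forall i, derivable u x (delta_mx 0 i) /\
    `|partial u i x0 - partial u i x| < e / m.+1%:R.
  have : \forall x \near x0, forall i, `|partial u i x0 - partial u i x| < e / m.+1%:R.
    have := @filter_forall _ 'I_m (fun i => [set x | `|partial u i x0 - partial u i x| < e / m.+1%:R])
      (nbhs x0) _ ; apply.
    by move=> i; have /cvgrPdist_lt/(_ _ e'0) := cu i.
  by apply: filterS2 du => x h1 h2 i; split.
have [r /= r0 rH] : exists2 r : R, 0 < r & ball x0 r `<=` [set x | forall i,
    derivable u x (delta_mx 0 i) /\ `|partial u i x0 - partial u i x| < e / m.+1%:R].
  by move/nbhs_ballP: H => -[r]; exists r.
near=> d => x y xd yd.
have dr : d <= r by near: d; apply: nbhs_right_le.
have d0 : 0 < d by near: d; exact: nbhs_right_gt.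
have telesc : u x - u y = \sum_(i < m) (u (mix x y i.+1) - u (mix x y i)).
  rewrite -(big_mkord xpredT (fun i => u (mix x y i.+1) - u (mix x y i))).
  rewrite telescope_sumr//; congr (u _ - u _); apply/rowP => i; rewrite mxE//.
  by rewrite ltn_ord.
have lin : ((x - y) *m gradient u x0) 0 0 =
    \sum_(i < m) (x 0 i - y 0 i) * partial u i x0.
  by rewrite mxE; apply: eq_bigr => i _; rewrite !mxE.
rewrite telesc lin -sumrB.
apply: (@le_trans _ _ (\sum_(i < m) (e / m.+1%:R * `|x - y|))); last first.
  rewrite sumr_const card_ord -[leLHS]mulr_natl mulrA ler_wpM2r//.
  by rewrite mulrCA ler_piMr ?(ltW e0)// ler_pdivrMr// mul1r ler_nat.
apply: le_trans (ler_norm_sum _ _ _) _; apply: ler_sum => i _.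
pose c := x 0 i - y 0 i; pose z := mix x y i.
have pt (s : R) : 0 <= s <= 1 -> ball x0 r (z + (s * c) *: delta_mx 0 i).
  move=> s01; rewrite row_ballE; apply: (@lt_le_trans _ _ d) => //.
  have xyd (j : 'I_m) : `|x0 0 j - x 0 j| < d /\ `|x0 0 j - y 0 j| < d.
    move: xd yd; rewrite !row_ballE => xd yd; split.
      by apply: le_lt_trans xd; have := row_norm_coord (x0 - x) j; rewrite !mxE.
    by apply: le_lt_trans yd; have := row_norm_coord (x0 - y) j; rewrite !mxE.
  apply: row_norm_lt => // j; rewrite !mxE eqxx/=; have [xj yj] := xyd j.
  have [ji|ji] := eqVneq j i.
    rewrite ji ltnn mulr1 /c -ji; exact: convex_dist.
  by rewrite mulr0 addr0; case: ifP.
have [|s] := @MVT01 R (fun s => u (z + (s * c) *: delta_mx 0 i))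
    (fun s => c * partial u i (z + (s * c) *: delta_mx 0 i)).
- move=> s s01.
  have /(_ i)[di _] := rH _ (pt s s01).
  have L := is_derive_line di.
  have M : is_derive s (1 : R) (fun s : R => s * c) c.
    rewrite (_ : (fun s => s * c) = c *: id); last first.
      by apply/funext => w; rewrite mulrC.
    by apply: is_derive_eq; rewrite [LHS]mulr1.
  have := @is_derive1_comp R (fun t => u (z + t *: delta_mx 0 i)) (fun s => s * c) s _ _ L M.
  by rewrite mulrC.
- move=> /andP[s0 s1].
  have zE : z + (1 * c) *: delta_mx 0 i = mix x y i.+1.
    apply/rowP => j; rewrite !mxE eqxx/= ltnS [(j <= i)%N]leq_eqVlt -val_eqE/= mul1r.
    have [/val_inj ->|ji] := eqVneq (j : nat) i; first by rewrite ltnn mulr1 /c subrKC.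
    by rewrite mulr0 addr0.
  rewrite zE !mul0r scale0r addr0 => ->.
  rewrite -/c -mulrBr normrM mulrC; apply: ler_pM => //.
    have s01 : 0 <= s <= 1 by rewrite !ltW.
    have /(_ i)[_ /ltW] := rH _ (pt s s01).
    by rewrite distrC.
  by have := row_norm_coord (x - y) i; rewrite !mxE.
Unshelve. all: by end_near. Qed.

End strict_diff.

Section strict_diff_calculus.
Context {R : realType}.

Lemma mulmx_norm_le m k (A : 'M[R]_(m, k)) : exists2 C : R, 0 < C &
  forall v : 'rV[R]_m, `|v *m A| <= C * `|v|.
Proof.
exists (1 + \sum_i \sum_j `|A i j|).
  by rewrite ltr_pwDl// sumr_ge0// => i _; rewrite sumr_ge0.
move=> v; apply: row_norm_le => [|j].
  by rewrite mulr_ge0// addr_ge0// sumr_ge0// => i _; rewrite sumr_ge0.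
rewrite mxE mulrDl mul1r; apply: le_trans (ler_norm_sum _ _ _) _.
rewrite -[leLHS]add0r lerD// mulr_suml; apply: ler_sum => i _.
rewrite normrM mulrC ler_pM//; last exact: row_norm_coord.
by rewrite (bigD1 j)//= lerDl sumr_ge0.
Qed.

Lemma mulcol_norm_le m (a : 'cV[R]_m) : exists2 C : R, 0 < C &
  forall v : 'rV[R]_m, `|(v *m a) 0 0| <= C * `|v|.
Proof.
have [C C0 H] := mulmx_norm_le a; exists C => // v.
exact: le_trans (row_norm_coord _ _) (H v).
Qed.

Lemma mulmx_col m k (v : 'rV[R]_m) (A : 'M[R]_(m, k)) j :
  (v *m col j A) 0 0 = (v *m A) 0 j.
Proof. by rewrite colE mulmxA -colE mxE. Qed.

Lemma strict_diffP m k (f : 'rV[R]_m -> 'rV[R]_k) x0 (A : 'M[R]_(m, k)) :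
  strict_diff f x0 A <-> forall j, strict_diff1 (fun x => f x 0 j) x0 (col j A).
Proof.
split=> [fA j e e0|fA e e0].
  near=> d => x y xd yd.
  have H : forall x y, ball x0 d x -> ball x0 d y ->
    `|f x - f y - (x - y) *m A| <= e * `|x - y| by near: d; exact: fA.
  apply: le_trans (H _ _ xd yd).
  have := row_norm_coord (f x - f y - (x - y) *m A) j; apply: le_trans.
  by rewrite mulmx_col !mxE.
near=> d => x y xd yd.
have H : forall j x y, ball x0 d x -> ball x0 d y ->
    `|f x 0 j - f y 0 j - ((x - y) *m col j A) 0 0| <= e * `|x - y|.
  near: d.
  have := @filter_forall _ 'I_k (fun j => [set d : R | forall x y, ball x0 d x -> ball x0 d y ->
    `|f x 0 j - f y 0 j - ((x - y) *m col j A) 0 0| <= e * `|x - y|])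
      (0^'+) _; apply.
  by move=> j; exact: fA.
apply: row_norm_le => [|j]; first by rewrite mulr_ge0// ltW.
by apply: le_trans (H j _ _ xd yd); rewrite mulmx_col !mxE.
Unshelve. all: by end_near. Qed.

Lemma near_near_ball m (P : set 'rV[R]_m) x0 : (\forall x \near x0, P x) ->
  \forall d \near 0^'+, forall x, ball x0 (d : R) x -> P x.
Proof.
move=> /nbhs_ballP[r /= r0 rP]; near=> d => x xd; apply: rP.
by apply: le_ball xd; near: d; exact: nbhs_right_le.
Unshelve. all: by end_near. Qed.

Lemma strict_diff1_lip m (u : 'rV[R]_m -> R) x0 a : strict_diff1 u x0 a ->
  exists2 C : R, 0 < C & \forall d \near 0^'+, forall x y, ball x0 (d : R) x -> ball x0 d y ->
    `|u x - u y| <= C * `|x - y|.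
Proof.
move=> ua; have [C C0 aC] := mulcol_norm_le a.
exists (C + 1); first by rewrite addr_gt0.
near=> d => x y xd yd.
have H : forall x y, ball x0 d x -> ball x0 d y ->
    `|u x - u y - ((x - y) *m a) 0 0| <= 1 * `|x - y| by near: d; exact: ua.
rewrite -[u x - u y](subrK (((x - y) *m a) 0 0)).
by rewrite (le_trans (ler_normD _ _))// addrC mulrDl lerD// H.
Unshelve. all: by end_near. Qed.

Lemma strict_diff1_continuous m (u : 'rV[R]_m -> R) x0 a : strict_diff1 u x0 a ->
  {for x0, continuous u}.
Proof.
move=> /strict_diff1_lip[C C0 uC].
apply/(@cvgrPdist_lt _ _ _ _ (nbhs_filter x0)) => e e0.
have [d [d0 dC]] : exists d : R, 0 < d /\ forall x y, ball x0 (d : R) x -> ball x0 d y ->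
    `|u x - u y| <= C * `|x - y|.
  near (0 : R)^'+ => d; exists d; split; first by near: d; exact: nbhs_right_gt.
  by near: d.
have m0 : 0 < Num.min d (e / C) by rewrite lt_min d0 divr_gt0.
apply: filterS (nbhsx_ballx x0 _ m0) => x xm.
have xd : ball x0 d x by apply: le_ball xm; rewrite ge_min lexx.
apply: le_lt_trans (dC _ _ (ballxx _ d0) xd) _.
rewrite mulrC -ltr_pdivlMr// -row_ballE.
by apply: le_ball xm; rewrite ge_min lexx orbT.
Unshelve. all: by end_near. Qed.

Lemma strict_diff_continuous m k (f : 'rV[R]_m -> 'rV[R]_k) x0 A :
  strict_diff f x0 A -> {for x0, continuous f}.
Proof.
move=> /strict_diffP fA; apply/(@cvgrPdist_lt _ _ _ _ (nbhs_filter x0)) => e e0.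
have : \forall x \near x0, forall j, `|f x0 0 j - f x 0 j| < e.
  have := @filter_forall _ 'I_k (fun j => [set x | `|f x0 0 j - f x 0 j| < e]) (nbhs x0) _; apply.
  by move=> j; have /strict_diff1_continuous/cvgrPdist_lt/(_ _ e0) := fA j.
apply: filterS => x H; apply: row_norm_lt => // j.
by have := H j; rewrite !mxE.
Qed.

Lemma near_eq_strict_diff1 m (u v : 'rV[R]_m -> R) x0 a :
  (\forall x \near x0, u x = v x) -> strict_diff1 u x0 a -> strict_diff1 v x0 a.
Proof.
move=> uv ua e e0; near=> d => x y xd yd.
have H : forall x y, ball x0 d x -> ball x0 d y ->
    `|u x - u y - ((x - y) *m a) 0 0| <= e * `|x - y| by near: d; exact: ua.
have E : forall x, ball x0 d x -> u x = v x by near: d; exact: near_near_ball.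
by rewrite -!E//; exact: H.
Unshelve. all: by end_near. Qed.

Lemma strict_diff1_cst m (c : R) (x0 : 'rV[R]_m) : strict_diff1 (fun=> c) x0 0.
Proof.
move=> e e0; apply: nearW => d x y _ _.
by rewrite mulmx0 mxE !subrr normr0 mulr_ge0// ltW.
Qed.

Lemma strict_diff1_coord m (i : 'I_m) (x0 : 'rV[R]_m) :
  strict_diff1 (fun x => x 0 i) x0 (delta_mx i 0).
Proof.
move=> e e0; apply: nearW => d x y _ _.
by rewrite -colE !mxE subrr normr0 mulr_ge0// ltW.
Qed.

Lemma strict_diff1D m (u v : 'rV[R]_m -> R) x0 a b :
  strict_diff1 u x0 a -> strict_diff1 v x0 b ->
  strict_diff1 (fun x => u x + v x) x0 (a + b).
Proof.
move=> ua vb e e0; have e20 : 0 < e / 2 by rewrite divr_gt0.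
near=> d => x y xd yd.
have H1 : forall x y, ball x0 d x -> ball x0 d y ->
    `|u x - u y - ((x - y) *m a) 0 0| <= e / 2 * `|x - y| by near: d; exact: ua.
have H2 : forall x y, ball x0 d x -> ball x0 d y ->
    `|v x - v y - ((x - y) *m b) 0 0| <= e / 2 * `|x - y| by near: d; exact: vb.
have := lerD (H1 _ _ xd yd) (H2 _ _ xd yd).
rewrite -mulrDl -splitr; apply: le_trans.
apply: le_trans (ler_normD _ _); rewrite mulmxDr [X in _ - X]mxE.
by rewrite le_eqVlt; apply/orP; left; apply/eqP; congr `|_|; ring.
Unshelve. all: by end_near. Qed.

Lemma strict_diff1_sum m (I : finType) (u : I -> 'rV[R]_m -> R) x0 a :
  (forall i, strict_diff1 (u i) x0 (a i)) ->
  strict_diff1 (fun x => \sum_i u i x) x0 (\sum_i a i).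
Proof.
move=> ua; pose F (s : seq I) := strict_diff1 (fun x => \sum_(i <- s) u i x) x0 (\sum_(i <- s) a i).
suff : F (index_enum I) by [].
elim: (index_enum I) => [|i s IH]; rewrite /F.
  rewrite big_nil; under [X in strict_diff1 X]eq_fun do rewrite big_nil.
  exact: strict_diff1_cst.
rewrite big_cons; under [X in strict_diff1 X]eq_fun do rewrite big_cons.
exact: strict_diff1D.
Qed.

Lemma strict_diff1M m (u v : 'rV[R]_m -> R) x0 a b :
  strict_diff1 u x0 a -> strict_diff1 v x0 b ->
  strict_diff1 (fun x => u x * v x) x0 (v x0 *: a + u x0 *: b).
Proof.
move=> ua vb e e0.
have [Cu Cu0 uC] := strict_diff1_lip ua; have [Cv Cv0 vC] := strict_diff1_lip vb.
pose K := `|u x0| + `|v x0| + Cu + Cv.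
have K0 : 0 < K.
  by have ? := normr_ge0 (u x0); have ? := normr_ge0 (v x0); rewrite /K; lra.
pose e1 := e / K; have e10 : 0 < e1 by rewrite divr_gt0.
near=> d => x y xd yd.
have H1 : forall x y, ball x0 d x -> ball x0 d y ->
    `|u x - u y - ((x - y) *m a) 0 0| <= e1 * `|x - y| by near: d; exact: ua.
have H2 : forall x y, ball x0 d x -> ball x0 d y ->
    `|v x - v y - ((x - y) *m b) 0 0| <= e1 * `|x - y| by near: d; exact: vb.
have L1 : forall x y, ball x0 d x -> ball x0 d y -> `|u x - u y| <= Cu * `|x - y| by near: d.
have L2 : forall x y, ball x0 d x -> ball x0 d y -> `|v x - v y| <= Cv * `|x - y| by near: d.
have N1 : forall x, ball x0 d x -> `|u x0 - u x| < e1.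
  near: d; apply: (@near_near_ball _ [set x | `|u x0 - u x| < e1]).
  by have /strict_diff1_continuous/cvgrPdist_lt/(_ _ e10) := ua.
have N2 : forall x, ball x0 d x -> `|v x0 - v x| < e1.
  near: d; apply: (@near_near_ball _ [set x | `|v x0 - v x| < e1]).
  by have /strict_diff1_continuous/cvgrPdist_lt/(_ _ e10) := vb.
rewrite mulmxDr -!scalemxAr [X in _ - X]mxE [X in _ - (X + _)]mxE [X in _ - (_ + X)]mxE.
set la := ((x - y) *m a) 0 0; set lb := ((x - y) *m b) 0 0.
have -> : u x * v x - u y * v y - (v x0 * la + u x0 * lb) =
  (u x - u y - la) * v x0 + u x0 * (v x - v y - lb) +
  (u x - u y) * (v x - v x0) + (u y - u x0) * (v x - v y) by ring.
have -> : e = e1 * K by rewrite /e1 divfK// gt_eqF.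
have T1 : `|(u x - u y - la) * v x0| <= e1 * `|v x0| * `|x - y|.
  by rewrite normrM mulrAC ler_wpM2r// H1.
have T2 : `|u x0 * (v x - v y - lb)| <= e1 * `|u x0| * `|x - y|.
  by rewrite normrM [e1 * _]mulrC -mulrA ler_wpM2l// H2.
have T3 : `|(u x - u y) * (v x - v x0)| <= e1 * Cu * `|x - y|.
  by rewrite normrM mulrC -mulrA ler_pM// ?L1// distrC ltW// N2.
have T4 : `|(u y - u x0) * (v x - v y)| <= e1 * Cv * `|x - y|.
  by rewrite normrM -mulrA ler_pM// ?L2// distrC ltW// N1.
apply: le_trans (ler_normD _ _) _; apply: le_trans (lerD (ler_normD _ _) (lexx _)) _.
apply: le_trans (lerD (lerD (ler_normD _ _) (lexx _)) (lexx _)) _.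
apply: le_trans (lerD (lerD (lerD T1 T2) T3) T4) _.
by rewrite le_eqVlt; apply/orP; left; apply/eqP; rewrite /K; ring.
Unshelve. all: by end_near. Qed.

Lemma strict_diff1V m (u : 'rV[R]_m -> R) x0 a : u x0 != 0 ->
  strict_diff1 u x0 a ->
  strict_diff1 (fun x => (u x)^-1) x0 (- (u x0) ^- 2 *: a).
Proof.
move=> u0 ua e e0.
have [C C0 uC] := strict_diff1_lip ua.
pose S := (u x0)^-1.
pose K := C * (1 + `|S| + `|S|) + `|S| ^+ 2.
have K0 : 0 < K by rewrite ltr_pwDl ?exprn_ge0// mulr_gt0// -addrA ltr_pwDl// addr_ge0.
pose e1 := Num.min 1 (e / K).
have e10 : 0 < e1 by rewrite lt_min ltr01 divr_gt0.
near=> d => x y xd yd.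
have H1 : forall x y, ball x0 d x -> ball x0 d y ->
    `|u x - u y - ((x - y) *m a) 0 0| <= e1 * `|x - y| by near: d; exact: ua.
have L1 : forall x y, ball x0 d x -> ball x0 d y -> `|u x - u y| <= C * `|x - y| by near: d.
have N1 : forall x, ball x0 d x -> `|S - (u x)^-1| < e1.
  near: d; apply: (@near_near_ball _ [set x | `|S - (u x)^-1| < e1]).
  have := strict_diff1_continuous ua => /(cvgV u0).
  by move=> /cvgrPdist_lt/(_ _ e10).
have N0 : forall x, ball x0 d x -> u x != 0.
  near: d; apply: (@near_near_ball _ [set x | u x != 0]).
  have := strict_diff1_continuous ua; move=> /cvgrPdist_lt/(_ `|u x0|).
  rewrite normr_gt0 => /(_ u0); apply: filterS => z; apply: contraTneq => ->.
  by rewrite subr0 ltxx.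
rewrite -scalemxAr [X in _ - X]mxE -exprVn -/S.
set la := ((x - y) *m a) 0 0; set P := (u x)^-1; set Q := (u y)^-1.
have -> : P - Q - - S ^+ 2 * la =
   (u x - u y) * ((S - P) * Q + (S - Q) * S) - S ^+ 2 * (u x - u y - la).
  have uP : u x * P = 1 by rewrite /P mulfV// N0.
  have uQ : u y * Q = 1 by rewrite /Q mulfV// N0.
  have -> : P - Q = - (u x - u y) * (P * Q).
    by rewrite mulNr mulrBl mulrA uP mul1r mulrCA uQ mulr1 opprB addrC; ring.
  ring.
have QS : `|Q| <= 1 + `|S|.
  have -> : Q = - (S - Q) + S by ring.
  rewrite (le_trans (ler_normD _ _))// lerD2r normrN (le_trans (ltW (N1 _ yd)))//.
  by rewrite ge_min lexx.
apply: le_trans (ler_normB _ _) _; rewrite !normrM.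
have T1 : `|(S - P) * Q + (S - Q) * S| <= e1 * (1 + `|S| + `|S|).
  rewrite [leRHS]mulrDr (le_trans (ler_normD _ _))// !normrM lerD// ler_pM//;
    exact/ltW/N1.
apply: (@le_trans _ _ ((C * `|x - y|) * (e1 * (1 + `|S| + `|S|)) +
   `|S| ^+ 2 * (e1 * `|x - y|))).
  apply: lerD; first by apply: ler_pM => //; exact: L1.
  by apply: ler_wpM2l; [exact: (exprn_ge0 2 (normr_ge0 S))|exact: H1].
apply: (@le_trans _ _ (e1 * K * `|x - y|)); first by rewrite le_eqVlt; apply/orP; left; apply/eqP; rewrite /K; ring.
by rewrite ler_wpM2r// -ler_pdivlMr// ge_min lexx orbT.
Unshelve. all: by end_near. Qed.

Lemma strict_diff_comp m k l (f : 'rV[R]_m -> 'rV[R]_k) (g : 'rV[R]_k -> 'rV[R]_l)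
    x0 A B : strict_diff f x0 A -> strict_diff g (f x0) B ->
  strict_diff (g \o f) x0 (A *m B).
Proof.
move=> fA gB e e0.
have [CA CA0 AC] := mulmx_norm_le A; have [CB CB0 BC] := mulmx_norm_le B.
pose e1 := e / 2 / CB; pose e2 := e / 2 / (CA + 1).
have e10 : 0 < e1 by rewrite !divr_gt0.
have e20 : 0 < e2 by rewrite !divr_gt0// addr_gt0.
have [r [r0 rg]] : exists r : R, 0 < r /\ forall x y, ball (f x0) r x -> ball (f x0) r y ->
    `|g x - g y - (x - y) *m B| <= e2 * `|x - y|.
  near (0 : R)^'+ => r; exists r; split; first by near: r; exact: nbhs_right_gt.
  by near: r; exact: gB.
near=> d => x y xd yd.
have H1 : forall x y, ball x0 d x -> ball x0 d y ->
    `|f x - f y - (x - y) *m A| <= e1 * `|x - y| by near: d; exact: fA.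
have H2 : forall x y, ball x0 d x -> ball x0 d y ->
    `|f x - f y - (x - y) *m A| <= 1 * `|x - y| by near: d; exact: fA.
have N : forall x, ball x0 d x -> ball (f x0) r (f x).
  near: d; apply: near_near_ball; have := strict_diff_continuous fA.
  by apply; exact: nbhsx_ballx.
have L : `|f x - f y| <= (CA + 1) * `|x - y|.
  rewrite -[f x - f y](subrK ((x - y) *m A)) (le_trans (ler_normD _ _))// addrC.
  by rewrite mulrDl lerD// H2.
have -> : (g \o f) x - (g \o f) y - (x - y) *m (A *m B) =
    (g (f x) - g (f y) - (f x - f y) *m B) + (f x - f y - (x - y) *m A) *m B.
  by rewrite [X in _ = _ + X]mulmxBl mulmxA /= subrKA.
rewrite (le_trans (ler_normD _ _))// [e]splitr mulrDl lerD//.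
  apply: le_trans (rg _ _ (N _ xd) (N _ yd)) _.
  apply: (@le_trans _ _ (e2 * ((CA + 1) * `|x - y|))); first by rewrite ler_wpM2l// ltW.
  by rewrite mulrA /e2 divfK// gt_eqF// addr_gt0.
apply: le_trans (BC _) _.
apply: (@le_trans _ _ (CB * (e1 * `|x - y|))); first by rewrite ler_wpM2l ?(ltW CB0)// H1.
by rewrite mulrA /e1 mulrC [CB * _]mulrC divfK ?gt_eqF// mulrC.
Unshelve. all: by end_near. Qed.

End strict_diff_calculus.

(** * Change of variables *)

Section local_volume.
Context {R : realType}.
Local Notation lam := (lebesgue_rV R).

Lemma continuous_open_measurable m k (O : set 'rV[R]_m) (f : 'rV[R]_m -> 'rV[R]_k) :
  open O -> (forall x, O x -> {for x, continuous f}) -> measurable_fun O f.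
Proof.
move=> oO fc; apply: (@measurability _ _ _ _ _ _ (@open 'rV[R]_k)) => //.
move=> _ [U oU <-]; suff oV : open (O `&` f @^-1` U) by exact: open_measurable_mx.
rewrite openE => x [Ox Ux]; apply: filterI; first exact: open_nbhs_nbhs.
by apply: (fc x Ox); exact: open_nbhs_nbhs.
Qed.

Lemma lipschitz_continuous m k (O : set 'rV[R]_m) (f : 'rV[R]_m -> 'rV[R]_k) (C : R) :
  0 < C -> open O -> (forall x y, O x -> O y -> `|f x - f y| <= C * `|x - y|) ->
  forall x, O x -> {for x, continuous f}.
Proof.
move=> C0 oO fC x Ox; apply/(@cvgrPdist_lt _ _ _ _ (nbhs_filter x)) => e e0.
have eC : 0 < e / C by rewrite divr_gt0.
apply: filterS2 (open_nbhs_nbhs (conj oO Ox)) (nbhsx_ballx x _ eC) => y Oy.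
rewrite row_ballE => xy; apply: le_lt_trans (fC _ _ Ox Oy) _.
by rewrite mulrC -ltr_pdivlMr.
Qed.

Lemma measurable_image_compact m k (K : set 'rV[R]_m) (f : 'rV[R]_m -> 'rV[R]_k) :
  compact K -> {within K, continuous f} ->
  (forall x y, K x -> K y -> f x = f y -> x = y) ->
  forall E, E `<=` K -> measurable E -> measurable (f @` E).
Proof.
move=> cK fc fI E EK mE; rewrite -(setIidl EK); move: E mE {EK}.
have mC F : closed F -> measurable (f @` (F `&` K)).
  move=> cF; rewrite -[X in measurable X]setCK; apply: measurableC.
  apply: open_measurable_mx; apply: closed_openC; apply: compact_closed => //.
  apply: continuous_compact.
    by apply: continuous_subspaceW fc; exact: subIsetr.
  by rewrite setIC; exact: compact_closedI.
have imD A : f @` (~` A `&` K) = f @` K `\` f @` (A `&` K).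
  apply/seteqP; split=> [_ [x [Ax Kx] <-]|_ [[x Kx <-] nx]].
    split; [by exists x|move=> [y [Ay Ky] /fI yx]].
    by apply: Ax; rewrite -yx.
  exists x => //; split=> // Ax; apply: nx.
  by exists x.
have mK : measurable (f @` K).
  by have := mC setT closedT; rewrite setTI.
apply: smallest_sub; last first.
  move=> U oU /=; rewrite -[U]setCK imD; apply: measurableD => //.
  by apply: mC; exact: open_closedC.
split=> [|A mA|A mA] /=.
- by rewrite set0I image_set0; exact: measurable0.
- by rewrite setTD imD; exact: measurableD.
- rewrite setI_bigcupl image_bigcup; exact: bigcupT_measurable.
Qed.

Lemma root_gt1 n (K : R) : 1 < K -> exists2 L : R, 1 < L & L ^+ n <= K.
Proof.
move=> K1.
have : (fun x : R => x ^+ n) x @[x --> (1 : R)^'+] --> (1 : R) ^+ n.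
  by apply: cvg_at_right_filter; exact: exprn_continuous.
rewrite expr1n => /cvgrPdist_lt/(_ (K - 1)).
rewrite subr_gt0 => /(_ K1) H.
near (1 : R)^'+ => L; exists L; first by near: L; exact: nbhs_right_gt.
have : `|1 - L ^+ n| < K - 1 by near: L.
by rewrite ltr_norml => /andP[+ _]; lra.
Unshelve. all: by end_near. Qed.

Lemma strict_diff_volume n (G : 'rV[R]_n -> 'rV[R]_n) x0 (A : 'M[R]_n) (K : R) :
  strict_diff G x0 A -> \det A != 0 -> 1 < K ->
  exists2 d : R, 0 < d & forall E, measurable E -> E `<=` ball x0 d ->
    [/\ measurable (G @` E),
        (lam n (G @` E) <= (K * `|\det A|)%:E * lam n E)%E &
        (`|\det A|%:E * lam n E <= K%:E * lam n (G @` E))%E].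
Proof.
move=> GA dA K1.
have uA : A \in unitmx by rewrite unitmxE unitfE.
have [L L1 LK] := root_gt1 n K1.
have L0 : 0 < L by lra.
pose B := invmx A.
have [C C0 BC] := mulmx_norm_le B.
pose e := 1 - L^-1.
have e0 : 0 < e by rewrite subr_gt0 invf_lt1.
have [d0 [d00 Gd]] : exists d : R, 0 < d /\ forall x y, ball x0 (d : R) x -> ball x0 d y ->
    `|G x - G y - (x - y) *m A| <= e / C * `|x - y|.
  near (0 : R)^'+ => d; exists d; split; first by near: d; exact: nbhs_right_gt.
  by near: d; apply: GA; rewrite divr_gt0.
pose F x := G x *m B.
have Fd x y : ball x0 d0 x -> ball x0 d0 y -> `|F x - F y - (x - y)| <= e * `|x - y|.
  move=> xd yd.
  have -> : F x - F y - (x - y) = (G x - G y - (x - y) *m A) *m B.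
    by rewrite !mulmxBl -!mulmxA mulmxV// !mulmx1.
  apply: le_trans (BC _) _; rewrite -ler_pdivlMl// mulrA [C^-1 * e]mulrC.
  exact: Gd.
have FL x y : ball x0 d0 x -> ball x0 d0 y -> `|F x - F y| <= L * `|x - y|.
  move=> xd yd; rewrite -[F x - F y](subrK (x - y)).
  apply: le_trans (ler_normD _ _) _; apply: le_trans (lerD (Fd _ _ xd yd) (lexx _)) _.
  rewrite -{2}[`|x - y|]mul1r -mulrDl ler_wpM2r// /e.
  have : (L - 1) ^+ 2 * L^-1 >= 0 by rewrite mulr_ge0 ?sqr_ge0// invr_ge0 ltW.
  have -> : (L - 1) ^+ 2 * L^-1 = L - 2 + L^-1 by field; rewrite gt_eqF.
  by lra.
have FL' x y : ball x0 d0 x -> ball x0 d0 y -> `|x - y| <= L * `|F x - F y|.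
  move=> xd yd; rewrite -ler_pdivrMl//.
  have -> : L^-1 * `|x - y| = `|x - y| - e * `|x - y| by rewrite /e; ring.
  rewrite lerBlDr -lerBlDl; apply: le_trans (Fd _ _ xd yd).
  by rewrite [leRHS]distrC; exact: lerB_dist.
have FI x y : ball x0 d0 x -> ball x0 d0 y -> F x = F y -> x = y.
  move=> xd yd Fxy; apply/eqP; rewrite -subr_eq0 -normr_le0.
  by apply: le_trans (FL' _ _ xd yd) _; rewrite Fxy subrr normr0 mulr0.
have oB : open (ball x0 d0) by exact: ball_open.
have Fcont := lipschitz_continuous L0 oB FL.
pose d := d0 / 2.
have dd : 0 < d by rewrite divr_gt0.
exists d => // E mE Ed.
pose KK : set 'rV[R]_n := [set x | `|x0 - x| <= d].
have KKd : KK `<=` ball x0 d0.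
  by move=> x /= xd; rewrite row_ballE; apply: le_lt_trans xd _; rewrite /d; lra.
have EKK : E `<=` KK by move=> x /Ed; rewrite row_ballE => /ltW.
have cKK : compact KK.
  apply: bounded_closed_compact.
    exists (`|x0| + d); split; first exact: num_real.
    move=> M M1 x /= xd; apply: le_trans (ltW M1).
    rewrite -lerBlDl (le_trans _ xd)// (le_trans (lerB_dist _ _))//.
    by rewrite distrC.
  rewrite -[KK]setCK; apply: open_closedC.
  rewrite openE => x /= /negP; rewrite -ltNge => dx.
  have r0 : 0 < `|x0 - x| - d by rewrite subr_gt0.
  apply: filterS (nbhsx_ballx x _ r0) => y; rewrite row_ballE /= => xy xd.
  have := ler_normD (x0 - y) (y - x).
  have xd' : `|x0 - y| <= d := xd.
  by rewrite subrKA [`|y - x|]distrC => H; lra.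
have mFE H : H `<=` E -> measurable H -> measurable (F @` H).
  move=> HE mH; apply: (@measurable_image_compact _ _ KK) => //.
  - apply: continuous_in_subspaceT => x; rewrite inE => xK.
    by apply: Fcont; exact: KKd.
  - by move=> x y xK yK; apply: FI; exact: KKd.
  - exact: subset_trans EKK.
have Ed0 : E `<=` ball x0 d0 by exact: subset_trans KKd.
have mFE' := mFE E (@subset_refl _ E) mE.
have up : (lam n (F @` E) <= (L ^+ n)%:E * lam n E)%E.
  apply: (@lipschitz_image _ _ _ _ _ d x0) => //; first exact: ltW.
  by move=> x y /Ed0 xd /Ed0 yd; exact: FL.
pose Fi y := xget x0 (E `&` F @^-1` [set y]).
have FiK x : E x -> Fi (F x) = x.
  move=> Ex; rewrite /Fi; case: xgetP => [z _ [/= Ez Fz]|/(_ x)[]//].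
  by apply: FI => //; exact: Ed0.
have FiE H : H `<=` F @` E -> Fi @` H = E `&` F @^-1` H.
  move=> HE; apply/seteqP; split=> [_ [y Hy <-]|x [Ex Hx]].
    by have [x Ex xy] := HE _ Hy; rewrite -xy FiK//; split=> //=; rewrite xy.
  by exists (F x) => //; exact: FiK.
have lo : (lam n E <= (L ^+ n)%:E * lam n (F @` E))%E.
  have {1}-> : E = Fi @` (F @` E).
    by rewrite FiE//; apply/seteqP; split=> x; [move=> Ex; split=> //; exists x|case].
  apply: (@lipschitz_image _ _ _ _ _ (L * d + 1) (F x0)) => //; first exact: ltW.
  - move=> _ [x Ex <-]; rewrite row_ballE ltr_pwDr//.
    apply: le_trans (FL _ _ (ballxx _ d00) (Ed0 _ Ex)) _.
    by rewrite ler_wpM2l ?(ltW L0)//; exact: EKK.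
  - move=> _ _ [x Ex <-] [y Ey <-]; rewrite !FiK//.
    by apply: FL'; exact: Ed0.
  - move=> H HF mH; rewrite FiE//.
    have mF := continuous_open_measurable oB Fcont.
    have : measurable (E `&` (ball x0 d0 `&` F @^-1` H)).
      by apply: measurableI => //; apply: mF => //; exact: measurable_row_ball.
    by rewrite setIA (setIidl Ed0).
have GE : G @` E = (fun y => y *m B + 0) @^-1` (F @` E).
  apply/seteqP; split=> [_ [x Ex <-]|y [x Ex]] /=.
    by exists x => //; rewrite addr0.
  rewrite addr0 /F => xy; exists x => //.
  by rewrite -[LHS]mulmx1 -[RHS]mulmx1 -(mulVmx uA) !mulmxA -/B xy.
have dB : \det B != 0 by rewrite det_inv invr_eq0.
have vol : (`|\det A|%:E * lam n (F @` E) = lam n (G @` E))%E.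
  rewrite -(scales_volume_unit dB 0 mFE') -GE muleA -EFinM -normrM -det_mulmx.
  by rewrite mulmxV// det1 normr1 mul1e.
have mGE : measurable (G @` E).
  by rewrite GE -[X in measurable X]setTI; exact: measurable_row_affine.
split=> //.
- rewrite -vol mulrC EFinM -muleA; apply: lee_wpmul2l => //.
  apply: le_trans up _; apply: lee_wpmul2r => //.
- rewrite -vol muleCA; apply: lee_wpmul2l => //.
  by apply: le_trans lo _; apply: lee_wpmul2r.
Unshelve. all: by end_near. Qed.

End local_volume.

Section change_of_variables.
Context {R : realType}.
Local Notation lam := (lebesgue_rV R).

Lemma strict_diff_coef_continuous m k (f : 'rV[R]_m -> 'rV[R]_k) x0
    (A : 'rV[R]_m -> 'M[R]_(m, k)) i j :
  (\forall x \near x0, strict_diff f x (A x)) ->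
  {for x0, continuous (fun x => A x i j)}.
Proof.
move=> fA; apply/(@cvgrPdist_lt _ _ _ _ (nbhs_filter x0)) => e e0.
have e30 : 0 < e / 3 by rewrite divr_gt0.
have /nbhs_ballP[r /= r0 rA] := fA.
have [d [d0 dr H0]] : exists d : R, [/\ 0 < d, d <= r & forall x y, ball x0 d x -> ball x0 d y ->
    `|f x - f y - (x - y) *m A x0| <= e / 3 * `|x - y|].
  near (0 : R)^'+ => d; exists d; split.
  - by near: d; exact: nbhs_right_gt.
  - by near: d; exact: nbhs_right_le.
  - by near: d; apply: (rA _ (ballxx _ r0)).
apply: filterS (nbhsx_ballx x0 _ d0) => x xd.
have xA : strict_diff f x (A x) by apply: rA; exact: le_ball xd.
have xd' : 0 < d - `|x0 - x| by rewrite subr_gt0 -row_ballE.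
near (0 : R)^'+ => s.
have s0 : 0 < s by near: s; exact: nbhs_right_gt.
have sd : s < d - `|x0 - x| by near: s; exact: nbhs_right_lt.
pose y := x + (s / 2) *: delta_mx 0 i.
have s20 : 0 < s / 2 by rewrite divr_gt0.
have yx : `|y - x| <= s / 2.
  rewrite /y addrAC subrr add0r; apply: row_norm_le => [|l]; first exact: ltW.
  rewrite !mxE eqxx/=; case: (l == i); first by rewrite mulr1 ger0_norm// ltW.
  by rewrite mulr0 normr0 ltW.
have s2 : s / 2 < s by rewrite ltr_pdivrMr// mulr_natr mulr2n ltrDl.
have yd : ball x0 d y.
  rewrite row_ballE -(subrKA x) (le_lt_trans (ler_normD _ _))//.
  by rewrite [`|x - y|]distrC; lra.
have H1 : forall y z, ball x s y -> ball x s z ->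
    `|f y - f z - (y - z) *m A x| <= e / 3 * `|y - z| by near: s; exact: xA.
have h1 : `|f y - f x - (y - x) *m A x| <= e / 3 * `|y - x|.
  apply: H1; last exact: ballxx.
  by rewrite row_ballE distrC; exact: le_lt_trans s2.
have h0 := H0 _ _ yd xd.
have : `|(y - x) *m A x0 - (y - x) *m A x| <= 2 * (e / 3) * (s / 2).
  have -> : (y - x) *m A x0 - (y - x) *m A x =
    (f y - f x - (y - x) *m A x) - (f y - f x - (y - x) *m A x0).
    by rewrite opprB [RHS]addrC subrKA.
  apply: le_trans (ler_normB _ _) _; apply: le_trans (lerD h1 h0) _.
  by rewrite -mulrDl [2 * _]mulr_natl mulr2n ler_wpM2l// addr_ge0// ltW.
rewrite -mulmxBr => h; have := le_trans (row_norm_coord _ j) h.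
rewrite /y addrAC subrr add0r -scalemxAl -rowE !mxE normrM gtr0_norm// mulrC.
by rewrite ler_pM2r// => /le_lt_trans; apply; lra.
Unshelve. all: by end_near. Qed.

Lemma det_continuous (T : topologicalType) n (A : T -> 'M[R]_n) x0 :
  (forall i j, {for x0, continuous (fun x => A x i j)}) ->
  {for x0, continuous (fun x => \det (A x))}.
Proof.
move=> cA; rewrite /determinant; apply: cvg_big => [|s _].
  by move=> x; exact: add_continuous.
apply: cvgM; first exact: cvg_cst.
apply: cvg_big => [|i _]; first by move=> x; exact: mul_continuous.
exact: cA.
Qed.

Lemma rational_ball n (x : 'rV[R]_n) (d : R) : 0 < d ->
  exists qe : 'rV[rat]_n * rat, let b := ball (map_mx ratr qe.1 : 'rV[R]_n) (ratr qe.2 : R) in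
    [/\ (0 < qe.2)%R, b x & b `<=` ball x d].
Proof.
move=> d0; have [e] := rat_in_itvoo (divr_gt0 d0 (ltr0n R 2)).
rewrite in_itv/= => /andP[e0 ed].
have e0' : (0 < e)%R by rewrite -(ltr0q R).
have /choice[q qP] (i : 'I_n) : exists q : rat, `|ratr q - x 0 i| < ratr e :> R.
  have lt : x 0 i - ratr e < x 0 i + ratr e by rewrite ltrD2l gtrN.
  have [q] := rat_in_itvoo lt; rewrite in_itv/= => /andP[q1 q2].
  exists q; rewrite distrC ltr_distlC; apply/andP; split; lra.
exists (\row_i q i, e); rewrite /=.
have bx : ball (map_mx ratr (\row_i q i) : 'rV[R]_n) (ratr e) x.
  by rewrite row_ballE; apply: row_norm_lt => // i; rewrite !mxE.
split=> // y yb; rewrite [d]splitr.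
apply: (@ball_triangle _ _ (map_mx ratr (\row_i q i) : 'rV[R]_n)).
  by apply: le_ball (ball_sym bx); exact: (ltW ed).
by apply: le_ball yb; exact: (ltW ed).
Qed.

Lemma lee_mul_gt1 (a b : \bar R) : (0 <= a)%E -> (0 <= b)%E ->
  (forall K : R, 1 < K -> (a <= K%:E * b)%E) -> (a <= b)%E.
Proof.
move=> a0 b0 H; case: b b0 H => [b||]; [|by move=> *; rewrite leey|by []].
rewrite lee_fin => b0 H; apply/lee_addgt0Pr => e e0.
apply: le_trans (H (1 + e / (b + 1)) _) _.
  by rewrite ltrDl divr_gt0// ltr_wpDl.
rewrite -EFinM -EFinD lee_fin mulrDl mul1r lerD2l -mulrA ler_piMr ?(ltW e0)//.
by rewrite mulrC ler_pdivrMr ?ltr_wpDl// mul1r lerDl.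
Qed.

Variables (n : nat) (D : set 'rV[R]_n) (G : 'rV[R]_n -> 'rV[R]_n).
Variable (A : 'rV[R]_n -> 'M[R]_n).
Hypotheses (oD : open D) (GA : forall x, D x -> strict_diff G x (A x)).
Hypotheses (detA : forall x, D x -> \det (A x) != 0).
Hypothesis injG : forall x y, D x -> D y -> G x = G y -> x = y.
Let J x := `|\det (A x)|.

Let Jcont x : D x -> {for x, continuous J}.
Proof.
move=> Dx; apply: continuous_comp; last exact: norm_continuous.
apply: det_continuous => i j; apply: strict_diff_coef_continuous.
by apply: filterS (open_nbhs_nbhs (conj oD Dx)) => y; exact: GA.
Qed.

Lemma measurable_jacobian : measurable_fun D (fun x => (J x)%:E).
Proof.
apply/measurable_EFinP; apply: measurableT_comp => //.
apply: measurable_sum => s; apply: measurable_funM => //; apply: measurable_prod => i _.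
have H (u : 'rV[R]_n -> R) : (forall x, D x -> {for x, continuous u}) -> measurable_fun D u.
  move=> uc; apply: (measurability _ (RGenOpens.measurableE R)).
  move=> _ [_ [a [b ->]] <-]; suff oV : open (D `&` u @^-1` `]a, b[) by exact: open_measurable_mx.
  rewrite openE => x [Dx Ux]; apply: filterI; first exact: open_nbhs_nbhs.
  by apply: (uc x Dx); apply: open_nbhs_nbhs; split => //; exact: interval_open.
apply: H => x Dx; apply: strict_diff_coef_continuous.
by apply: filterS (open_nbhs_nbhs (conj oD Dx)) => y; exact: GA.
Qed.

Let good (K : R) (B : set 'rV[R]_n) := B `<=` D /\
  forall E, measurable E -> E `<=` B ->
  [/\ measurable (G @` E), (lam n (G @` E) <= K%:E * \int[lam n]_(x in E) (J x)%:E)%E &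
      (\int[lam n]_(x in E) (J x)%:E <= K%:E * lam n (G @` E))%E].

Let good_ball (K : R) x : 1 < K -> D x -> exists2 d : R, 0 < d & good K (ball x d).
Proof.
move=> K1 Dx; have [L L1 LK] := root_gt1 2 K1.
have L0 : 0 < L by lra.
have Jx : 0 < J x by rewrite normr_gt0 detA.
have [d d0 Hd] := strict_diff_volume (GA Dx) (detA Dx) L1.
have /nbhs_ballP[r /= r0 rP] : \forall y \near x, [/\ D y, J y <= L * J x & J x <= L * J y].
  have c1 : \forall y \near x, J y < L * J x.
    apply: (cvgr_lt (J x) (Jcont Dx)).
    by rewrite ltr_pMl.
  have c2 : \forall y \near x, L^-1 * J x < J y.
    apply: (cvgr_gt (J x) (Jcont Dx)).
    by rewrite gtr_pMl// invf_lt1.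
  near=> y; split.
  - by near: y; exact: open_nbhs_nbhs.
  - by apply: ltW; near: y.
  - by rewrite -ler_pdivrMl//; apply: ltW; near: y.
exists (Num.min d r); first by rewrite lt_min d0.
split=> [y yd|E mE Ed].
  have [] // := rP y _; apply: le_ball yd; by rewrite ge_min lexx orbT.
have Ed' : E `<=` ball x d.
  by apply: subset_trans Ed _; apply: le_ball; rewrite ge_min lexx.
have Er y : E y -> [/\ D y, J y <= L * J x & J x <= L * J y].
  by move=> /Ed yd; apply: rP; apply: le_ball yd; rewrite ge_min lexx orbT.
have [mGE up lo] := Hd _ mE Ed'.
have mJ : measurable_fun E (fun x => (J x)%:E).
  apply: measurable_funS measurable_jacobian => //.
    exact: open_measurable_mx.
  by move=> y /Er[].
split=> //.
- apply: le_trans up _; rewrite EFinM -muleA -/(J x).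
  have H : ((J x)%:E * lam n E <= L%:E * \int[lam n]_(x in E) (J x)%:E)%E.
    rewrite -integral_cst// -ge0_integralZl//;
      [|by move=> y _; rewrite lee_fin; exact: normr_ge0|by rewrite lee_fin ltW].
    apply: ge0_le_integral => //.
    + by move=> y _; rewrite lee_fin ltW.
    + exact: measurable_funeM.
    + by move=> y /Er[_ _ h]; rewrite lee_fin.
  apply: (@le_trans _ _ (L%:E * (L%:E * \int[lam n]_(x in E) (J x)%:E))%E).
    by apply: lee_wpmul2l => //; rewrite lee_fin ltW.
  rewrite muleA -EFinM; apply: lee_wpmul2r; first by apply: integral_ge0 => y _; rewrite lee_fin; exact: normr_ge0.
  by rewrite lee_fin -expr2.
- apply: (@le_trans _ _ (\int[lam n]_(y in E) (L * J x)%:E)%E).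
    apply: ge0_le_integral => //; first by move=> y _; rewrite lee_fin; exact: normr_ge0.
    by move=> y /Er[_ h _]; rewrite lee_fin.
  rewrite integral_cst// EFinM -muleA.
  apply: (@le_trans _ _ (L%:E * (L%:E * lam n (G @` E)))%E).
    by apply: lee_wpmul2l => //; rewrite lee_fin ltW.
  by rewrite muleA -EFinM; apply: lee_wpmul2r.
Unshelve. all: by end_near. Qed.

Theorem change_of_variables E : measurable E -> E `<=` D ->
  measurable (G @` E) /\ lam n (G @` E) = (\int[lam n]_(x in E) `|\det (A x)|%:E)%E.
Proof.
move=> mE ED.
have mJ : measurable_fun E (fun x => (J x)%:E).
  by apply: measurable_funS measurable_jacobian => //; exact: open_measurable_mx.
have J0 x : (0 <= (J x)%:E)%E by rewrite lee_fin normr_ge0.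
suff H (K : R) : 1 < K ->
  [/\ measurable (G @` E), (lam n (G @` E) <= K%:E * \int[lam n]_(x in E) (J x)%:E)%E &
      (\int[lam n]_(x in E) (J x)%:E <= K%:E * lam n (G @` E))%E].
  have [mGE _ _] := H 2 (ltr1n R 2); split=> //; apply/eqP; rewrite eq_le; apply/andP; split.
    apply: lee_mul_gt1 => //; first by apply: integral_ge0 => x _; exact: J0.
    by move=> K /H[].
  apply: lee_mul_gt1 => //; first by apply: integral_ge0 => x _; exact: J0.
  by move=> K /H[].
move=> K1.
pose b (qe : 'rV[rat]_n * rat) := ball (map_mx ratr qe.1 : 'rV[R]_n) (ratr qe.2 : R).
pose B k : set 'rV[R]_n :=
  if (unpickle k : option ('rV[rat]_n * rat)) is Some qe then
    (if pselect (good K (b qe)) then b qe else set0)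
  else set0.
have good0 : good K set0.
  split=> // F mF; rewrite subset0 => ->.
  by rewrite image_set0 measure0 integral_set0 mule0; split=> //; exact: measurable0.
have gB k : good K (B k).
  by rewrite /B; case: (unpickle k) => [qe|//]; case: pselect.
have mB k : measurable (B k).
  rewrite /B; case: (unpickle k) => [qe|]; last exact: measurable0.
  case: pselect => ?; [exact: measurable_row_ball|exact: measurable0].
have DB : D `<=` \bigcup_k B k.
  move=> x Dx; have [d d0 [gD gd]] := good_ball K1 Dx.
  have [qe [q0 xqe sqe]] := rational_ball x d0.
  exists (pickle qe) => //; rewrite /B pickleK; case: pselect => //= -[]; split.
    exact: subset_trans gD.
  by move=> F mF Fb; apply: gd => //; exact: subset_trans sqe.
pose S k := E `&` seqDU B k.
have ES : E = \bigcup_k S k.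
  by rewrite -setI_bigcupr -seqDU_bigcup_eq; apply/esym/setIidPl; exact: subset_trans DB.
have mS k : measurable (S k) by apply: measurableI => //; exact: seqDU_measurable.
have SB k : S k `<=` B k by move=> x [_]; exact: subset_seqDU.
have SE k : S k `<=` E by move=> x [].
have tS : trivIset setT S by apply: trivIset_setIl; exact: trivIset_seqDU.
have gS k := (gB k).2 _ (mS k) (SB k).
have mGS k : measurable (G @` S k) by have [] := gS k.
have GE : G @` E = \bigcup_k (G @` S k) by rewrite {1}ES image_bigcup.
have mGE : measurable (G @` E) by rewrite GE; exact: bigcupT_measurable.
have tGS : trivIset setT (fun k => G @` S k).
  apply/trivIsetP => i j _ _ ij; apply/seteqP; split=> // _ [[x Sx <-] [y Sy]].
  move=> /(injG (ED _ (SE _ _ Sy)) (ED _ (SE _ _ Sx))) yx; rewrite yx in Sy.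
  have : (S i `&` S j) x by [].
  by move/trivIsetP: tS => /(_ i j I I ij) ->.
have lGE : lam n (G @` E) = (\sum_(k <oo) lam n (G @` S k))%E.
  by rewrite GE measure_semi_bigcup// -GE.
have iE : (\int[lam n]_(x in E) (J x)%:E = \sum_(k <oo) \int[lam n]_(x in S k) (J x)%:E)%E.
  rewrite {1}ES ge0_integral_bigcup//; first by rewrite -ES.
have K0 : 0 <= K by rewrite (le_trans ler01)// ltW.
split=> //.
- rewrite lGE iE -nneseriesZl//; last by move=> k _; apply: integral_ge0.
  by apply: lee_nneseries => // k _; have [] := gS k.
- rewrite lGE iE -nneseriesZl//.
  by apply: lee_nneseries => [k _ _|k _]; [exact: integral_ge0|have [] := gS k].
Qed.
End change_of_variables.

(** * The transport map in coordinates *)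

Section projective_maps.
Context {R : realType}.

Lemma det_rank1 m (u : 'cV[R]_m) (v : 'rV[R]_m) :
  \det (1%:M + u *m v) = 1 + (v *m u) 0 0.
Proof.
have E : block_mx (1%:M + u *m v) u 0 1%:M *m block_mx 1%:M 0 (- v) 1%:M =
    block_mx 1%:M 0 (- v) (1%:M : 'M[R]_1) *m block_mx 1%:M u 0 (1%:M + v *m u).
  rewrite !mulmx_block !mulmx1 !mul1mx !mulmx0 !mul0mx !mulmxN !mulNmx.
  by rewrite addrK !addr0 !add0r [- _ + _]addrC addrK.
have := congr1 determinant E.
rewrite !det_mulmx !det_ublock !det_lblock !det1 !mulr1 !mul1r => ->.
by rewrite [_ + _]mx11_scalar det_scalar1 !mxE eqxx.
Qed.

Definition lastc m (x : 'rV[R]_m) : R := 1 - \sum_i x 0 i.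

Definition ratio m (x : 'rV[R]_m) : 'rV[R]_m := (lastc x)^-1 *: x.

Definition proj m (u : 'rV[R]_m) : 'rV[R]_m := (1 + \sum_i u 0 i)^-1 *: u.

Definition recip m (a : 'rV[R]_m) : 'rV[R]_m := map_mx GRing.inv a.

Lemma eq_strict_diff1 m (u v : 'rV[R]_m -> R) x0 a b :
  strict_diff1 u x0 a -> u =1 v -> a = b -> strict_diff1 v x0 b.
Proof. by move=> + /funext <- <-. Qed.

Let strict_diff_scaled m (k : 'rV[R]_m -> R) x0 b :
  strict_diff1 k x0 b ->
  strict_diff (fun x => k x *: x) x0 (k x0 *: 1%:M + b *m x0).
Proof.
move=> kb; apply/strict_diffP => j.
have := strict_diff1M kb (strict_diff1_coord j x0).
move=> /eq_strict_diff1; apply => [x|].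
  by rewrite mxE.
apply/colP => i; rewrite !mxE big_ord1 addrC; congr (_ * _ + _).
  by rewrite eqxx andbT.
by rewrite mulrC.
Qed.

Let sumE m (x : 'rV[R]_m) : (x *m (const_mx 1 : 'cV[R]_m)) 0 0 = \sum_i x 0 i :> R.
Proof. by rewrite mxE; apply: eq_bigr => i _; rewrite mxE mulr1. Qed.

Let strict_diff1_total m (x0 : 'rV[R]_m) :
  strict_diff1 (fun x => \sum_i x 0 i) x0 (const_mx 1).
Proof.
have := strict_diff1_sum (fun i : 'I_m => strict_diff1_coord i x0).
rewrite (_ : \sum_(i < m) delta_mx i 0 = const_mx 1 :> 'cV[R]_m)//.
apply/colP => i; rewrite summxE mxE (bigD1 i)//= mxE !eqxx big1 ?addr0// => j ji.
by rewrite mxE [i == j]eq_sym (negbTE ji).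
Qed.

Lemma strict_diff_proj m (u : 'rV[R]_m) : 1 + \sum_i u 0 i != 0 ->
  exists2 A, strict_diff (@proj m) u A & \det A = (1 + \sum_i u 0 i) ^- m.+1.
Proof.
move=> s0; set s := 1 + _ in s0 *.
have d1 : strict_diff1 (fun x : 'rV[R]_m => 1 + \sum_i x 0 i) u (0 + const_mx 1).
  by apply: strict_diff1D; [exact: strict_diff1_cst|exact: strict_diff1_total].
have := strict_diff_scaled (strict_diff1V s0 d1); rewrite add0r -/s => H.
eexists; first exact: H.
have -> : s^-1 *: 1%:M + (- s ^- 2 *: const_mx 1) *m u =
    s^-1 *: (1%:M + (- s^-1 *: (const_mx 1 : 'cV[R]_m)) *m u) .
  by rewrite scalerDr -!scalemxAl scalerA mulrN -expr2 exprVn.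
rewrite detZ det_rank1 -scalemxAr mxE sumE exprS invfM mulrC exprVn.
by congr (_ * _); rewrite -[\sum_i _](addKr 1) -/s; field.
Qed.

Lemma strict_diff_ratio m (x : 'rV[R]_m) : lastc x != 0 ->
  exists2 A, strict_diff (@ratio m) x A & \det A = (lastc x) ^- m.+1.
Proof.
move=> s0; set s := lastc x in s0 *.
have d1 : strict_diff1 (@lastc m) x (0 + (- 1) *: const_mx 1).
  have := strict_diff1D (strict_diff1_cst 1 x)
    (strict_diff1M (strict_diff1_cst (-1) x) (strict_diff1_total x)).
  move=> /eq_strict_diff1; apply => [y|]; first by rewrite /lastc mulN1r.
  by rewrite scaler0 !add0r.
have := strict_diff_scaled (strict_diff1V s0 d1).
rewrite add0r -/s scalerA mulrN1 opprK => H.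
eexists; first exact: H.
have -> : s^-1 *: 1%:M + (s ^- 2 *: const_mx 1) *m x =
    s^-1 *: (1%:M + (s^-1 *: (const_mx 1 : 'cV[R]_m)) *m x) .
  by rewrite scalerDr -!scalemxAl scalerA -expr2 exprVn.
rewrite detZ det_rank1 -scalemxAr mxE sumE exprS invfM mulrC exprVn.
congr (_ * _); have -> : \sum_i x 0 i = 1 - s by rewrite /s /lastc; ring.
by field.
Qed.

Lemma strict_diff_recip m (a : 'rV[R]_m) : (forall i, a 0 i != 0) ->
  exists2 A, strict_diff (@recip m) a A & `|\det A| = \prod_i (a 0 i) ^- 2.
Proof.
move=> a0; exists (diag_mx (\row_i (- (a 0 i) ^- 2))).
  apply/strict_diffP => j.
  have := strict_diff1V (a0 j) (strict_diff1_coord j a).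
  move=> /eq_strict_diff1; apply => [x|].
    by rewrite mxE.
  by apply/colP => i; rewrite !mxE eqxx andbT; case: eqVneq => [->|]; rewrite ?mulr1 ?mulr0.
rewrite det_diag normr_prod; apply: eq_bigr => i _; rewrite mxE normrN.
by rewrite ger0_norm// invr_ge0 sqr_ge0.
Qed.

(* In terms of the ratios w_i = pi_i / r_i of the portfolio map, [dual_last] is the
   last one and [dual] lists the others divided by it. *)
Definition dual_last m (f : 'rV[R]_m -> R) (x : 'rV[R]_m) : R :=
  1 - (x *m gradient f x) 0 0.

Definition dual m (f : 'rV[R]_m -> R) (x : 'rV[R]_m) : 'rV[R]_m :=
  const_mx 1 + (dual_last f x)^-1 *: (gradient f x)^T.

Lemma strict_diff_dual m (f : 'rV[R]_m -> R) (x : 'rV[R]_m) :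
  (forall j, strict_diff1 (partial f j) x (col j (hessian f x))) ->
  dual_last f x != 0 ->
  exists2 A, strict_diff (dual f) x A &
    `|\det A| = `|\det (- hessian f x - gradient f x *m (gradient f x)^T)| *
      `|dual_last f x| ^- m.+1.
Proof.
move=> fH w0; set w := dual_last f x in w0 *.
set H := hessian f x; set g := gradient f x; set L := - H - _.
have dw : strict_diff1 (dual_last f) x (- (g + H *m x^T)).
  have h j := strict_diff1M (strict_diff1_coord j x) (fH j).
  have := strict_diff1D (strict_diff1_cst 1 x)
    (strict_diff1M (strict_diff1_cst (-1) x) (strict_diff1_sum h)).
  move=> /eq_strict_diff1; apply => [y|].
    rewrite /dual_last mulN1r mxE; congr (_ - _).
    by apply: eq_bigr => i _; rewrite !mxE.
  rewrite scaler0 !add0r scaleN1r; congr (- _).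
  apply/colP => i; rewrite summxE !mxE.
  under eq_bigr do rewrite !mxE.
  rewrite big_split/=; congr (_ + _).
    rewrite (bigD1 i)//= !eqxx mulr1 big1 ?addr0// => j ji.
    by rewrite [i == j]eq_sym (negbTE ji) mulr0.
  by apply: eq_bigr => j _; rewrite !mxE mulrC.
exists (w^-1 *: H + w ^- 2 *: ((g + H *m x^T) *m g^T)).
  apply/strict_diffP => j.
  have := strict_diff1D (strict_diff1_cst 1 x) (strict_diff1M (strict_diff1V w0 dw) (fH j)).
  move=> /eq_strict_diff1; apply => [y|].
    by rewrite !mxE.
  apply/colP => i; rewrite !mxE !add0r big_ord1 !mxE -/w addrC; congr (_ + _).
  by ring.
have -> : w^-1 *: H + w ^- 2 *: ((g + H *m x^T) *m g^T) =
    (- w ^- 2) *: (L *m (w *: (1%:M + (w^-1 *: x^T) *m g^T))).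
  have gx : g^T *m x^T = (1 - w)%:M.
    by rewrite -trmx_mul [x *m g]mx11_scalar tr_scalar_mx /w /dual_last opprB addrC subrK.
  clearbody w.
  have -> : L *m (w *: (1%:M + (w^-1 *: x^T) *m g^T)) =
      - (w *: H) - H *m x^T *m g^T - g *m g^T.
    rewrite scalerDr -scalemxAl scalerA mulfV// scale1r mulmxDr -scalemxAr mulmx1.
    rewrite /L mulmxA !mulmxBl !mulNmx -[g *m g^T *m x^T]mulmxA gx.
    rewrite mul_mx_scalar -scalemxAl.
    move: (g *m g^T) (H *m x^T *m g^T) => GG Q.
    by apply/matrixP => i j; rewrite !mxE; ring.
  rewrite mulmxDl; move: (g *m g^T) (H *m x^T *m g^T) => GG Q.
  apply/matrixP => i j; rewrite !mxE; field.
  exact: w0.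
have gx : (g^T *m x^T) 0 0 = 1 - w.
  by rewrite -trmx_mul mxE /w /dual_last opprB addrC subrK.
rewrite detZ det_mulmx detZ det_rank1 -scalemxAr mxE gx !normrM !normrX normrN.
rewrite normrV ?unitfE ?expf_neq0// normrX.
have -> : 1 + w^-1 * (1 - w) = w^-1 by field.
rewrite normrV ?unitfE// mulrCA; congr (_ * _).
have nw : `|w| != 0 by rewrite normr_eq0.
rewrite mulrA -exprMn; have -> : `|w| ^- 2 * `|w| = `|w|^-1 by field.
by rewrite exprVn -invfM mulrC -exprS.
Qed.

End projective_maps.

Section convexity.
Context {R : realType}.

Lemma strict_diff1_derive m (u : 'rV[R]_m -> R) x0 a v : strict_diff1 u x0 a ->
  is_derive x0 v u ((v *m a) 0 0).
Proof.
move=> ua.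
suff H : (fun h : R => h^-1 *: ((u \o shift x0) (h *: v) - u x0)) @ (0 : R)^' --> (v *m a) 0 0.
  by apply: DeriveDef; [apply/cvg_ex; eexists; exact: H|exact: cvg_lim H].
apply/cvgrPdist_le => e e0.
pose e1 := e / (`|v| + 1).
have v1 : 0 < `|v| + 1 by rewrite ltr_wpDl.
have e10 : 0 < e1 by rewrite divr_gt0.
have [d [d0 H]] : exists d : R, 0 < d /\ forall x y, ball x0 d x -> ball x0 d y ->
    `|u x - u y - ((x - y) *m a) 0 0| <= e1 * `|x - y|.
  near (0 : R)^'+ => d; exists d; split; first by near: d; exact: nbhs_right_gt.
  by near: d; exact: ua.
near=> h.
have h0 : h != 0 by near: h; exact: nbhs_dnbhs_neq.
have hd : `|h| < d / (`|v| + 1).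
  near: h; apply: dnbhs0_lt; by rewrite divr_gt0.
have hv : ball x0 d (h *: v + x0).
  rewrite row_ballE opprD addrCA subrr addr0 normrN normrZ.
  move: hd; rewrite ltr_pdivlMr// mulrDr mulr1; apply: le_lt_trans.
  by rewrite lerDl.
have := H _ _ hv (ballxx _ d0); rewrite addrK -scalemxAl mxE normrZ => H1.
rewrite distrC /= -[X in `|_ - X|](mulKf h0) -mulrBr normrM normfV.
rewrite ler_pdivrMl ?normr_gt0//; apply: le_trans H1 _.
rewrite mulrCA ler_wpM2l// /e1 mulrAC -mulrA ler_piMr ?(ltW e0)//.
by rewrite ler_pdivrMr// mul1r lerDl.
Unshelve. all: by end_near. Qed.

Lemma coord_domain_open m : open (@coord_domain R m).
Proof.
have cl (x : 'rV[R]_m) : {for x, continuous (fun y : 'rV[R]_m => \sum_i y 0 i)}.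
  by apply: (strict_diff1_continuous (strict_diff1_sum (fun i : 'I_m => strict_diff1_coord i x))).
rewrite openE => x [x0 x1]; apply: filterI.
  have := @filter_forall _ 'I_m (fun i => [set y : 'rV[R]_m | 0 < y 0 i]) (nbhs x) _; apply.
  move=> i; have := @cvgr_gt R _ _ (nbhs_filter x) _ _ (@coord_continuous R 1 m 0 i x) 0.
  by apply; exact: x0.
by have := @cvgr_lt R _ _ (nbhs_filter x) _ _ (cl x) 1; apply.
Qed.

Lemma coord_domain_convex m (x y : 'rV[R]_m) (s : R) : 0 <= s <= 1 ->
  coord_domain x -> coord_domain y -> coord_domain (x + s *: (y - x)).
Proof.
move=> /andP[s0 s1] [x0 x1] [y0 y1].
have [->|sN1] := eqVneq s 1; first by rewrite scale1r subrKC.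
have {}s1 : 0 < 1 - s by rewrite subr_gt0 lt_neqAle sN1.
split=> [i|].
  rewrite !mxE; have -> : x 0 i + s * (y 0 i - x 0 i) = (1 - s) * x 0 i + s * y 0 i by ring.
  by rewrite ltr_pwDl ?mulr_gt0// mulr_ge0// ltW.
have -> : \sum_i (x + s *: (y - x)) 0 i = (1 - s) * \sum_i x 0 i + s * \sum_i y 0 i.
  by rewrite !mulr_sumr -big_split/=; apply: eq_bigr => i _; rewrite !mxE; ring.
have := mulr_gt0 s1 (_ : 0 < 1 - \sum_i x 0 i); rewrite subr_gt0 => /(_ x1).
have := mulr_ge0 s0 (_ : 0 <= 1 - \sum_i y 0 i); rewrite subr_ge0 => /(_ (ltW y1)).
by lra.
Qed.

Definition curvature m (f : 'rV[R]_m -> R) (x : 'rV[R]_m) : 'M[R]_m :=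
  - hessian f x - gradient f x *m (gradient f x)^T.

Lemma curvatureE m (f : 'rV[R]_m -> R) x (v : 'rV[R]_m) :
  (v *m curvature f x *m v^T) 0 0 =
  - (v *m (hessian f x *m v^T)) 0 0 - (v *m gradient f x) 0 0 ^+ 2.
Proof.
have tr : (gradient f x)^T *m v^T = (v *m gradient f x)^T by rewrite trmx_mul.
rewrite /curvature mulmxBr mulmxBl mulmxN mulNmx -!mulmxA tr.
rewrite [v *m (gradient f x *m _)]mulmxA.
by move: (v *m (hessian f x *m _)) (v *m gradient f x) => a b; rewrite !mxE big_ord1 !mxE.
Qed.

Variables (m : nat) (f : 'rV[R]_m -> R).
Local Notation D := (@coord_domain R m).
Hypothesis fC2 : C2_on D f.

Lemma C2_strict_diff1 x : D x -> strict_diff1 f x (gradient f x).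
Proof.
move=> Dx; apply: C1_strict_diff1 => [|i]; last by have [] := fC2 Dx i.
apply: filterS (open_nbhs_nbhs (conj (@coord_domain_open m) Dx)) => y Dy i.
by have [] := fC2 Dy i.
Qed.

Lemma C2_strict_diff1_partial x j : D x ->
  strict_diff1 (partial f j) x (col j (hessian f x)).
Proof.
move=> Dx.
have -> : col j (hessian f x) = gradient (partial f j) x.
  by apply/colP => i; rewrite !mxE.
apply: C1_strict_diff1 => [|i]; last by have [_ _ /(_ i)[]] := fC2 Dx j.
apply: filterS (open_nbhs_nbhs (conj (@coord_domain_open m) Dx)) => y Dy i.
by have [_ _ /(_ i)[]] := fC2 Dy j.
Qed.

Lemma C2_strict_diff1_slope x (v : 'rV[R]_m) : D x -> strict_diff1 (fun y => (v *m gradient f y) 0 0) x (hessian f x *m v^T).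
Proof.
move=> Dx.
have := strict_diff1_sum (fun j => strict_diff1M (strict_diff1_cst (v 0 j) x) (C2_strict_diff1_partial j Dx)).
move=> /eq_strict_diff1; apply => [y|].
  by rewrite mxE; apply: eq_bigr => j _; rewrite mxE.
apply/colP => i; rewrite summxE mxE; apply: eq_bigr => j _.
by rewrite !mxE mulr0 add0r mulrC.
Qed.

Hypothesis fpos : forall (x v : 'rV[R]_m), D x -> v != 0 -> 0 < (v *m curvature f x *m v^T) 0 0.

Lemma expR_strictly_concave x y : D x -> D y -> x != y ->
  expR (f y - f x) < 1 + ((y - x) *m gradient f x) 0 0.
Proof.
move=> Dx Dy xy; set v := y - x.
have v0 : v != 0 by rewrite subr_eq0 eq_sym.
pose p (s : R) := x + s *: v.
have Dp (s : R) : 0 <= s <= 1 -> D (p s) by move=> s01; exact: coord_domain_convex.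
pose h (s : R) : R := f (p s); pose h1 (s : R) : R := (v *m gradient f (p s)) 0 0.
pose h2 (s : R) : R := (v *m (hessian f (p s) *m v^T)) 0 0.
have dh (s : R) : 0 <= s <= 1 -> is_derive s (1 : R) h (h1 s).
  move=> /Dp Dps; have [d1 d2] := strict_diff1_derive v (C2_strict_diff1 Dps).
  by rewrite /h1 -d2; exact: is_derive_line.
have dh1 (s : R) : 0 <= s <= 1 -> is_derive s (1 : R) h1 (h2 s).
  move=> /Dp Dps; have [d1 d2] := strict_diff1_derive v (C2_strict_diff1_slope v Dps).
  by rewrite /h2 -d2; exact: (is_derive_line d1).
pose P (s : R) : R := expR (h s).
have dP (s : R) : 0 <= s <= 1 -> is_derive s (1 : R) P (P s * h1 s).
  by move=> s01; apply: is_derive1_comp; exact: dh.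
have dP1 (s : R) : 0 <= s <= 1 -> is_derive s (1 : R) (P * h1) (P s * (h2 s + h1 s ^+ 2)).
  move=> s01; have := is_deriveM (dP _ s01) (dh1 _ s01).
  by move=> /is_derive_eq; apply; rewrite -[_ *: _]/(_ * _) -[X in _ + X]/(_ * _); ring.
have neg (s : R) : 0 <= s <= 1 -> P s * (h2 s + h1 s ^+ 2) < 0.
  move=> s01; rewrite pmulr_rlt0 ?expR_gt0//.
  by have := fpos (Dp _ s01) v0; rewrite curvatureE -/(h2 s) -/(h1 s); lra.
have [c /andP[c0 c1] Pc] := MVT01 dP.
have dc (s : R) : s \in `]0, c[ -> is_derive s (1 : R) (P * h1) (P s * (h2 s + h1 s ^+ 2)).
  by rewrite in_itv/= => /andP[s0 sc]; apply: dP1; rewrite !ltW//; exact: lt_trans c1.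
have [|c' ] := MVT c0 dc.
  apply: derivable_within_continuous => s; rewrite in_itv/= => /andP[s0 sc].
  by have [] := dP1 s; rewrite // s0 (le_trans sc)// ltW.
rewrite in_itv/= => /andP[c'0 c'c].
have : P c' * (h2 c' + h1 c' ^+ 2) < 0.
  by apply: neg; rewrite (ltW c'0)/= ltW//; exact: lt_trans c1.
move=> n1 E.
have : P c * h1 c < P 0 * h1 0.
  rewrite -subr_lt0 -[X in X < _]/((P * h1) c - (P * h1) 0) E subr0.
  by rewrite nmulr_rlt0.
rewrite -Pc /P /h1 /h /p scale1r scale0r addr0 subrKC => lt1.
have ex0 := expR_gt0 (f x).
rewrite expRD expRN ltr_pdivrMr//.
by move: lt1; rewrite ltrBlDr mulrDl mul1r addrC mulrC.
Qed.

(* [>= 0] is the tangent-line bound on exp f; strictness comes from comparing the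
   tangents at [x] and at the midpoint of [x] and the vertex [e]. *)
Lemma vertex_slope_gt0 x e : D x -> e != x ->
  (forall s : R, 0 <= s < 1 -> D (x + s *: (e - x))) ->
  0 < 1 + ((e - x) *m gradient f x) 0 0.
Proof.
move=> Dx ex De; pose z := x + 2^-1 *: (e - x).
have h01 : 0 <= (2^-1 : R) < 1 by rewrite invr_ge0 ler0n invf_lt1// ltr1n.
have Dz : D z by exact: De.
have v0 : e - x != 0 by rewrite subr_eq0.
have zx : z != x.
  by rewrite -subr_eq0 addrAC subrr add0r scaler_eq0 negb_or v0 invr_eq0 pnatr_eq0.
set a := ((e - x) *m gradient f x) 0 0.
pose b := ((e - x) *m gradient f z) 0 0.
have H1 : expR (f z - f x) < 1 + 2^-1 * a.
  have := expR_strictly_concave Dx Dz; rewrite eq_sym => /(_ zx).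
  by rewrite {2}/z addrAC subrr add0r -scalemxAl mxE.
have H2 : expR (f x - f z) < 1 - 2^-1 * b.
  have := expR_strictly_concave Dz Dx zx.
  by rewrite {2}/z opprD addrA subrr add0r -scaleNr -scalemxAl mxE mulNr.
have H3 (s : R) : 0 < s < 1 -> 0 < 1 + s / 2 * b.
  move=> /andP[s0 s1]; pose y := z + (s / 2) *: (e - x).
  have Dy : D y.
    rewrite /y /z -addrA -scalerDl; apply: De; apply/andP; split; lra.
  have yz : y != z.
    by rewrite -subr_eq0 addrAC subrr add0r scaler_eq0 negb_or v0 mulf_neq0 ?gt_eqF// invr_gt0.
  have := expR_strictly_concave Dz Dy; rewrite eq_sym => /(_ yz).
  rewrite {2}/y addrAC subrr add0r -scalemxAl mxE; apply: lt_trans.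
  exact: expR_gt0.
have H4 : 0 <= 1 + b / 2.
  rewrite leNgt; apply/negP => b2.
  have b0 : b < - 2 by lra.
  have bN0 : b != 0 by rewrite lt_eqF//; lra.
  have s01 : 0 < 2 / - b < 1.
    by rewrite ltr_pdivrMr ?divr_gt0//=; lra.
  have := H3 _ s01; have -> : 2 / - b / 2 * b = - 1 by field.
  by rewrite subrr ltxx.
have H5 : 1 < (1 + 2^-1 * a) * (1 - 2^-1 * b).
  have {1}-> : 1 = expR (f z - f x) * expR (f x - f z).
    by rewrite -expRD addrA subrK subrr expR0.
  exact: (ltr_pM (expR_ge0 _) (expR_ge0 _) H1 H2).
have a0 : 0 <= 1 + 2^-1 * a := le_trans (expR_ge0 _) (ltW H1).
have := mulr_ge0 a0 H4; move: H5; nra.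
Qed.

Lemma dual_last_gt0 x : D x -> (0 < m)%N -> 0 < dual_last f x.
Proof.
move=> Dx m0; have := @vertex_slope_gt0 x 0 Dx.
rewrite sub0r mulNmx mxE; apply.
  apply/eqP => xE; move: Dx; rewrite -xE => -[+ _].
  by move=> /(_ (Ordinal m0)); rewrite mxE ltxx.
move=> s /andP[s0 s1]; move: Dx => [x0 x1]; split=> [i|].
  by rewrite !mxE; have := x0 i; nra.
have -> : \sum_i (x + s *: - x) 0 i = (1 - s) * \sum_i x 0 i.
  by rewrite mulr_sumr; apply: eq_bigr => i _; rewrite !mxE; ring.
have : 0 <= \sum_i x 0 i by apply: sumr_ge0 => i _; exact: ltW.
nra.
Qed.

Lemma dual_slope_gt0 x i : D x -> 0 < dual_last f x + gradient f x i 0.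
Proof.
move=> Dx; have := @vertex_slope_gt0 x (delta_mx 0 i) Dx.
rewrite mulmxBl mxE -rowE [X in 1 + (_ + X)]mxE mxE => H.
rewrite /dual_last addrAC -addrA; apply: H.
  apply/eqP => xE; move: Dx; rewrite -xE => -[_].
  by rewrite (bigD1 i)//= mxE !eqxx big1 ?addr0 ?ltxx// => j ji; rewrite mxE (negbTE ji) andbF.
move=> s /andP[s0 s1]; move: Dx => [x0 x1]; split=> [j|].
  rewrite !mxE eqxx/=; have := x0 j; have : 0 <= (j == i)%:R :> R by rewrite ler0n.
  by nra.
have -> : \sum_j (x + s *: (delta_mx 0 i - x)) 0 j = (1 - s) * \sum_j x 0 j + s.
  have dE : \sum_j (delta_mx 0 i : 'rV[R]_m) 0 j = 1.
    by rewrite (bigD1 i)//= mxE !eqxx big1 ?addr0// => j ji; rewrite mxE (negbTE ji) andbF.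
  rewrite -[X in _ = _ + X]mulr1 -[X in _ = _ + _ * X]dE !mulr_sumr -big_split/=.
  by apply: eq_bigr => j _; rewrite !mxE; ring.
nra.
Qed.

Lemma dual_gt0 x i : D x -> 0 < dual f x 0 i.
Proof.
move=> Dx; have w0 := dual_last_gt0 Dx (leq_ltn_trans (leq0n i) (ltn_ord i)).
rewrite !mxE -[X in X + _](mulVf (lt0r_neq0 w0)) -mulrDr mulr_gt0// ?invr_gt0//.
by have := dual_slope_gt0 i Dx; rewrite [X in _ + X]mxE.
Qed.

Lemma dual_inj x y : (0 < m)%N -> D x -> D y -> dual f x = dual f y -> x = y.
Proof.
move=> m0 Dx Dy /addrI E; apply/eqP; apply: contraT => xy.
have wx := dual_last_gt0 Dx m0; have wy := dual_last_gt0 Dy m0.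
have H u v : D u -> D v -> u != v ->
    (dual_last f u)^-1 *: (gradient f u)^T = (dual_last f v)^-1 *: (gradient f v)^T ->
    expR (f v - f u) < dual_last f u / dual_last f v.
  move=> Du Dv uv Euv.
  have wu := dual_last_gt0 Du m0; have wv := dual_last_gt0 Dv m0.
  have gE : gradient f u = (dual_last f u / dual_last f v) *: gradient f v.
    apply: trmx_inj; rewrite linearZ/= -scalerA -Euv scalerA mulfV ?scale1r//.
    by rewrite gt_eqF.
  have := expR_strictly_concave Du Dv uv; rewrite mulmxBl mxE [X in _ + (_ + X)]mxE.
  rewrite addrCA -/(dual_last f u) {1}gE -scalemxAr mxE.
  have -> : (v *m gradient f v) 0 0 = 1 - dual_last f v by rewrite /dual_last; ring.
  congr (_ < _); field; exact: lt0r_neq0.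
have h1 := H _ _ Dx Dy xy E; have := H _ _ Dy Dx; rewrite eq_sym => /(_ xy (esym E)) h2.
have : 1 < (dual_last f x / dual_last f y) * (dual_last f y / dual_last f x).
  have {1}-> : 1 = expR (f y - f x) * expR (f x - f y).
    by rewrite -expRD addrA subrK subrr expR0.
  exact: (ltr_pM (expR_ge0 _) (expR_ge0 _) h1 h2).
by rewrite mulrA divfK ?gt_eqF// mulfV ?gt_eqF// ltxx.
Qed.

End convexity.

Section transport_coord.
Context {R : realType}.

Lemma posdef_det_gt0 m (M : 'M[R]_m) :
  (forall v : 'rV[R]_m, v != 0 -> 0 < (v *m M *m v^T) 0 0) -> 0 < \det M.
Proof.
elim: m => [|m IH] in M *; first by rewrite det_mx00.
rewrite -[m.+1]/(1 + m)%N in M * => Mpos.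
pose a := M 0 0; pose b := ursubmx M; pose c := dlsubmx M.
pose S := drsubmx M - c *m (a^-1 *: b).
have ME : M = block_mx a%:M b c (drsubmx M).
  rewrite -[LHS]submxK; congr block_mx; apply/matrixP => i j.
  by rewrite !ord1 !mxE eqxx mulr1n; congr (M _ _); exact/val_inj.
have a0 : 0 < a.
  have := Mpos (row_mx 1%:M 0).
  rewrite ME tr_row_mx mul_row_block mul_row_col !mul1mx !mul0mx trmx0 mulmx0 !addr0.
  rewrite trmx1 mulmx1 mxE eqxx mulr1n; apply.
  by rewrite -row_mx0; apply/eqP => /eq_row_mx[/matrixP/(_ 0 0) + _];
    rewrite !mxE eqxx => /eqP; rewrite oner_eq0.
have aN0 : a != 0 by rewrite gt_eqF.
have BE : M = block_mx a%:M 0 c S *m block_mx 1%:M (a^-1 *: b) 0 1%:M.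
  rewrite mulmx_block !mulmx0 !mulmx1 !addr0 mul_scalar_mx scalerA mulfV// scale1r.
  by rewrite /S subrKC -ME.
rewrite BE det_mulmx det_lblock det_ublock !det1 det_scalar1 !mulr1 mulr_gt0//.
apply: IH => w w0.
have := Mpos (row_mx (- a^-1 *: (w *m c)) w).
rewrite {1}ME mul_row_block mul_mx_scalar scalerA mulrN mulfV// scaleN1r addNr.
rewrite tr_row_mx mul_row_col mul0mx add0r -scalemxAl -mulmxA addrC.
rewrite /S mulmxBr -!scalemxAr !scaleNr; apply.
by rewrite -row_mx0; apply/eqP => /eq_row_mx[_] /eqP; apply/negP.
Qed.

Lemma prod_ord_last m (F : 'I_m.+1 -> R) :
  \prod_i F i = (\prod_(j < m) F (lift ord_max j)) * F ord_max.
Proof.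
rewrite big_ord_recr/=; congr (_ * _); apply: eq_bigr => j _; congr F.
by apply/val_inj; rewrite /= /bump leqNgt ltn_ord.
Qed.

Lemma sum_ord_last m (F : 'I_m.+1 -> R) :
  \sum_i F i = (\sum_(j < m) F (lift ord_max j)) + F ord_max.
Proof.
rewrite big_ord_recr/=; congr (_ + _); apply: eq_bigr => j _; congr F.
by apply/val_inj; rewrite /= /bump leqNgt ltn_ord.
Qed.

Lemma chart_lift m (x : 'rV[R]_m) j : chart x 0 (lift ord_max j) = x 0 j.
Proof. by rewrite mxE liftK. Qed.

Lemma chart_max m (x : 'rV[R]_m) : chart x 0 ord_max = lastc x.
Proof. by rewrite mxE unlift_none. Qed.

Lemma prod_chart m (x : 'rV[R]_m) :
  \prod_i chart x 0 i = (\prod_i x 0 i) * lastc x.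
Proof.
rewrite prod_ord_last chart_max; congr (_ * _).
by apply: eq_bigr => j _; rewrite chart_lift.
Qed.

Definition orthant m : set 'rV[R]_m := [set u | forall i, 0 < u 0 i].

Lemma orthant_total m (u : 'rV[R]_m) : orthant u -> 0 < 1 + \sum_i u 0 i.
Proof. by move=> u0; rewrite ltr_pwDl// sumr_ge0// => i _; exact/ltW/u0. Qed.

Lemma lastc_gt0 m (x : 'rV[R]_m) : coord_domain x -> 0 < lastc x.
Proof. by move=> [_ x1]; rewrite subr_gt0. Qed.

Lemma lastc_proj m (u : 'rV[R]_m) : orthant u ->
  lastc (proj u) = (1 + \sum_i u 0 i)^-1.
Proof.
move=> /orthant_total; set s := 1 + _ => s0; rewrite /lastc.
have -> : \sum_i proj u 0 i = s^-1 * \sum_i u 0 i.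
  by rewrite mulr_sumr; apply: eq_bigr => i _; rewrite mxE.
have -> : \sum_i u 0 i = s - 1 by rewrite /s; ring.
by field; rewrite gt_eqF.
Qed.

Lemma proj_domain m (u : 'rV[R]_m) : orthant u -> coord_domain (proj u).
Proof.
move=> u0; have s0 := orthant_total u0; split=> [i|].
  by rewrite mxE mulr_gt0// invr_gt0.
by rewrite -subr_gt0 -/(lastc _) lastc_proj// invr_gt0.
Qed.

Lemma ratio_gt0 m (x : 'rV[R]_m) : coord_domain x -> orthant (ratio x).
Proof.
by move=> Dx i; rewrite mxE mulr_gt0 ?invr_gt0 ?lastc_gt0//; case: Dx.
Qed.

Lemma projK m (u : 'rV[R]_m) : orthant u -> ratio (proj u) = u.
Proof.
move=> u0; rewrite /ratio lastc_proj// invrK scalerA mulfV ?scale1r//.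
by rewrite gt_eqF// orthant_total.
Qed.

Lemma ratioK m (x : 'rV[R]_m) : coord_domain x -> proj (ratio x) = x.
Proof.
move=> Dx; have l0 := lt0r_neq0 (lastc_gt0 Dx); rewrite /proj /ratio scalerA.
suff -> : (1 + \sum_i ((lastc x)^-1 *: x) 0 i)^-1 * (lastc x)^-1 = 1 by rewrite scale1r.
have -> : \sum_i ((lastc x)^-1 *: x) 0 i = (lastc x)^-1 * \sum_i x 0 i.
  by rewrite mulr_sumr; apply: eq_bigr => i _; rewrite mxE.
have -> : \sum_i x 0 i = 1 - lastc x by rewrite /lastc; ring.
by field; rewrite l0/= subrKC oner_neq0.
Qed.

Lemma recipK m : involutive (@recip R m).
Proof. by move=> a; apply/rowP => i; rewrite !mxE invrK. Qed.

Lemma recip_gt0 m (a : 'rV[R]_m) : orthant a -> orthant (recip a).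
Proof. by move=> a0 i; rewrite mxE invr_gt0. Qed.

Definition inv_coord m (x : 'rV[R]_m) := proj (recip (ratio x)).

Definition transport_coord m (f : 'rV[R]_m -> R) (x : 'rV[R]_m) :=
  proj (dual f (inv_coord x)).

Lemma inv_coord_domain m (x : 'rV[R]_m) : coord_domain x -> coord_domain (inv_coord x).
Proof. by move=> /ratio_gt0/recip_gt0/proj_domain. Qed.

Lemma inv_coordK m (x : 'rV[R]_m) : coord_domain x -> inv_coord (inv_coord x) = x.
Proof.
move=> Dx; rewrite /inv_coord projK ?recipK ?ratioK//.
exact/recip_gt0/ratio_gt0.
Qed.

Variables (m : nat) (f : 'rV[R]_m -> R).
Hypothesis m_gt0 : (0 < m)%N.
Local Notation D := (@coord_domain R m).
Hypothesis fC2 : C2_on D f.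
Hypothesis fpos : forall (x v : 'rV[R]_m), D x -> v != 0 -> 0 < (v *m curvature f x *m v^T) 0 0.

Definition weight (y : 'rV[R]_m) (i : 'I_m.+1) : R :=
  dual_last f y + (if unlift ord_max i is Some j then gradient f y j 0 else 0).

Lemma prod_weight y : D y ->
  \prod_i weight y i = (\prod_i dual f y 0 i) * dual_last f y ^+ m.+1.
Proof.
move=> Dy; have w0 := lt0r_neq0 (dual_last_gt0 fC2 fpos Dy m_gt0).
rewrite prod_ord_last {2}/weight unlift_none addr0 exprS.
rewrite mulrA [RHS]mulrAC; congr (_ * _).
rewrite -[X in _ ^+ X](card_ord m) -prodr_const -big_split/=; apply: eq_bigr => j _.
rewrite /weight liftK !mxE mulrDl mul1r mulrAC mulVf// mul1r.
by [].
Qed.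

Lemma transport_coord_domain x : D x -> D (transport_coord f x).
Proof.
move=> /inv_coord_domain Dy; apply: proj_domain => i.
exact: (dual_gt0 fC2 fpos).
Qed.

Lemma transport_coord_inj x y : D x -> D y ->
  transport_coord f x = transport_coord f y -> x = y.
Proof.
move=> Dx Dy; have Ix := inv_coord_domain Dx; have Iy := inv_coord_domain Dy.
move=> /(congr1 (@ratio R m)).
rewrite !projK; try by move=> i; exact: (dual_gt0 fC2 fpos).
move=> /(dual_inj fC2 fpos m_gt0 Ix Iy) /(congr1 (@inv_coord m)).
by rewrite !inv_coordK.
Qed.

Lemma transport_coord_jacobian x : D x -> let y := inv_coord x in
  exists A, [/\ strict_diff (transport_coord f) x A, \det A != 0 &
   (\prod_i chart (transport_coord f x) 0 i)^-1 * `|\det A| =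
   (\prod_i chart x 0 i)^-1 *
     (\det (curvature f y) * (\prod_i chart y 0 i) ^+ 2 /
      \prod_i (chart y 0 i * weight y i))].
Proof.
move=> Dx y; have Dy : D y by exact: inv_coord_domain.
have l0 := lastc_gt0 Dx; have a0 := ratio_gt0 Dx; have b0 := recip_gt0 a0.
have s0 := orthant_total b0.
have w0 := dual_last_gt0 fC2 fpos Dy m_gt0.
have u0 : orthant (dual f y) by move=> i; exact: (dual_gt0 fC2 fpos).
have t0 := orthant_total u0.
have [A1 dA1 eA1] := strict_diff_ratio (lt0r_neq0 l0).
have [A2 dA2 eA2] := strict_diff_recip (fun i => lt0r_neq0 (a0 i)).
have [A3 dA3 eA3] := strict_diff_proj (lt0r_neq0 s0).
have [A4 dA4 eA4] := strict_diff_dual (fun j => C2_strict_diff1_partial fC2 j Dy) (lt0r_neq0 w0).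
have [A5 dA5 eA5] := strict_diff_proj (lt0r_neq0 t0).
have L0 : 0 < \det (curvature f y) by apply: posdef_det_gt0 => v; exact: fpos.
exists (A1 *m A2 *m A3 *m A4 *m A5).
have E : `|\det (A1 *m A2 *m A3 *m A4 *m A5)| =
  lastc x ^- m.+1 * \prod_i (ratio x 0 i) ^- 2 * (1 + \sum_i recip (ratio x) 0 i) ^- m.+1 *
  (\det (curvature f y) * dual_last f y ^- m.+1) * (1 + \sum_i dual f y 0 i) ^- m.+1.
  rewrite !det_mulmx !normrM eA1 eA2 eA3 eA5 eA4 -/(curvature f y).
  have pn (z : R) : 0 < z -> `|z ^- m.+1| = z ^- m.+1.
    by move=> z0; rewrite ger0_norm// invr_ge0 exprn_ge0// ltW.
  by rewrite !pn// (gtr0_norm L0) (gtr0_norm w0).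
have E0 : 0 < \prod_i (ratio x 0 i) by apply: prodr_gt0 => i _; exact: a0.
have U0 : 0 < \prod_i (dual f y 0 i) by apply: prodr_gt0 => i _; exact: u0.
have AE : \prod_i (ratio x 0 i) ^- 2 = (\prod_i (ratio x 0 i)) ^- 2.
  by rewrite prodfV prodrXl.
have np (z : R) : 0 < z -> z ^+ m.+1 != 0 by move=> z0; rewrite expf_neq0// gt_eqF.
split.
- do 4 (apply: strict_diff_comp; last by []).
  by [].
- by rewrite -normr_eq0 E AE !mulf_neq0// ?invr_eq0 ?np// ?expf_neq0// gt_eqF.
rewrite E AE big_split/= prod_weight// !prod_chart.
rewrite [lastc (transport_coord f x)]lastc_proj// [lastc y]lastc_proj//.
have PE (u : 'rV[R]_m) : \prod_i proj u 0 i = (1 + \sum_i u 0 i)^-1 ^+ m * \prod_i u 0 i.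
  rewrite -[X in _ ^+ X](card_ord m) -prodr_const -big_split/=; apply: eq_bigr => i _.
  by rewrite mxE.
have RE : \prod_i recip (ratio x) 0 i = (\prod_i ratio x 0 i)^-1.
  by rewrite -prodfV; apply: eq_bigr => i _; rewrite mxE.
have XE : \prod_i x 0 i = lastc x ^+ m * \prod_i ratio x 0 i.
  rewrite -[X in _ ^+ X](card_ord m) -prodr_const -big_split/=; apply: eq_bigr => i _.
  by rewrite mxE mulVKf// gt_eqF.
rewrite !PE RE XE !exprVn !exprS.
have pm (z : R) : 0 < z -> z ^+ m != 0 by move=> z0; rewrite expf_neq0// gt_eqF.
move: (pm _ l0) (pm _ s0) (pm _ t0) (pm _ w0).
move: (lt0r_neq0 l0) (lt0r_neq0 s0) (lt0r_neq0 t0) (lt0r_neq0 w0).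
move: (lt0r_neq0 E0) (lt0r_neq0 U0).
move: (_ ^+ m) (_ ^+ m) (_ ^+ m) (_ ^+ m) => X1 X2 X3 X4.
move=> h1 h2 h3 h4 h5 h6 h7 h8 h9 h10; field.
by rewrite -/y h1 h2 h3 h4 h5 h6 h7 h8 h9 h10.
Qed.

End transport_coord.

(** * Interpolation of the potentials *)

Section barycentric_potential.
Context {R : realType}.

Lemma ln_lip (p q s e : R) : 0 < p -> 0 < q ->
  `|s^-1 - p^-1| <= e -> `|s^-1 - q^-1| <= e ->
  `|ln p - ln q - (p - q) / s| <= e * `|p - q|.
Proof.
move=> p0 q0 pe qe.
have ub (a b : R) : 0 < a -> 0 < b -> ln a - ln b <= (a - b) / b.
  move=> a0 b0; rewrite -ln_div ?posrE//.
  have := @le_ln1Dx R (a / b - 1); rewrite subrKC => H.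
  rewrite mulrBl divff ?gt_eqF//; apply: H.
  by rewrite ltrBrDl subrr divr_gt0.
have h1 := ub _ _ p0 q0; have h2 := ub _ _ q0 p0.
have H (z : R) : `|s^-1 - z| <= e -> `|(p - q) * z - (p - q) / s| <= e * `|p - q|.
  by move=> ze; rewrite -mulrBr normrM mulrC distrC ler_wpM2r.
have := H _ pe; have := H _ qe; rewrite !ler_norml => /andP[a1 a2] /andP[b1 b2].
have h3 : (p - q) / p <= ln p - ln q by move: h2; rewrite -[q - p]opprB mulNr; lra.
by apply/andP; split; lra.
Qed.

Lemma strict_diff1_ln m (u : 'rV[R]_m -> R) x0 a : 0 < u x0 ->
  strict_diff1 u x0 a -> strict_diff1 (fun x => ln (u x)) x0 ((u x0)^-1 *: a).
Proof.
move=> u0 ua e e0.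
have [C C0 uC] := strict_diff1_lip ua.
pose S := (u x0)^-1; have S0 : 0 < S by rewrite invr_gt0.
pose e1 := e / (C + S); have CS : 0 < C + S by rewrite addr_gt0.
have e10 : 0 < e1 by rewrite divr_gt0.
near=> d => x y xd yd.
have H1 : forall x y, ball x0 d x -> ball x0 d y ->
    `|u x - u y - ((x - y) *m a) 0 0| <= e1 * `|x - y| by near: d; exact: ua.
have L1 : forall x y, ball x0 d x -> ball x0 d y -> `|u x - u y| <= C * `|x - y| by near: d.
have N1 : forall x, ball x0 d x -> `|S - (u x)^-1| < e1.
  near: d; apply: (@near_near_ball _ _ [set x | `|S - (u x)^-1| < e1]).
  have := strict_diff1_continuous ua => /(cvgV (lt0r_neq0 u0)).
  by move=> /cvgrPdist_lt/(_ _ e10).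
have N0 : forall x, ball x0 d x -> 0 < u x.
  near: d; apply: (@near_near_ball _ _ [set x | 0 < u x]).
  by have := @cvgr_gt R _ _ (nbhs_filter x0) _ _ (strict_diff1_continuous ua) 0; apply.
rewrite -scalemxAr [X in _ - X]mxE -/S.
set la := ((x - y) *m a) 0 0.
have -> : ln (u x) - ln (u y) - S * la =
    (ln (u x) - ln (u y) - (u x - u y) / (u x0)) + S * (u x - u y - la).
  by rewrite -/S; ring.
apply: le_trans (ler_normD _ _) _.
have T1 := ln_lip (N0 _ xd) (N0 _ yd) (ltW (N1 _ xd)) (ltW (N1 _ yd)).
apply: (@le_trans _ _ (e1 * (C * `|x - y|) + S * (e1 * `|x - y|))).
  apply: lerD; first by apply: le_trans T1 _; rewrite ler_wpM2l ?(ltW e10)// L1.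
  by rewrite normrM gtr0_norm// ler_wpM2l ?(ltW S0)// H1.
rewrite le_eqVlt; apply/orP; left; apply/eqP.
by rewrite /e1; field; rewrite gt_eqF.
Unshelve. all: by end_near. Qed.

Lemma strict_diff1_partial m (u : 'rV[R]_m -> R) x0 a i : strict_diff1 u x0 a ->
  derivable u x0 (delta_mx 0 i) /\ partial u i x0 = a i 0.
Proof.
move=> /(strict_diff1_derive (delta_mx 0 i))[d1 d2]; split=> //.
by rewrite /partial d2 -rowE mxE.
Qed.

Lemma C2_criterion m (D : set 'rV[R]_m) (f : 'rV[R]_m -> R)
    (G : 'I_m -> 'rV[R]_m -> R) (H : 'I_m -> 'I_m -> 'rV[R]_m -> R) :
  open D ->
  (forall x, D x -> strict_diff1 f x (\col_i G i x)) ->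
  (forall x i, D x -> strict_diff1 (G i) x (\col_j H i j x)) ->
  (forall x i j, D x -> {for x, continuous (H i j)}) ->
  [/\ C2_on D f, forall x i, D x -> partial f i x = G i x &
      forall x i j, D x -> partial (partial f i) j x = H i j x].
Proof.
move=> oD fG GH cH.
have nD x : D x -> \forall y \near x, D y by move=> Dx; exact: open_nbhs_nbhs.
have p1 x i : D x -> partial f i x = G i x.
  by move=> /fG/(strict_diff1_partial i)[_ ->]; rewrite mxE.
have GP x i : D x -> strict_diff1 (partial f i) x (\col_j H i j x).
  move=> Dx; apply: near_eq_strict_diff1 (GH _ i Dx).
  by apply: filterS (nD _ Dx) => y Dy; rewrite p1.
have p2 x i j : D x -> partial (partial f i) j x = H i j x.
  by move=> Dx; have [_ ->] := strict_diff1_partial j (GP _ i Dx); rewrite mxE.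
split=> // x Dx i; split.
- by have [] := strict_diff1_partial i (fG _ Dx).
- exact: strict_diff1_continuous (GP _ i Dx).
- move=> j; split; first by have [] := strict_diff1_partial j (GP _ i Dx).
  rewrite /prop_for/continuous_at p2//.
  apply: cvg_trans (cH _ i j Dx); apply: (@near_eq_cvg _ _ (nbhs x) (nbhs_filter x)).
  by apply: filterS (nD _ Dx) => y Dy; rewrite p2.
Qed.

Lemma strict_diff1_lastc m (x : 'rV[R]_m) : strict_diff1 (@lastc R m) x (const_mx (-1)).
Proof.
have := strict_diff1D (strict_diff1_cst 1 x) (strict_diff1M (strict_diff1_cst (-1) x)
  (strict_diff1_sum (fun i : 'I_m => strict_diff1_coord i x))).
move=> /eq_strict_diff1; apply => [y|]; first by rewrite /lastc mulN1r.
apply/colP => i; rewrite scaler0 !add0r !mxE summxE (bigD1 i)//= mxE !eqxx big1 ?addr0 ?mulr1//.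
by move=> j ji; rewrite mxE [i == j]eq_sym (negbTE ji).
Qed.

Lemma phi0_C2 m : [/\ C2_on (@coord_domain R m) (@phi0 R m.+1 \o @chart R m),
  forall x i, coord_domain x -> partial (@phi0 R m.+1 \o @chart R m) i x =
    m.+1%:R^-1 * ((x 0 i)^-1 - (lastc x)^-1) &
  forall x i j, coord_domain x -> partial (partial (@phi0 R m.+1 \o @chart R m) i) j x =
    - m.+1%:R^-1 * ((i == j)%:R * (x 0 i) ^- 2 + lastc x ^- 2)].
Proof.
set k : R := m.+1%:R^-1.
pose G i (x : 'rV[R]_m) := k * ((x 0 i)^-1 - (lastc x)^-1).
pose H (i j : 'I_m) (x : 'rV[R]_m) := - k * ((i == j)%:R * (x 0 i) ^- 2 + lastc x ^- 2).
apply: (@C2_criterion m _ _ G H) => [|x Dx|x i Dx|x i j Dx].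
- exact: coord_domain_open.
- have l0 := lastc_gt0 Dx; have [x0 _] := Dx.
  have := strict_diff1M (strict_diff1_cst k x) (strict_diff1D
    (strict_diff1_sum (fun i : 'I_m => strict_diff1_ln (x0 i) (strict_diff1_coord i x)))
    (strict_diff1_ln l0 (strict_diff1_lastc x))).
  move=> /eq_strict_diff1; apply => [y|].
    rewrite /= /phi0 sum_ord_last chart_max; congr (_ * (_ + _)).
    by apply: eq_bigr => i _; rewrite chart_lift.
  apply/colP => i; rewrite scaler0 add0r !mxE summxE; congr (_ * _).
  rewrite (bigD1 i)//= !mxE !eqxx mulr1 mulrN1 big1 ?addr0// => j ji.
  by rewrite !mxE [i == j]eq_sym (negbTE ji) mulr0.
- have l0 := lt0r_neq0 (lastc_gt0 Dx); have [x0 _] := Dx.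
  have := strict_diff1M (strict_diff1_cst k x) (strict_diff1D
    (strict_diff1V (lt0r_neq0 (x0 i)) (strict_diff1_coord i x))
    (strict_diff1M (strict_diff1_cst (-1) x) (strict_diff1V l0 (strict_diff1_lastc x)))).
  move=> /eq_strict_diff1; apply => [y|]; first by rewrite mulN1r.
  apply/colP => j; rewrite !scaler0 !add0r !mxE eqxx andbT eq_sym /H.
  by ring.
- have l0 := lt0r_neq0 (lastc_gt0 Dx); have [x0 _] := Dx.
  have dV := strict_diff1V (lt0r_neq0 (x0 i)) (strict_diff1_coord i x).
  have dL := strict_diff1V l0 (strict_diff1_lastc x).
  have := strict_diff1M (strict_diff1_cst (- k) x) (strict_diff1D
    (strict_diff1M (strict_diff1_cst (i == j)%:R x) (strict_diff1M dV dV)) (strict_diff1M dL dL)).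
  move=> /eq_strict_diff1 => /(_ (H i j)) K; apply: (@strict_diff1_continuous _ _ _ _ _ (K _ _ _)).
  + by move=> y; rewrite /H -!expr2 !exprVn.
  + by [].
Qed.

Lemma phi0_curvature_pos m (x v : 'rV[R]_m) : coord_domain x -> v != 0 ->
  0 < (v *m curvature (@phi0 R m.+1 \o @chart R m) x *m v^T) 0 0.
Proof.
move=> Dx v0; have [_ gE hE] := phi0_C2 m.
have l0 := lt0r_neq0 (lastc_gt0 Dx); have [x0 _] := Dx.
set k : R := m.+1%:R^-1 in gE hE.
pose z (i : 'I_m.+1) := if unlift ord_max i is Some j then v 0 j / x 0 j
   else - (\sum_j v 0 j) / lastc x.
have zmax : z ord_max = - (\sum_j v 0 j) / lastc x by rewrite /z unlift_none.
have zlift j : z (lift ord_max j) = v 0 j / x 0 j by rewrite /z liftK.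
pose mu := k * \sum_i z i.
have kn : k * m.+1%:R = 1 by rewrite mulVf// pnatr_eq0.
have k0 : 0 < k by rewrite invr_gt0.
have gv : (v *m gradient (@phi0 R m.+1 \o @chart R m) x) 0 0 = mu.
  rewrite mxE /mu sum_ord_last zmax mulrDr mulr_sumr mulNr mulr_suml mulrN mulr_sumr.
  rewrite -sumrB; apply: eq_bigr => j _; rewrite zlift mxE gE//; ring.
have hv : (v *m (hessian (@phi0 R m.+1 \o @chart R m) x *m v^T)) 0 0 = - k * \sum_i z i ^+ 2.
  rewrite sum_ord_last zmax.
  transitivity (\sum_i (- k * z (lift ord_max i) ^+ 2 - k * lastc x ^- 2 * v 0 i * \sum_j v 0 j)).
    rewrite mxE; apply: eq_bigr => i _; rewrite mxE.
    have -> : \sum_j hessian (@phi0 R m.+1 \o @chart R m) x i j * (v^T) j 0 =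
        - k * (v 0 i * x 0 i ^- 2) - k * lastc x ^- 2 * \sum_j v 0 j.
      rewrite mulr_sumr -sumrN (bigD1 i)//= [in RHS](bigD1 i)//= addrA; congr (_ + _).
        by rewrite !mxE hE// eqxx mul1r; ring.
      by apply: eq_bigr => j ji; rewrite !mxE hE// (negbTE ji) mul0r add0r; ring.
    by rewrite zlift; field; rewrite l0 (gt_eqF (x0 i)).
  rewrite big_split/= -!mulr_sumr sumrN -mulr_suml -mulr_sumr; field.
  exact: l0.
rewrite curvatureE hv gv mulNr opprK.
have -> : k * (\sum_i z i ^+ 2) - mu ^+ 2 = k * \sum_i (z i - mu) ^+ 2.
  under [in RHS]eq_bigr do rewrite sqrrB.
  rewrite big_split/= sumrB sumr_const card_ord -[mu ^+ 2 *+ _]mulr_natl.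
  have -> : \sum_(i < m.+1) z i * mu *+ 2 = 2 * mu * \sum_i z i.
    by rewrite mulr_sumr; apply: eq_bigr => i _; rewrite mulr2n; ring.
  have zE : \sum_i z i = m.+1%:R * mu by rewrite /mu mulrA [_ * k]mulrC kn mul1r.
  rewrite zE; have -> : k * (\sum_i z i ^+ 2 - 2 * mu * (m.+1%:R * mu) + m.+1%:R * mu ^+ 2) =
    k * \sum_i z i ^+ 2 - (k * m.+1%:R) * mu ^+ 2 by ring.
  by rewrite kn mul1r.
rewrite mulr_gt0// lt_neqAle sumr_ge0 ?andbT; last by move=> i _; exact: sqr_ge0.
apply/eqP => /esym/eqP; rewrite psumr_eq0; last by move=> i _; exact: sqr_ge0.
move=> /allP zP.
have zE i : z i = mu.
  by have := zP i (mem_index_enum i); rewrite /= sqrf_eq0 subr_eq0 => /eqP.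
have vE j : v 0 j = mu * x 0 j by rewrite -(zE (lift ord_max j)) zlift divfK// gt_eqF.
have mu0 : mu = 0.
  have := zE ord_max; rewrite zmax; under eq_bigr do rewrite vE.
  rewrite -mulr_sumr; have -> : \sum_i x 0 i = 1 - lastc x by rewrite /lastc; ring.
  by move=> /(congr1 (fun z => z * lastc x)); rewrite divfK// => ?; lra.
by move/eqP: v0; apply; apply/rowP => j; rewrite vE mu0 mul0r mxE.
Qed.

End barycentric_potential.

Section interpolation.
Context {R : realType}.

Lemma continuous_lincomb (T : topologicalType) (u v : T -> R) (a b : R) x :
  {for x, continuous u} -> {for x, continuous v} ->
  {for x, continuous (fun x => a * u x + b * v x)}.
Proof. by move=> cu cv; apply: cvgD; (apply: cvgM; first exact: cvg_cst). Qed.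

Let col_hessianE m (f : 'rV[R]_m -> R) x (a : R) i j :
  (a *: col i (hessian f x)) j 0 = a * partial (partial f i) j x.
Proof. by rewrite mxE [X in _ * X]mxE [X in _ * X]mxE. Qed.

Lemma C2_lincomb m (f g : 'rV[R]_m -> R) (a b : R) :
  C2_on (@coord_domain R m) f -> C2_on (@coord_domain R m) g ->
  let h x := a * f x + b * g x in
  [/\ C2_on (@coord_domain R m) h,
      forall x, coord_domain x -> gradient h x = a *: gradient f x + b *: gradient g x &
      forall x, coord_domain x -> hessian h x = a *: hessian f x + b *: hessian g x].
Proof.
move=> fC2 gC2 h.
have lin (u v : 'rV[R]_m -> R) x p q : strict_diff1 u x p -> strict_diff1 v x q ->
    strict_diff1 (fun x => a * u x + b * v x) x (a *: p + b *: q).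
  move=> up vq; have := strict_diff1D (strict_diff1M (strict_diff1_cst a x) up)
    (strict_diff1M (strict_diff1_cst b x) vq).
  by move=> /eq_strict_diff1; apply => [y|]; [|rewrite !scaler0 !add0r].
pose G i x := a * partial f i x + b * partial g i x.
pose H i j x := a * partial (partial f i) j x + b * partial (partial g i) j x.
have [] := @C2_criterion R m (@coord_domain R m) h G H.
- exact: coord_domain_open.
- move=> x Dx; have := lin _ _ _ _ _ (C2_strict_diff1 fC2 Dx) (C2_strict_diff1 gC2 Dx).
  by move=> /eq_strict_diff1; apply => [y|]; [exact: erefl|apply/colP => i; rewrite !mxE].
- move=> x i Dx.
  have := lin _ _ _ _ _ (C2_strict_diff1_partial fC2 i Dx) (C2_strict_diff1_partial gC2 i Dx).
  move=> /eq_strict_diff1; apply => [y|]; first exact: erefl.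
  apply/colP => j; rewrite [LHS]mxE [RHS]mxE [X in X + _]col_hessianE.
  by rewrite [X in _ + X]col_hessianE; exact: erefl.
- move=> x i j Dx; have [_ _ /(_ j)[_ cf]] := fC2 _ Dx i; have [_ _ /(_ j)[_ cg]] := gC2 _ Dx i.
  exact: (@continuous_lincomb _ _ _ a b x cf cg).
- move=> hC2 h1 h2; split=> // x Dx.
    apply/colP => i; rewrite [LHS]mxE [RHS]mxE [X in X + _]mxE [X in _ + X]mxE.
    by rewrite [X in _ * X + _]mxE [X in _ + _ * X]mxE; exact: h1.
  apply/matrixP => i j; rewrite [LHS]mxE [RHS]mxE [X in X + _]mxE [X in _ + X]mxE.
  by rewrite [X in _ * X + _]mxE [X in _ + _ * X]mxE; exact: h2.
Qed.

Let lincomb_entry m (a b : R) (p q : 'cV[R]_m) j :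
  (a *: p + b *: q) j 0 = a * p j 0 + b * q j 0.
Proof. by rewrite mxE [X in X + _]mxE [X in _ + X]mxE. Qed.

Let lincomb_lin m (v : 'rV[R]_m) (a b : R) (p q : 'cV[R]_m) :
  (v *m (a *: p + b *: q)) 0 0 = a * (v *m p) 0 0 + b * (v *m q) 0 0.
Proof. by rewrite mulmxDr -!scalemxAr mxE [X in X + _]mxE [X in _ + X]mxE. Qed.

Let lincomb_quad m (v : 'rV[R]_m) (a b : R) (p q : 'M[R]_m) :
  (v *m ((a *: p + b *: q) *m v^T)) 0 0 =
  a * (v *m (p *m v^T)) 0 0 + b * (v *m (q *m v^T)) 0 0.
Proof. by rewrite mulmxDl -!scalemxAl lincomb_lin. Qed.

Let lincomb_pos (t p q r s : R) : 0 <= t -> t <= 1 ->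
  0 < - p - r ^+ 2 -> 0 < - q - s ^+ 2 ->
  0 < - ((1 - t) * p + t * q) - ((1 - t) * r + t * s) ^+ 2.
Proof.
move=> t0 t1 H1 H2.
have -> : - ((1 - t) * p + t * q) - ((1 - t) * r + t * s) ^+ 2 =
  (1 - t) * (- p - r ^+ 2) + t * (- q - s ^+ 2) + t * (1 - t) * (r - s) ^+ 2 by ring.
have h3 : 0 <= t * (1 - t) * (r - s) ^+ 2.
  by apply: mulr_ge0; [apply: mulr_ge0; rewrite ?subr_ge0|exact: sqr_ge0].
apply: ltr_wpDr => //.
have [->|tN0] := eqVneq t 0; first by rewrite subr0 mul1r mul0r addr0.
apply: ltr_wpDl; first by apply: mulr_ge0; [rewrite subr_ge0|exact: ltW].
by rewrite mulr_gt0// lt_neqAle eq_sym tN0.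
Qed.

Lemma curvature_lincomb_pos m (f g : 'rV[R]_m -> R) (t : R) : 0 <= t <= 1 ->
  C2_on (@coord_domain R m) f -> C2_on (@coord_domain R m) g ->
  (forall x v : 'rV[R]_m, coord_domain x -> v != 0 -> 0 < (v *m curvature f x *m v^T) 0 0) ->
  (forall x v : 'rV[R]_m, coord_domain x -> v != 0 -> 0 < (v *m curvature g x *m v^T) 0 0) ->
  forall x v : 'rV[R]_m, coord_domain x -> v != 0 ->
  0 < (v *m curvature (fun x => (1 - t) * f x + t * g x) x *m v^T) 0 0.
Proof.
move=> /andP[t0 t1] fC2 gC2 fp gp x v Dx v0.
have H1 := fp _ _ Dx v0; rewrite (curvatureE f x v) in H1.
have H2 := gp _ _ Dx v0; rewrite (curvatureE g x v) in H2.
have [_ /(_ _ Dx) gE /(_ _ Dx) hE] := C2_lincomb (1 - t) t fC2 gC2.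
rewrite (curvatureE _ x v) gE hE lincomb_quad lincomb_lin.
exact: lincomb_pos.
Qed.

Lemma weight_lincomb m (f g : 'rV[R]_m -> R) (t : R) x i :
  C2_on (@coord_domain R m) f -> C2_on (@coord_domain R m) g -> coord_domain x ->
  weight (fun x => (1 - t) * f x + t * g x) x i = (1 - t) * weight f x i + t * weight g x i.
Proof.
move=> fC2 gC2 Dx; have [_ /(_ _ Dx) gE _] := C2_lincomb (1 - t) t fC2 gC2.
rewrite /weight /dual_last gE lincomb_lin; case: unlift => [j|]; last by ring.
by rewrite lincomb_entry; ring.
Qed.

End interpolation.

Section chart_translation.
Context {R : realType}.

Lemma chart_total m (x : 'rV[R]_m) : \sum_i chart x 0 i = 1.
Proof.
rewrite sum_ord_last chart_max /lastc; under eq_bigr do rewrite chart_lift.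
by rewrite subrKC.
Qed.

Lemma drop_lastK m (p : 'rV[R]_m.+1) : \sum_i p 0 i = 1 -> chart (drop_last p) = p.
Proof.
move=> p1; apply/rowP => i; have [j ->|->] := unliftP ord_max i.
  by rewrite chart_lift mxE.
rewrite chart_max /lastc -p1 sum_ord_last addrAC -sumrB big1 ?add0r// => j _.
by rewrite mxE subrr.
Qed.

Lemma chartK m (x : 'rV[R]_m) : drop_last (chart x) = x.
Proof. by apply/rowP => j; rewrite mxE chart_lift. Qed.

Lemma chart_gt0 m (x : 'rV[R]_m) i : coord_domain x -> 0 < chart x 0 i.
Proof. by rewrite coord_domainE; apply. Qed.

Lemma chart_simplex m (x : 'rV[R]_m) : (0 < m)%N -> coord_domain x -> simplex (chart x).
Proof.
move=> m0 Dx; split; last exact: chart_total.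
move=> i; rewrite chart_gt0//= -(chart_total x).
have [j ji] : exists j : 'I_m.+1, j != i.
  have [->|i0] := eqVneq i ord0; last by exists ord0; rewrite eq_sym.
  by exists ord_max; rewrite -val_eqE/= -lt0n.
rewrite (bigD1 i)//= (bigD1 j)//= ltrDl ltr_pwDl ?chart_gt0// sumr_ge0// => l _.
exact/ltW/chart_gt0.
Qed.

Lemma simplex_domain m (p : 'rV[R]_m.+1) : simplex p -> coord_domain (drop_last p).
Proof.
move=> [p0 p1]; rewrite coord_domainE => i _ /=; rewrite drop_lastK//.
by have /andP[] := p0 i.
Qed.

Lemma simplexP m (p : 'rV[R]_m.+1) : simplex p -> p = chart (drop_last p).
Proof. by move=> [_ p1]; rewrite drop_lastK. Qed.

Lemma drop_lastD m (u v : 'rV[R]_m.+1) : drop_last (u + v) = drop_last u + drop_last v.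
Proof. by apply/rowP => i; rewrite !mxE. Qed.

Lemma derive_chart m (phi : 'rV[R]_m.+1 -> R) (y : 'rV[R]_m) (v : 'rV[R]_m.+1) :
  \sum_i v 0 i = 0 -> 'D_v phi (chart y) = 'D_(drop_last v) (phi \o @chart R m) y.
Proof.
move=> v0; rewrite /derive.
suff -> : (fun h : R => h^-1 *: ((phi \o shift (chart y)) (h *: v) - phi (chart y))) =
    (fun h : R => h^-1 *: (((phi \o @chart R m) \o shift y) (h *: drop_last v) -
                           (phi \o @chart R m) y)) by [].
apply/funext => h; rewrite /shift/=; congr (_ *: (phi _ - _)).
rewrite -[LHS]drop_lastK.
  by congr chart; apply/rowP => i; rewrite !mxE liftK.
have -> : \sum_i (h *: v + chart y) 0 i = h * \sum_i v 0 i + \sum_i chart y 0 i.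
  by rewrite mulr_sumr -big_split; apply: eq_bigr => i _; rewrite mxE [X in X + _]mxE.
by rewrite v0 chart_total mulr0 add0r.
Qed.

Let mulmxB00 m (u v : 'rV[R]_m) (g : 'cV[R]_m) :
  ((u - v) *m g) 0 0 = (u *m g) 0 0 - (v *m g) 0 0.
Proof. by rewrite mulmxBl mxE [X in _ + X]mxE. Qed.

Let delta_mul00 m (g : 'cV[R]_m) j : ((delta_mx 0 j : 'rV[R]_m) *m g) 0 0 = g j 0.
Proof. by rewrite -rowE mxE. Qed.

Lemma portfolio_chart m (phi : 'rV[R]_m.+1 -> R) (y : 'rV[R]_m) i :
  C2_on (@coord_domain R m) (phi \o @chart R m) -> coord_domain y ->
  portfolio phi (chart y) 0 i = chart y 0 i * weight (phi \o @chart R m) y i.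
Proof.
move=> fC2 Dy; rewrite mxE; congr (_ * _).
rewrite derive_chart; last first.
  under eq_bigr do rewrite mxE [X in _ + X]mxE.
  rewrite sumrB chart_total (bigD1 i)//= mxE !eqxx big1 ?addr0 ?subrr// => j ji.
  by rewrite mxE (negbTE ji) andbF.
have [_ ->] := strict_diff1_derive (drop_last (delta_mx 0 i - chart y)) (C2_strict_diff1 fC2 Dy).
rewrite drop_lastD.
have -> : drop_last (- chart y) = - y by apply/rowP => j; rewrite !mxE liftK.
rewrite mulmxB00 /weight /dual_last.
have [j ->|->] := unliftP ord_max i.
  have -> : drop_last (delta_mx 0 (lift ord_max j) : 'rV[R]_m.+1) = delta_mx 0 j.
    by apply/rowP => k; rewrite !mxE (inj_eq lift_inj).
  by rewrite delta_mul00; ring.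
have -> : drop_last (delta_mx 0 ord_max : 'rV[R]_m.+1) = 0.
  by apply/rowP => k; rewrite !mxE eqxx/= eq_sym (negbTE (neq_lift _ _)).
by rewrite mul0mx mxE; ring.
Qed.

Lemma portfolio_phi0 m (y : 'rV[R]_m) i : coord_domain y ->
  chart y 0 i * weight (@phi0 R m.+1 \o @chart R m) y i = m.+1%:R^-1.
Proof.
move=> Dy; have [_ gE _] := @phi0_C2 R m.
have l0 := lt0r_neq0 (lastc_gt0 Dy); have [y0 _] := Dy.
set k : R := m.+1%:R^-1 in gE *.
have km : k * m%:R = 1 - k.
  have : k * m.+1%:R = 1 by rewrite mulVf// pnatr_eq0.
  by rewrite -natr1 mulrDr mulr1 => kE; apply/eqP; rewrite eq_sym subr_eq kE.
have wE : dual_last (@phi0 R m.+1 \o @chart R m) y = k / lastc y.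
  rewrite /dual_last mxE.
  have -> : \sum_j y 0 j * gradient (@phi0 R m.+1 \o @chart R m) y j 0 =
     \sum_j (k - k / lastc y * y 0 j).
    by apply: eq_bigr => j _; rewrite mxE gE//; field; rewrite l0 (gt_eqF (y0 j)).
  rewrite sumrB -mulr_sumr sumr_const card_ord -[_ *+ m]mulr_natr km.
  have -> : \sum_i y 0 i = 1 - lastc y by rewrite /lastc; ring.
  by field.
rewrite /weight wE; have [j ->|->] := unliftP ord_max i.
  by rewrite chart_lift mxE gE//; field; rewrite l0 (gt_eqF (y0 j)).
by rewrite chart_max addr0 mulrCA mulfV// mulr1.
Qed.

Lemma simplex_inv_chart m (x : 'rV[R]_m) : coord_domain x ->
  (exists k : R, k != 0 /\ forall i, chart x 0 i * chart (inv_coord x) 0 i = k) /\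
  simplex_inv (chart x) = chart (inv_coord x).
Proof.
move=> Dx; have l0 := lt0r_neq0 (lastc_gt0 Dx); have [x0 _] := Dx.
have b0 := recip_gt0 (ratio_gt0 Dx).
have s0 := lt0r_neq0 (orthant_total b0).
set s := 1 + _ in s0.
have kP i : chart x 0 i * chart (inv_coord x) 0 i = lastc x / s.
  have [j ->|->] := unliftP ord_max i.
    rewrite !chart_lift mxE -/s !mxE; field.
    by rewrite l0 s0 (gt_eqF (x0 j)).
  by rewrite !chart_max lastc_proj.
have k0 : lastc x / s != 0 by rewrite mulf_neq0// invr_eq0.
split; first by exists (lastc x / s).
have iE i : (chart x 0 i)^-1 = chart (inv_coord x) 0 i / (lastc x / s).
  rewrite -(kP i); have := lt0r_neq0 (chart_gt0 i Dx).
  have := lt0r_neq0 (chart_gt0 i (inv_coord_domain Dx)).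
  by move=> *; field; apply/andP; split.
apply/rowP => i; rewrite [LHS]mxE iE; under eq_bigr do rewrite iE.
by rewrite -mulr_suml chart_total mul1r invrK divfK.
Qed.

End chart_translation.

(** * Densities *)

Section density_transfer.
Local Open Scope ereal_scope.
Context d1 d2 (X : measurableType d1) (Y : measurableType d2) (R : realType).
Variables (mu : {measure set X -> \bar R}) (nu : {measure set Y -> \bar R}).
Variables (D : set X) (phi : X -> Y) (k : X -> R).
Hypotheses (mD : measurable D) (mphi : measurable_fun D phi).
Hypotheses (mk : measurable_fun D k) (k0 : forall x, D x -> (0 <= k x)%R).
Hypothesis nuE : forall A, measurable A -> nu A = \int[mu]_(x in D `&` phi @^-1` A) (k x)%:E.

Import HBNNSimple.

Lemma ge0_integral_density_transfer A (h : Y -> \bar R) :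
  measurable A -> measurable_fun setT h -> (forall y, 0 <= h y) ->
  \int[nu]_(y in A) h y = \int[mu]_(x in D `&` phi @^-1` A) (h (phi x) * (k x)%:E).
Proof.
move=> mA mh h0; pose f_ := nnsfun_approx measurableT mh.
have mDA B : measurable B -> measurable (D `&` phi @^-1` B) by move=> mB; exact: mphi.
set DA := D `&` _.
have mDA' : measurable DA by exact: mDA.
have DAD : DA `<=` D by move=> x [].
have mkA : measurable_fun DA (EFin \o k) by apply/measurable_EFinP; exact: measurable_funS mk.
have kDA x : DA x -> 0 <= (k x)%:E by move=> [Dx _]; rewrite lee_fin k0.
have mfphi n : measurable_fun DA (fun x => (f_ n (phi x))%:E).
  apply/measurable_EFinP; apply: (@measurableT_comp _ _ _ _ _ _ (f_ n)) => //.
  exact: measurable_funS mphi.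
transitivity (limn (fun n => \int[nu]_(y in A) (f_ n y)%:E)).
  rewrite -monotone_convergence//.
  - by apply: eq_integral => y _; apply/esym/cvg_lim => //; apply: cvg_nnsfun_approx.
  - by move=> n; apply/measurable_EFinP; exact: measurable_funTS.
  - by move=> n y _; rewrite lee_fin.
  - by move=> y _ a b ab; rewrite lee_fin; exact/lefP/nd_nnsfun_approx.
transitivity (limn (fun n => \int[mu]_(x in DA) ((f_ n (phi x))%:E * (k x)%:E))); last first.
  rewrite -monotone_convergence//.
  - apply: eq_integral => x; rewrite inE => -[Dx _]; apply/cvg_lim => //.
    by apply: cvgeZr => //; apply: cvg_nnsfun_approx.
  - by move=> n; exact: emeasurable_funM.
  - by move=> n x Dx; rewrite mule_ge0 ?kDA// lee_fin.
  - move=> x Dx a b ab; apply: lee_wpmul2r; first exact: kDA.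
    by rewrite lee_fin; exact/lefP/nd_nnsfun_approx.
congr (limn _); apply/funext => n.
pose P r := f_ n @^-1` [set r].
have mP r : measurable (P r) by rewrite -[X in measurable X]setTI; exact: measurable_funP.
transitivity (\sum_(r \in range (f_ n)) (r%:E * \int[mu]_(x in DA `&` phi @^-1` P r) (k x)%:E)).
  under eq_integral do rewrite fimfunE -fsumEFin//.
  rewrite ge0_integral_fsum//; last 2 first.
  - by move=> r; apply/measurable_EFinP; exact: measurable_funM.
  - by move=> r y _; rewrite nnfun_muleindic_ge0.
  apply: eq_fsbigr => r _; rewrite integralZl_indic_nnsfun// integral_indic//.
  rewrite nuE; last exact: measurableI.
  by congr (_ * _); rewrite /DA -setIA -preimage_setI [A `&` _]setIC.
have mind r : measurable_fun DA (fun x => (\1_(P r) (phi x) : R)%:E).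
  have mi : measurable_fun setT (\1_(P r) : Y -> R) by exact: measurable_indic.
  have mp : measurable_fun DA phi by exact: measurable_funS mphi.
  by apply/measurable_EFinP; exact: (measurableT_comp mi mp).
have mrind r : measurable_fun DA (fun x => (r * \1_(P r) (phi x))%:E).
  by under eq_fun do rewrite EFinM; exact: measurable_funeM.
transitivity (\sum_(r \in range (f_ n)) \int[mu]_(x in DA) ((r * \1_(P r) (phi x))%:E * (k x)%:E)); last first.
  rewrite -ge0_integral_fsum//.
  - apply: eq_integral => x _; rewrite fimfunE -fsumEFin// ge0_mule_fsuml//.
    by move=> r; rewrite nnfun_muleindic_ge0.
  - by move=> r; apply: emeasurable_funM.
  - by move=> r x Dx; rewrite mule_ge0 ?kDA// nnfun_muleindic_ge0.
apply: eq_fsbigr => r /[!inE] -[y _ <-{r}].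
set r := f_ n y; have r0 : (0 <= r)%R by [].
under [in RHS]eq_integral do rewrite EFinM -muleA.
rewrite ge0_integralZl//; [|exact: emeasurable_funM|by move=> x Dx; rewrite mule_ge0 ?kDA// lee_fin].
congr (_ * _); rewrite integral_mkcondr; apply: eq_integral => x _.
rewrite patchE indicE; case: ifPn => xP.
  by rewrite mem_set ?mul1e//; rewrite inE in xP.
by rewrite memNset ?mul0e// => Px; move/negP: xP; apply; rewrite inE.
Qed.

End density_transfer.

Section transport_chart.
Context {R : realType}.
Variables (m : nat) (phi1 : 'rV[R]_m.+1 -> R) (t : R).
Hypotheses (m_gt0 : (0 < m)%N) (t01 : 0 <= t <= 1).
Hypothesis phi1_C2 : C2_on_simplex phi1.
Hypothesis phi1_pos : forall r v : 'rV[R]_m.+1, simplex r ->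
  v != 0 -> \sum_i v 0 i = 0 -> 0 < L_form phi1 r v.
Local Notation D := (@coord_domain R m).
Local Notation f0 := (@phi0 R m.+1 \o @chart R m).
Local Notation f1 := (phi1 \o @chart R m).

Definition interp_coord (x : 'rV[R]_m) : R := (1 - t) * f0 x + t * f1 x.
Local Notation ft := interp_coord.

Lemma phi1_curvature_pos (y v : 'rV[R]_m) : D y -> v != 0 ->
  0 < (v *m curvature f1 y *m v^T) 0 0.
Proof.
move=> Dy v0; pose w := chart v - chart 0.
have w0 : \sum_i w 0 i = 0.
  under eq_bigr do rewrite mxE [X in _ + X]mxE.
  by rewrite sumrB !chart_total subrr.
have wv : drop_last w = v.
  by apply/rowP => j; rewrite mxE mxE [X in _ + X]mxE !chart_lift mxE subr0.
have wN0 : w != 0.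
  apply: contraNneq v0 => wE; rewrite -wv wE; apply/eqP/rowP => j.
  by rewrite !mxE.
have := phi1_pos (chart_simplex m_gt0 Dy) wN0 w0.
have D1 z : 'D_w phi1 (chart z) = 'D_v f1 z by rewrite (derive_chart phi1 z w0) wv.
have D1E z : D z -> 'D_v f1 z = (v *m gradient f1 z) 0 0.
  by move=> Dz; have [_ ->] := strict_diff1_derive v (C2_strict_diff1 phi1_C2 Dz).
have D2 : 'D_w ('D_w phi1) (chart y) = (v *m (hessian f1 y *m v^T)) 0 0.
  rewrite (derive_chart _ y w0) wv.
  have -> : ('D_w phi1 \o @chart R m) = 'D_v f1 by apply/funext => z; exact: D1.
  have H : strict_diff1 ('D_v f1) y (hessian f1 y *m v^T).
    apply: near_eq_strict_diff1 (C2_strict_diff1_slope phi1_C2 v Dy).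
    by apply: filterS (open_nbhs_nbhs (conj (@coord_domain_open R m) Dy)) => z /D1E ->.
  by have [_ ->] := strict_diff1_derive v H.
by rewrite /L_form D2 D1 (D1E _ Dy) (curvatureE f1 y v).
Qed.

Lemma interp_C2 : C2_on D ft.
Proof.
have [C2 _ _] := @phi0_C2 R m.
by have [H _ _] := C2_lincomb (1 - t) t C2 phi1_C2.
Qed.

Lemma interp_pos (y v : 'rV[R]_m) : D y -> v != 0 ->
  0 < (v *m curvature ft y *m v^T) 0 0.
Proof.
have [C2 _ _] := @phi0_C2 R m.
apply: (curvature_lincomb_pos t01 C2 phi1_C2); last exact: phi1_curvature_pos.
exact: phi0_curvature_pos.
Qed.

Lemma portfolio_interp_chart (y : 'rV[R]_m) i : D y ->
  portfolio_interp phi1 t (chart y) 0 i = chart y 0 i * weight ft y i.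
Proof.
move=> Dy; have [C2 _ _] := @phi0_C2 R m.
rewrite (weight_lincomb t i C2 phi1_C2 Dy).
transitivity ((1 - t) * (chart y 0 i * weight f0 y i) + t * (chart y 0 i * weight f1 y i)).
  rewrite (portfolio_phi0 i Dy) -(portfolio_chart i phi1_C2 Dy).
  by rewrite /portfolio_interp mxE [X in X + _]mxE [X in _ + X]mxE mxE.
by move: (chart y 0 i) (weight f0 y i) (weight f1 y i) => a b c; ring.
Qed.

Lemma L_tilde_chart (y : 'rV[R]_m) :
  L_tilde (phi_interp phi1 t) (chart y) = curvature ft y.
Proof. by rewrite /L_tilde chartK. Qed.

Lemma transport_map_chart (x : 'rV[R]_m) : D x ->
  transport_map (portfolio_interp phi1 t) (chart x) = chart (transport_coord ft x).
Proof.
move=> Dx; have Dy := inv_coord_domain Dx; set y := inv_coord x in Dy.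
have [[k [k0 kP]] sE] := simplex_inv_chart Dx.
have w0 := dual_last_gt0 interp_C2 interp_pos Dy m_gt0.
have u0 : orthant (dual ft y) by move=> i; exact: (dual_gt0 interp_C2 interp_pos).
have s0 := orthant_total u0; set s := 1 + _ in s0.
have cE i : chart (transport_coord ft x) 0 i = (s * dual_last ft y)^-1 * weight ft y i.
  rewrite /weight; have [j ->|->] := unliftP ord_max i.
    rewrite chart_lift mxE -/y -/s invfM -mulrA; congr (_ * _).
    by rewrite mxE [X in X + _]mxE [X in _ + X]mxE [X in _ * X]mxE; field; exact: lt0r_neq0.
  rewrite chart_max lastc_proj -/y// -/s addr0; field.
  by rewrite !lt0r_neq0.
have W1 : (s * dual_last ft y)^-1 * \sum_i weight ft y i = 1.
  by rewrite -(chart_total (transport_coord ft x)) mulr_sumr; apply: eq_bigr => i _; rewrite cE.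
apply/rowP => i; rewrite cE /transport_map sE mxE.
have pE j : chart x 0 j * portfolio_interp phi1 t (chart (inv_coord x)) 0 j = k * weight ft y j.
  by rewrite portfolio_interp_chart// mulrA kP.
rewrite pE; under eq_bigr do rewrite pE.
rewrite -mulr_sumr invfM mulrACA mulfV// mul1r mulrC; congr (_ * _).
have W0 : \sum_i weight ft y i != 0.
  by apply: contra_eq_neq W1 => ->; rewrite mulr0 eq_sym oner_neq0.
by rewrite -[LHS]mul1r -W1 mulfK.
Qed.

End transport_chart.

Section null_sets.
Local Open Scope ereal_scope.
Context d (T : measurableType d) (R : realType) (mu : {measure set T -> \bar R}).

Lemma integral_gt0_null (E : set T) (k : T -> R) : measurable E ->
  measurable_fun E k -> (forall x, E x -> (0 < k x)%R) ->
  \int[mu]_(x in E) (k x)%:E = 0 -> mu E = 0.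
Proof.
move=> mE mk k0 ik; have mk' : measurable_fun E (EFin \o k) by apply/measurable_EFinP.
have /(ae_eq_integral_abs mu mE mk')[N [mN N0 EN]] :
    \int[mu]_(x in E) `|(EFin \o k) x| = 0.
  rewrite -ik; apply: eq_integral => x; rewrite inE => Ex /=.
  by rewrite gtr0_norm ?k0.
apply: (subset_measure0 mE mN) => // x Ex; apply: EN => /(_ Ex) /=.
by move=> [kx]; have := k0 _ Ex; rewrite kx ltxx.
Qed.

Lemma density_ge0 (P : set T -> \bar R) (rho : T -> \bar R) :
  (forall A, measurable A -> 0 <= P A) -> is_density mu P rho ->
  exists r : T -> \bar R, [/\ measurable_fun setT r, forall x, 0 <= r x,
    forall A, measurable A -> P A = \int[mu]_(x in A) r x &
    exists N, [/\ measurable N, mu N = 0 & forall x, ~ N x -> rho x = r x]].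
Proof.
move=> P0 [irho PE]; have mrho := measurable_int _ irho.
pose N := [set x | rho x < 0].
have mN : measurable N.
  by rewrite -[N]setTI; exact: emeasurable_fun_infty_o.
have mrN : measurable_fun N rho by exact: measurable_funTS.
have N0 : mu N = 0.
  have H : \int[mu]_(x in N) `|rho x| = 0.
    apply/eqP; rewrite eq_le integral_ge0 ?andbT//.
    have -> : \int[mu]_(x in N) `|rho x| = - \int[mu]_(x in N) rho x.
      rewrite -[LHS]oppeK -integral_ge0N//; congr (- _); apply: eq_integral => x.
      by rewrite inE => /ltW rx; rewrite lee0_abs// oppeK.
    by rewrite leeNl oppe0 -PE// P0.
  have /(ae_eq_integral_abs mu mN mrN)[M [mM M0 NM]] := H.
  apply: (subset_measure0 mN mM) => // x Nx; apply: NM => /(_ Nx) /= rx.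
  by move: Nx; rewrite /N/= rx ltxx.
pose r x := maxe (rho x) 0.
have mr : measurable_fun setT r by exact: measurable_maxe.
have rE x : ~ N x -> rho x = r x.
  by move=> /negP; rewrite -leNgt => rx; rewrite /r max_l.
exists r; split=> //.
- by move=> x; rewrite /r le_max lexx orbT.
- move=> A mA; rewrite PE//; apply: ae_eq_integral => //.
  + exact: measurable_funTS.
  + exact: measurable_funTS.
  + exists N; split=> // x /= h; apply: contrapT => Nx; apply: h => _; exact: rE.
- by exists N.
Qed.

End null_sets.

Section simplex_measure.
Context {R : realType}.
Local Notation lam := (lebesgue_rV R).

Lemma measurable_drop_last m : measurable_fun setT (@drop_last R m).
Proof.
apply: measurable_fun_mx => i j; rewrite (ord1 i).
by under eq_fun do rewrite mxE; exact: measurable_coord.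
Qed.

Lemma measurable_chart_image m (E : set 'rV[R]_m) : measurable E ->
  measurable (@chart R m @` E).
Proof.
move=> mE; have -> : @chart R m @` E =
    (fun p : 'rV[R]_m.+1 => \sum_i p 0 i) @^-1` [set 1] `&` @drop_last R m @^-1` E.
  apply/seteqP; split=> [_ [x Ex <-]|p /= [p1 Ep]].
    by split; [exact: chart_total|rewrite /= chartK].
  by exists (drop_last p) => //; exact: drop_lastK.
apply: measurableI.
  rewrite -[X in measurable X]setTI.
  have ms : measurable_fun setT (fun p : 'rV[R]_m.+1 => \sum_i p 0 i).
    by apply: measurable_sum => i; exact: measurable_coord.
  by apply: ms => //; exact: measurable_set1.
by rewrite -[X in measurable X]setTI; exact: measurable_drop_last.
Qed.

Lemma chart_preimage_image m (E : set 'rV[R]_m) : @chart R m @^-1` (@chart R m @` E) = E.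
Proof.
apply/seteqP; split=> [x [y Ey /(congr1 (@drop_last R m))]|x Ex]; last by exists x.
by rewrite !chartK => <-.
Qed.

Definition chart_density m (x : 'rV[R]_m) : R := `|\prod_i chart x 0 i|^-1.

Lemma chart_densityE m (x : 'rV[R]_m) : coord_domain x ->
  chart_density x = (\prod_i chart x 0 i)^-1.
Proof.
by move=> Dx; rewrite /chart_density gtr0_norm// prodr_gt0// => i _; exact: chart_gt0.
Qed.

Lemma chart_density_gt0 m (x : 'rV[R]_m) : coord_domain x -> 0 < chart_density x.
Proof.
by move=> Dx; rewrite chart_densityE// invr_gt0 prodr_gt0// => i _; exact: chart_gt0.
Qed.

Lemma chart_density_ge0 m (x : 'rV[R]_m) : 0 <= chart_density x.
Proof. by rewrite invr_ge0. Qed.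

Lemma measurable_chart_density m : measurable_fun setT (@chart_density m).
Proof.
rewrite (_ : @chart_density m = (fun z => powR z (-1)) \o
    (fun x : 'rV[R]_m => `|\prod_i chart x 0 i|)).
  apply: measurableT_comp; first exact: measurable_powR.
  apply: measurableT_comp => //; apply: measurable_prod => i _.
  exact: measurable_chart_coord.
by apply/funext => x /=; rewrite powR_inv1.
Qed.

Lemma integral_mu0 m (A : set 'rV[R]_m.+1) (h : 'rV[R]_m.+1 -> \bar R) :
  measurable A -> measurable_fun setT h -> (forall p, 0 <= h p)%E ->
  (\int[@mu0 R m]_(p in A) h p =
   \int[lam m]_(x in @coord_domain R m `&` @chart R m @^-1` A)
     (h (chart x) * (chart_density x)%:E))%E.
Proof.
move=> mA mh h0; apply: ge0_integral_density_transfer => //.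
- exact: measurable_coord_domain.
- by apply: measurable_funTS; exact: measurable_chart.
- by apply: measurable_funTS; exact: measurable_chart_density.
- by move=> x _; exact: chart_density_ge0.
- move=> B mB; apply: eq_integral => x; rewrite inE => -[Dx _].
  by rewrite chart_densityE.
Qed.

End simplex_measure.

Section transport_density.
Context {R : realType}.
Local Notation lam := (lebesgue_rV R).
Variables (m : nat) (f : 'rV[R]_m -> R).
Hypothesis m_gt0 : (0 < m)%N.
Local Notation D := (@coord_domain R m).
Hypothesis fC2 : C2_on D f.
Hypothesis fpos : forall (x v : 'rV[R]_m), D x -> v != 0 -> 0 < (v *m curvature f x *m v^T) 0 0.
Local Notation G := (transport_coord f).

Definition density_ratio (x : 'rV[R]_m) : R :=
  let y := inv_coord x in
  \det (curvature f y) * (\prod_i chart y 0 i) ^+ 2 / \prod_i (chart y 0 i * weight f y i).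

Lemma weight_gt0 y i : D y -> 0 < weight f y i.
Proof.
move=> Dy; rewrite /weight; case: unlift => [j|].
  exact: (dual_slope_gt0 fC2 fpos).
by rewrite addr0; exact: (dual_last_gt0 fC2 fpos).
Qed.

Lemma density_ratio_gt0 x : D x -> 0 < density_ratio x.
Proof.
move=> Dx; have Dy := inv_coord_domain Dx.
have L0 : 0 < \det (curvature f (inv_coord x)) by apply: posdef_det_gt0 => v; exact: fpos.
have p0 : 0 < \prod_i chart (inv_coord x) 0 i by apply: prodr_gt0 => i _; exact: chart_gt0.
rewrite /density_ratio !mulr_gt0// ?exprn_gt0// invr_gt0; apply: prodr_gt0 => i _.
by rewrite mulr_gt0 ?chart_gt0 ?weight_gt0.
Qed.

Lemma transport_change_of_variables :
  [/\ measurable_fun D (fun x => chart_density x * density_ratio x),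
      measurable_fun D G,
      forall E, measurable E -> E `<=` D -> measurable (G @` E) &
      forall E (h : 'rV[R]_m.+1 -> \bar R), measurable E -> E `<=` D ->
        measurable_fun setT h -> (forall p, 0 <= h p)%E ->
        (\int[@mu0 R m]_(p in @chart R m @` (G @` E)) h p =
         \int[lam m]_(x in E) (h (chart (G x)) * (chart_density x * density_ratio x)%:E))%E].
Proof.
have /choice[A AP] (x : 'rV[R]_m) : exists A, D x -> [/\ strict_diff G x A, \det A != 0 &
    chart_density (G x) * `|\det A| = chart_density x * density_ratio x].
  have [Dx|nDx] := pselect (D x); last by exists 0.
  have [A [dA A0 AE]] := transport_coord_jacobian m_gt0 fC2 fpos Dx.
  exists A => _; split=> //; rewrite !chart_densityE//.
  exact: (transport_coord_domain fC2 fpos).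
have oD := @coord_domain_open R m.
have GA x : D x -> strict_diff G x (A x) by move=> /AP[].
have dA x : D x -> \det (A x) != 0 by move=> /AP[].
have Ginj := @transport_coord_inj R m f m_gt0 fC2 fpos.
have GD x : D x -> D (G x) by exact: (transport_coord_domain fC2 fpos).
have mG : measurable_fun D G.
  apply: (continuous_open_measurable oD) => x Dx.
  exact: (strict_diff_continuous (GA x Dx)).
have cov := change_of_variables oD GA dA Ginj.
have mJ : measurable_fun D (fun x => `|\det (A x)|).
  by apply/measurable_EFinP; exact: measurable_jacobian oD GA.
have mD : measurable D by exact: measurable_coord_domain.
have mK : measurable_fun D (fun x => chart_density x * density_ratio x).
  have mK' : measurable_fun D (fun x => chart_density (G x) * `|\det (A x)|).
    apply: measurable_funM => //.
    by apply: measurableT_comp => //; exact: measurable_chart_density.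
  by apply: eq_measurable_fun mK' => x; rewrite inE => /AP[].
split=> //; first by move=> E mE ED; have [] := cov _ mE ED.
move=> E h mE ED mh h0.
have [mGE _] := cov _ mE ED; have [mGD _] := cov _ mD (@subset_refl _ D).
have GED : G @` E `<=` D by move=> _ [x Ex <-]; exact/GD/ED.
rewrite integral_mu0//; last exact: measurable_chart_image.
rewrite chart_preimage_image setIidr//.
pose g y := (h (chart y) * (chart_density y)%:E)%E.
have g0 y : (0 <= g y)%E by rewrite mule_ge0// lee_fin chart_density_ge0.
have mg : measurable_fun setT g.
  apply: emeasurable_funM; first by apply: measurableT_comp => //; exact: measurable_chart.
  by apply/measurable_EFinP; exact: measurable_chart_density.
have -> : (\int[lam m]_(y in G @` E) g y = \int[mrestr (lam m) mGD]_(y in G @` E) g y)%E.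
  apply: eq_measure_integral => B mB BE; rewrite /= /mrestr setIidl//.
  by apply: subset_trans BE _; exact: image_subset.
rewrite (@ge0_integral_density_transfer _ _ _ _ _ (lam m) (mrestr (lam m) mGD) D G
  (fun x => `|\det (A x)|))//.
- have -> : D `&` G @^-1` (G @` E) = E.
    apply/seteqP; split=> [x [Dx [y Ey yx]]|x Ex].
      by rewrite -(Ginj _ _ (ED _ Ey) Dx yx).
    by split; [exact: ED|exists x].
  apply: eq_integral => x; rewrite inE => /ED /AP[_ _ <-].
  by rewrite /g -muleA -EFinM.
- move=> B mB; rewrite /= /mrestr.
  have mDB : measurable (D `&` G @^-1` B) by exact: mG.
  have -> : B `&` G @` D = G @` (D `&` G @^-1` B).
    apply/seteqP; split=> [y [By [x Dx xy]]|_ [x [Dx Bx] <-]]; last by split=> //; exists x.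
    by exists x => //; split=> //=; rewrite xy.
  by have [_ ->] := cov _ mDB (@subIsetl _ _ _).
Qed.

End transport_density.

Lemma mule_EFin_cancel (R : realType) (u v : \bar R) (d c : R) : 0 < d -> 0 < c ->
  (u * d%:E = v * (d * c)%:E)%E -> v = (u * (c^-1)%:E)%E.
Proof.
move=> d0 c0 uv; have dc0 : d * c != 0 by rewrite mulf_neq0// lt0r_neq0.
rewrite -[LHS]mule1 -(mulfV dc0) EFinM muleA -uv -muleA -EFinM; congr (_ * _%:E)%E.
by field; rewrite !lt0r_neq0.
Qed.

(* The dimension of the ambient space is n = m.+1 >= 2. *)
Theorem theorem7 (R : realType) (m : nat) (hm : (0 < m)%N)
    (P0 P1 : probability 'rV[R]_m.+1 R)
    (hP0 : log_integrable_ac P0) (hP1 : log_integrable_ac P1)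
    (phi1 : 'rV[R]_m.+1 -> R)
    (phi1_concave : exp_concave phi1)
    (T1_optimal : optimal_transport_map P0 P1 (transport_map (portfolio phi1)))
    (phi1_C2 : C2_on_simplex phi1)
    (phi1_pos : forall r v : 'rV[R]_m.+1, simplex r ->
       v != 0 -> \sum_i v 0 i = 0 -> 0 < L_form phi1 r v)
    (t : R) (ht : 0 <= t <= 1) :
  let Tt := transport_map (portfolio_interp phi1 t) in
  let Pt := simplex_image P0 Tt in
  Pt `<< @mu0 R m /\
  forall rho0 rhot : 'rV[R]_m.+1 -> \bar R,
    is_density (@mu0 R m) P0 rho0 -> is_density (@mu0 R m) Pt rhot ->
    {ae @mu0 R m, forall p, simplex p ->
       let r := simplex_inv p in
       let q := Tt p in
       let pi := portfolio_interp phi1 t r in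
       rhot q = (rho0 p *
         ((\prod_i pi 0 i) / \det (L_tilde (phi_interp phi1 t) r) *
          (\prod_i r 0 i ^+ 2)^-1)%:E)%E}.
Proof.
move=> Tt Pt.
pose f := interp_coord phi1 t; pose G := transport_coord f.
pose lam := lebesgue_rV R m; pose D := @coord_domain R m.
have fC2 : C2_on D f by exact: interp_C2.
have fpos (x v : 'rV[R]_m) : D x -> v != 0 -> 0 < (v *m curvature f x *m v^T) 0 0.
  exact: (interp_pos hm ht phi1_C2 phi1_pos).
have [mK mG mGE transfer] := transport_change_of_variables hm fC2 fpos.
pose K x := chart_density x * density_ratio f x.
have mD : measurable D by exact: measurable_coord_domain.
have GD x : D x -> D (G x) by exact: (transport_coord_domain fC2 fpos).
have K0 x : D x -> 0 < K x.
  by move=> Dx; rewrite mulr_gt0 ?chart_density_gt0// (density_ratio_gt0 hm fC2 fpos).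
have TtE x : D x -> Tt (chart x) = chart (G x).
  exact: (transport_map_chart hm ht phi1_C2 phi1_pos).
have preT (A : set 'rV[R]_m.+1) :
    @simplex R m.+1 `&` Tt @^-1` A = @chart R m @` (D `&` (@chart R m \o G) @^-1` A).
  apply/seteqP; split=> [p [Sp Ap]|_ [x [Dx Ax] <-]].
    have Dp := simplex_domain Sp; exists (drop_last p); last by rewrite -simplexP.
    by split; [exact: Dp|rewrite /preimage /= -(TtE _ Dp) -(simplexP Sp); exact: Ap].
  by split; [exact: chart_simplex|rewrite /preimage /= (TtE _ Dx); exact: Ax].
have chart_inj : injective (@chart R m) by exact: can_inj (@chartK R m).
have mcG : measurable_fun D (@chart R m \o G).
  by apply: measurableT_comp => //; exact: measurable_chart.
have mpre (A : set 'rV[R]_m.+1) : measurable A -> measurable (D `&` (@chart R m \o G) @^-1` A).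
  by move=> mA; exact: mcG.
have nullG (N : set 'rV[R]_m.+1) : measurable N -> @mu0 R m N = 0%E ->
    lam (D `&` (@chart R m \o G) @^-1` N) = 0%E.
  move=> mN N0; set E := D `&` _; have mE : measurable E by exact: mpre.
  have ED : E `<=` D by exact: subIsetl.
  apply: (@integral_gt0_null _ _ _ _ _ K) => //.
  - exact: measurable_funS mK.
  - by move=> x /ED; exact: K0.
  - have := transfer E (cst 1%E) mE ED (measurable_cst _) (fun=> lee01).
    rewrite integral_cst; last by apply: measurable_chart_image; exact: mGE.
    rewrite mul1e => i1; transitivity (@mu0 R m (@chart R m @` (G @` E))).
      by rewrite i1; apply: eq_integral => x _; rewrite mul1e.
    apply: (subset_measure0 _ mN) => //; first by apply: measurable_chart_image; exact: mGE.
    by move=> _ [_ [x [_ Nx] <-] <-].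
have nullP (E : set 'rV[R]_m) : measurable E -> E `<=` D -> lam E = 0%E ->
    P0 (@chart R m @` E) = 0%E.
  move=> mE ED E0; have [_ _ /null_content_dominatesP] := hP0; apply.
    exact: measurable_chart_image.
  rewrite /simplex_lebesgue/= /pushforward /mrestr chart_preimage_image setIidl//.
split.
  apply/null_content_dominatesP => A mA A0.
  rewrite /Pt /simplex_image preT; apply: nullP; [exact: mpre|exact: subIsetl|].
  exact: nullG.
have PtA A : Pt A = P0 (@chart R m @` (D `&` (@chart R m \o G) @^-1` A)).
  by rewrite -preT.
have Pt0 A : measurable A -> (0 <= Pt A)%E by move=> _; rewrite PtA; exact: measure_ge0.
move=> rho0 rhot d0 dt.
clearbody Pt; clearbody Tt.
have [r0 [mr0 r00 P0E [N0 [mN0 N00 r0E]]]] := density_ge0 (fun A _ => measure_ge0 P0 A) d0.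
have [rt [mrt rt0 PtE [Nt [mNt Nt0 rtE]]]] := density_ge0 Pt0 dt.
pose a x := (r0 (chart x) * (chart_density x)%:E)%E.
pose b x := (rt (chart (G x)) * (K x)%:E)%E.
have ma : measurable_fun D a.
  apply: emeasurable_funM.
    by apply: measurable_funTS; apply: measurableT_comp => //; exact: measurable_chart.
  by apply/measurable_EFinP; apply: measurable_funTS; exact: measurable_chart_density.
have mb : measurable_fun D b.
  by apply: emeasurable_funM; [exact: measurableT_comp|exact/measurable_EFinP].
have ab E : E `<=` D -> measurable E ->
    (\int[lam]_(x in E) a x = \int[lam]_(x in E) b x)%E.
  move=> ED mE; have mcE := measurable_chart_image mE.
  have mcGE := measurable_chart_image (mGE _ mE ED).
  transitivity (P0 (@chart R m @` E)).
    by rewrite P0E// integral_mu0// chart_preimage_image setIidr.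
  transitivity (Pt (@chart R m @` (G @` E))).
    rewrite PtA; congr (P0 (_ @` _)).
    apply/seteqP; split=> [x Ex|x [Dx [_ [y Ey <-]] /chart_inj yx]].
      by split; [exact: ED|exists (G x) => //; exists x].
    by rewrite -(transport_coord_inj hm fC2 fpos (ED _ Ey) Dx yx).
  rewrite (PtE _ mcGE); exact: (transfer E rt mE ED mrt rt0).
have ia : lam.-integrable D a.
  apply/integrableP; split=> //.
  have a0 x : (0 <= a x)%E by rewrite mule_ge0// lee_fin chart_density_ge0.
  under eq_integral do rewrite gee0_abs//.
  have -> : (\int[lam]_(x in D) a x = P0 (@chart R m @` D))%E.
    rewrite P0E ?integral_mu0// ?chart_preimage_image ?setIid//;
      exact: measurable_chart_image.
  by rewrite (le_lt_trans (probability_le1 _ _)) ?ltry//; exact: measurable_chart_image.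
have [M [mM M0 DM]] := integral_ae_eq mD ia mb ab.
have mchart : measurable_fun D (@chart R m).
  by apply: measurable_funTS; exact: measurable_chart.
have nullC (N : set 'rV[R]_m.+1) : measurable N -> @mu0 R m N = 0%E ->
    lam (D `&` @chart R m @^-1` N) = 0%E.
  move=> mN N0'; set E := D `&` _.
  have mE : measurable E by exact: mchart.
  have ED : E `<=` D by exact: subIsetl.
  apply: (@integral_gt0_null _ _ _ _ _ (@chart_density R m)) => //.
  - by apply: measurable_funTS; exact: measurable_chart_density.
  - by move=> x /ED; exact: chart_density_gt0.
  - rewrite -N0'; apply: eq_integral => x; rewrite inE => /ED Dx.
    by rewrite chart_densityE.
pose B := (D `&` M) `|` (D `&` @chart R m @^-1` N0) `|` (D `&` (@chart R m \o G) @^-1` Nt).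
have B1m : measurable (D `&` M) by exact: measurableI.
have B2m : measurable (D `&` @chart R m @^-1` N0) by exact: mchart.
have B3m : measurable (D `&` (@chart R m \o G) @^-1` Nt) by exact: mpre.
have mB : measurable B by exact: measurableU (measurableU _ _ B1m B2m) B3m.
have BD : B `<=` D by move=> x [[[]|[]]|[]].
have B0 : lam B = 0%E.
  have M0' : lam (D `&` M) = 0%E by apply: (subset_measure0 _ mM) => //; exact: subIsetr.
  rewrite /B (measureU0 (measurableU _ _ B1m B2m) B3m (nullG _ mNt Nt0)).
  by rewrite (measureU0 B1m B2m (nullC _ mN0 N00)).
have mcB := measurable_chart_image mB.
exists (@chart R m @` B); split; first exact: mcB.
  rewrite [LHS]/mu0 chart_preimage_image (setIidr BD).
  apply: (null_set_integral mB _ B0).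
  apply/measurable_EFinP; apply: eq_measurable_fun (measurable_funTS (@measurable_chart_density R m)).
  by move=> x; rewrite inE => /BD; exact: chart_densityE.
move=> p /= np; apply: contrapT => nB; apply: np => Sp.
pose x := drop_last p; have Dx : D x := simplex_domain Sp.
have px : p = chart x := simplexP Sp.
have nBx : ~ B x by move=> Bx; apply: nB; exists x => //; exact/esym.
have abx : a x = b x.
  by apply: contrapT => nab; apply: nBx; left; left; split=> //; apply: DM => /(_ Dx).
have r0x : rho0 (chart x) = r0 (chart x).
  by apply: r0E => N0x; apply: nBx; left; right.
have rtx : rhot (chart (G x)) = rt (chart (G x)).
  by apply: rtE => Ntx; apply: nBx; right.
have ratio0 := density_ratio_gt0 hm fC2 fpos Dx.
rewrite px (TtE _ Dx) r0x rtx (mule_EFin_cancel (chart_density_gt0 Dx) ratio0 abx).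
congr (_ * _%:E)%E.
have Dy := inv_coord_domain Dx; have [_ ->] := simplex_inv_chart Dx.
rewrite (L_tilde_chart phi1 t) /density_ratio.
under [X in _ = X / _ / _]eq_bigr do rewrite (portfolio_interp_chart t phi1_C2 _ Dy).
rewrite prodrXl !invfM invrK.
by rewrite [LHS]mulrC [LHS]mulrA.
Qed.
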